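(* There exist absolute constants $0<c\le C<\infty$ such that the following holds for all positive integers $p,m$, all $k\in\{1,\dots,p\}$, $s\in\{1,\dots,m\}$, and every unitarily invariant norm $\|\cdot\|$ on $\mathbb{R}^{p\times m}$. Let $r=\min(k,s)$, let $I_r\in\mathbb{R}^{p\times m}$ have ones on the first $r$ diagonal entries and zeros everywhere else, and let $$L_{\|\cdot\|}=\sup\{\|A\|: A\in\mathcal{F}(k,s;p,m),\ \|A\|_{\rm F}=1\}.$$ Suppose one observes $Y=M+Z$, where $M\in\mathcal{F}(k,s;p,m)$ is unknown and $Z\in\mathbb{R}^{p\times m}$ has i.i.d. $N(0,1)$ entries. Then $$c\,R\le \inf_{\widetilde M}\ \sup_{M\in\mathcal{F}(k,s;p,m)}\mathbb{E}\|\widetilde M-M\|^2\le C\,R,\qquad R=\|I_r\|^2(k+s)+L_{\|\cdot\|}^2\left(k\log\frac{e p}{k}+s\log\frac{e m}{s}\right),$$ where the infimum is over all estimators $\widetilde M=\widetilde M(Y)$.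
   Context: $\mathcal{F}(k,s;p,m)$ is the set of matrices $M\in\mathbb{R}^{p\times m}$ having at most $k$ nonzero rows and at most $s$ nonzero columns (not necessarily consecutive). $\|\cdot\|_{\rm F}$ is the Frobenius norm. A norm $\|\cdot\|$ on $\mathbb{R}^{p\times m}$ is unitarily invariant if $\|UAV\|=\|A\|$ for all $A$ and all orthogonal matrices $U\in O(p)$, $V\in O(m)$. An estimator is a measurable function of the observation $Y$ with values in $\mathbb{R}^{p\times m}$; it may depend on $p,m,k,s$ and the norm. *)

(* Defs.v *)
From HB Require Import structures.
From mathcomp Require Import all_boot all_order all_algebra.
From mathcomp Require Import all_classical all_reals all_analysis.

Set Implicit Arguments.
Unset Strict Implicit.
Unset Printing Implicit Defensive.

Import Order.TTheory GRing.Theory Num.Theory.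
Import numFieldNormedType.Exports.

Local Open Scope classical_set_scope.
Local Open Scope ring_scope.

Section matrices.
Context {R : realType}.

(* Rows and columns may be nonzero in arbitrary, not necessarily consecutive,
   positions. *)
Definition sparse_mx {p m : nat} (k s : nat) : set 'M[R]_(p, m) :=
  [set M : 'M[R]_(p, m) |
    (#|[set i | row i M != 0%R]%SET| <= k)%N /\
    (#|[set j | col j M != 0%R]%SET| <= s)%N].

Definition frobenius_norm p m (A : 'M[R]_(p, m)) : R :=
  Num.sqrt (\sum_i \sum_j A i j ^+ 2).

Definition orthogonal_mx n (U : 'M[R]_n) : Prop := U *m U^T = 1%:M.

(* Nonnegativity and N 0 = 0 follow from the three axioms. The norm is an
   explicit function because the canonical norm `|A| of 'M[R]_(p, m) is the
   entrywise maximum. *)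
Record is_norm p m (N : 'M[R]_(p, m) -> R) : Prop := IsNorm {
  norm_triangle : forall A B : 'M[R]_(p, m), N (A + B) <= N A + N B ;
  norm_scale : forall (a : R) (A : 'M[R]_(p, m)), N (a *: A) = `|a| * N A ;
  norm_definite : forall A : 'M[R]_(p, m), N A = 0 -> A = 0 }.

Definition unitarily_invariant p m (N : 'M[R]_(p, m) -> R) : Prop :=
  forall (A : 'M[R]_(p, m)) (U : 'M[R]_p) (V : 'M[R]_m),
    orthogonal_mx U -> orthogonal_mx V -> N (U *m A *m V) = N A.

(* The set is nonempty and bounded for 0 < k, 0 < s, 0 < p, 0 < m and N a norm,
   so that the real-valued [sup] is the actual supremum. *)
Definition sparse_norm_sup {p m} (k s : nat) (N : 'M[R]_(p, m) -> R) : R :=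
  sup [set N A | A in [set A | sparse_mx k s A /\ frobenius_norm A = 1]].

Definition rate {p m} (k s : nat) (N : 'M[R]_(p, m) -> R) : R :=
  N (pid_mx (minn k s)) ^+ 2 * (k + s)%N%:R +
  sparse_norm_sup k s N ^+ 2 *
    (k%:R * ln (expR 1 * p%:R / k%:R) + s%:R * ln (expR 1 * m%:R / s%:R)).

End matrices.

Definition borel_mx (R : realType) (p m : nat) :=
  g_sigma_algebraType (@open 'M[R]_(p, m)).

Definition estimator (R : realType) (p m : nat) :=
  {mfun borel_mx R p m >-> borel_mx R p m}.

Section gaussian_noise.
Context d (T : measurableType d) (R : realType) (P : probability T R).

Definition mutually_independent d' (T' : measurableType d') (I : finType)
    (X : I -> {RV P >-> T'}) : Prop :=
  forall (J : {set I}) (A : I -> set T'),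
    (forall i, i \in J -> measurable (A i)) ->
    P (\bigcap_(i in [set` J]) X i @^-1` A i) =
    (\prod_(i in J) P (X i @^-1` A i))%E.

Definition iid_standard_normal (I : finType) (X : I -> {RV P >-> R}) : Prop :=
  mutually_independent X /\
  forall i (A : set R), measurable A -> distribution P (X i) A = normal_prob 0 1 A.

Definition noise_mx {p m} (Z : 'I_p * 'I_m -> {RV P >-> R}) (w : T) :
    'M[R]_(p, m) := \matrix_(i, j) Z (i, j) w.

Definition minimax_risk {p m} (k s : nat) (N : 'M[R]_(p, m) -> R)
    (Z : 'I_p * 'I_m -> {RV P >-> R}) : \bar R :=
  ereal_inf [set
    ereal_sup [set ('E_P[fun w => (N (est (M + noise_mx Z w) - M) ^+ 2)%R])%E
              | M in sparse_mx k s]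
    | est in [set: estimator R p m]].

End gaussian_noise.

(* Main.v *)
(* Lower bound. For a uniform prior on a finite family M_o, the Bayes risk is
   bounded below by the distances N(M_o - M_o') weighted by the overlaps
   E[L_o L_o' / sum L] of the Gaussian likelihoods. Random signs on a k x s block
   give N(I_r)^2 (k + s). For the logarithmic term, take a k-row matrix of nearly
   maximal norm, rotate it so that all its rows have the same length (this does
   not change the norm), and put each row independently at one of about p/k
   positions; transposition exchanges the roles of rows and columns.

   Upper bound. Keep the entries of Y in the support (K, S) for which the residual
   has the smallest maximal norm over all other restrictions; the loss is then at
   most 12 times the maximum of N(Z_(K,S)) over supports of size k x s. The
   singular values of Z_(K,S) below a multiple of sqrt(k + s) cost
   N(I_r)^2 (k + s). If j of them are larger, then j (k + s) is dominated by the
   square of their Frobenius norm, which is tested against a net of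
   exp(O(j (k + s))) matrices of rank j and norm at most 1; the entropy of the net
   is thus paid for and the union bound only costs the logarithms of the numbers
   of supports. *)

Require Import Defs.
From HB Require Import structures.
From mathcomp Require Import all_boot all_order all_algebra fingroup perm.
From mathcomp Require Import all_classical all_reals all_analysis.
From mathcomp Require Import measurable_realfun.
From mathcomp Require Import ring lra zify.

Set Implicit Arguments.
Unset Strict Implicit.
Unset Printing Implicit Defensive.

Import Order.TTheory GRing.Theory Num.Theory.
Import numFieldNormedType.Exports.

Local Open Scope classical_set_scope.
Local Open Scope ring_scope.

(** * Measures on matrix spaces *)

(** The squared loss is linearised by [2 * a * l <= l ^+ 2 + a ^+ 2], so the Bayes argument only
    meets first moments, which the triangle inequality controls. Both priors are sums of
    independent, mutually orthogonal pieces: likelihoods factor, and the overlap summed over the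
    hypotheses that differ from a given one at one piece is the overlap of that one-piece problem.
    An arbitrary [N] cannot be converted into a Hamming distance; instead a weighted sum of norms is
    bounded below by the norm of the weighted sum, whose coefficients are the one-piece overlaps,
    and contraction by diagonal matrices compares that sum with the full matrix. Equal row lengths
    make every coefficient at least 1/4; a longer row would be identifiable and its coefficient
    could degenerate. If [p / k] is bounded, its logarithm is absorbed by the sign bound because
    [L <= N I_r]. In the upper bound the net need not approximate a matrix, only correlate with it
    by a constant factor. The factor 12 is 4 pieces of the error times 3, where 3 is one restriction
    of the noise plus two from the criterion. *)

Section density.
Local Open Scope ereal_scope.
Context d (T : measurableType d) (R : realType).
Variables (mu : {measure set T -> \bar R}) (h : T -> R).
Hypotheses (mh : measurable_fun setT h) (h0 : forall x, (0 <= h x)%R).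

Definition mdensity (A : set T) := \int[mu]_(x in A) (h x)%:E.

Let mdensity0 : mdensity set0 = 0.
Proof. by rewrite /mdensity integral_set0. Qed.

Let mdensity_ge0 A : 0 <= mdensity A.
Proof. by apply: integral_ge0 => x _; rewrite lee_fin. Qed.

Let mdensity_sigma_additive : semi_sigma_additive mdensity.
Proof.
move=> F mF tF mUF; rewrite /mdensity ge0_integral_bigcup//=.
- apply: is_cvg_ereal_nneg_natsum_cond => n _ _.
  exact: mdensity_ge0.
- by apply/measurable_EFinP; exact: measurable_funTS.
- by move=> x _; rewrite lee_fin.
Qed.

HB.instance Definition _ := isMeasure.Build _ _ _
  mdensity mdensity0 mdensity_ge0 mdensity_sigma_additive.

Import HBNNSimple.

Let ge0_integral_mdensity (f : T -> \bar R) :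
  measurable_fun setT f -> (forall x, 0 <= f x) ->
  \int[mdensity]_x f x = \int[mu]_x (f x * (h x)%:E).
Proof.
move=> mf f0; pose f_ := nnsfun_approx measurableT mf.
have cvgf x : (EFin \o f_^~ x) @ \oo --> f x by apply: cvg_nnsfun_approx.
transitivity (limn (fun n => \int[mdensity]_x (f_ n x)%:E)).
  rewrite -monotone_convergence//.
  - by apply: eq_integral => x _; apply/esym/cvg_lim => //; exact: cvgf.
  - by move=> n; exact/measurable_EFinP.
  - by move=> n x _; rewrite lee_fin.
  - by move=> x _ a b ab; rewrite lee_fin; exact/lefP/nd_nnsfun_approx.
transitivity (limn (fun n => \int[mu]_x ((f_ n x)%:E * (h x)%:E))); last first.
  rewrite -monotone_convergence//.
  - apply: eq_integral => x _; apply/cvg_lim => //.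
    rewrite [f x * _]muleC.
    under eq_fun do rewrite muleC.
    by apply: cvgeZl => //; exact: cvgf.
  - by move=> n; apply/measurable_EFinP/measurable_funM.
  - by move=> n x _; rewrite lee_fin mulr_ge0.
  - move=> x _ a b ab; rewrite lee_fin ler_wpM2r//.
    exact/lefP/nd_nnsfun_approx.
congr (limn _); apply/funext => n.
under [LHS]eq_integral do rewrite fimfunE// -fsumEFin//.
rewrite ge0_integral_fsum//; last 2 first.
  - by move=> r; exact/measurable_EFinP/measurableT_comp.
  - by move=> r x _; rewrite nnfun_muleindic_ge0.
under eq_fsbigr do rewrite integralZl_indic_nnsfun//.
transitivity (\int[mu]_x (\sum_(r \in range (f_ n)) (r * \1_(f_ n @^-1` [set r]) x * h x)%:E)).
  rewrite ge0_integral_fsum//; last 2 first.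
  - by move=> r; apply/measurable_EFinP/measurable_funM => //; exact/measurableT_comp.
  - move=> r x _; rewrite EFinM mule_ge0 ?lee_fin// -lee_fin EFinM nnfun_muleindic_ge0//.
  apply: eq_fsbigr => r /set_mem [x _ <-] /=.
  rewrite integral_indic// setIT.
  rewrite [X in _ * X = _](_ : _ = \int[mu]_(y in f_ n @^-1` [set f_ n x]) (h y)%:E)//.
  rewrite [in LHS]integral_mkcond.
  rewrite -ge0_integralZl//; last 3 first.
  - apply/measurable_restrict => //; first by rewrite setTI; exact/measurable_EFinP/measurable_funTS.
  - by move=> y _; rewrite patchE; case: ifPn => // _; rewrite lee_fin.
  - by rewrite lee_fin.
  apply: eq_integral => y _; rewrite patchE indicE.
  by case: ifPn => _; rewrite ?mulr1 ?mulr0 ?mul0r ?mule0// EFinM.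
apply: eq_integral => x _; rewrite -EFinM [in RHS](fimfunE (f_ n)).
rewrite fsumEFin//; congr EFin.
by rewrite !fsbig_finite//= big_distrl.
Qed.

(** Both equations are packed in an existence statement, so that later changes of measure are done
    by comparing two measures on a generating family. The integral formula passes from simple
    functions to the limit by monotone convergence. *)
Lemma density_measure_ex : exists nu : {measure set T -> \bar R},
  (forall A, nu A = \int[mu]_(x in A) (h x)%:E) /\
  forall f, measurable_fun setT f -> (forall x, 0 <= f x) ->
    \int[nu]_x f x = \int[mu]_x (f x * (h x)%:E).
Proof. by exists mdensity; split => //; exact: ge0_integral_mdensity. Qed.

End density.

Lemma pushforward_measure_ex d d' (T : measurableType d) (T' : measurableType d')
    (R : realType) (mu : {measure set T -> \bar R}) (g : T -> T') :
  measurable_fun setT g ->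
  exists nu : {measure set T' -> \bar R}, (forall A, nu A = mu (g @^-1` A)) /\
    forall f, measurable_fun setT f -> (forall x, (0 <= f x)%E) ->
      (\int[nu]_x f x = \int[mu]_x f (g x))%E.
Proof.
move=> mg; unshelve eexists; first (refine (pushforward mu g : {measure set T' -> \bar R}); exact: mg).
split => // f mf f0.
by rewrite (ge0_integral_pushforward mg).
Qed.

Section borel_matrices.
Context (R : realType) (p m : nat).
Local Notation mx := (borel_mx R p m).

Definition mxbox (A : 'I_p -> 'I_m -> set R) : set 'M[R]_(p, m) :=
  [set X | forall i j, A i j (X i j)].

Lemma mxboxE A : mxbox A =
  \bigcap_(i in [set: 'I_p]) \bigcap_(j in [set: 'I_m])
     (fun X : 'M[R]_(p, m) => X i j) @^-1` A i j.
Proof.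
by apply/seteqP; split => X; [move=> AX i _ j _; exact: AX|
  move=> AX i j; exact: AX].
Qed.

Let ratbox (ab : 'M[rat]_(p, m) * 'M[rat]_(p, m)) : set 'M[R]_(p, m) :=
  mxbox (fun i j => `](ratr (ab.1 i j)), (ratr (ab.2 i j))[%classic).

(** The balls of the entrywise maximum norm are boxes, so each point of an open set has a rational
    box around it inside the set. The countability of rational boxes is what makes the Borel sets
    generated by products of measurable sets. *)
Lemma open_mx_ratbox (U : set 'M[R]_(p, m)) : open U ->
  U = \bigcup_ab (if `[< ratbox ab `<=` U >] then ratbox ab else set0).
Proof.
move=> oU; apply/seteqP; split => [X UX|X [ab _]]; last first.
  by case: asboolP => // sU /sU.
have := open_nbhs_nbhs (conj oU UX); rewrite -nbhs_ballE => -[e /= e0 sU].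
have ex i j : exists ab : rat * rat, (X i j - e < ratr ab.1 < X i j) /\
    (X i j < ratr ab.2 < X i j + e).
  have [a ha] := @rat_in_itvoo R (X i j - e) (X i j) (ltac:(lra)).
  have [b hb] := @rat_in_itvoo R (X i j) (X i j + e) (ltac:(lra)).
  by exists (a, b); rewrite !in_itv/= in ha hb.
have {}ex ij : exists ab : rat * rat, (X ij.1 ij.2 - e < ratr ab.1 < X ij.1 ij.2) /\
    (X ij.1 ij.2 < ratr ab.2 < X ij.1 ij.2 + e) by exact: ex.
have [f fP] := boolp.choice ex.
exists (\matrix_(i, j) (f (i, j)).1, \matrix_(i, j) (f (i, j)).2) => //.
rewrite asboolT.
  move=> i j; rewrite /= !mxE in_itv/=.
  by have [/andP[_ ->] /andP[-> _]] := fP (i, j).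
move=> Y Yf; apply: sU; split => // i j.
have := Yf i j; rewrite /= !mxE in_itv/=.
have [/andP[/= h1 _] /andP[/= _ h2]] := fP (i, j) => /andP[h3 h4].
by rewrite /ball /= ltr_distlC; apply/andP; split; lra.
Qed.

Lemma continuous_measurable_mx (f : 'M[R]_(p, m) -> R) :
  continuous f -> measurable_fun setT (f : mx -> R).
Proof.
move=> cf; apply: (measurability _ (RGenOpens.measurableE R)).
move=> _ [_ [a [b ->]] <-]; rewrite setTI.
apply: sub_sigma_algebra; apply: open_comp; last exact: interval_open.
by move=> X _; exact: cf.
Qed.

Lemma measurable_mxcoord i j :
  measurable_fun setT (fun X : mx => X i j : R).
Proof. by apply: continuous_measurable_mx => X; exact: coord_continuous. Qed.

Lemma measurable_mxbox A : (forall i j, measurable (A i j)) ->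
  measurable (mxbox A : set mx).
Proof.
move=> mA; rewrite mxboxE.
rewrite bigcap_mkcond; apply: fin_bigcap_measurable => // i _.
rewrite mem_setT; apply: fin_bigcap_measurable => // j _.
by rewrite -[X in measurable X]setTI; apply: measurable_mxcoord.
Qed.

Definition mxboxes : set (set mx) :=
  [set B | exists2 A, (forall i j, measurable (A i j)) & B = mxbox A].

Lemma measurable_mxboxesE : @measurable _ mx = <<s mxboxes >>.
Proof.
apply/seteqP; split; last first.
  apply: smallest_sub; first exact: sigma_algebra_measurable.
  by move=> _ [A mA ->]; exact: measurable_mxbox.
apply: smallest_sub; first exact: smallest_sigma_algebra.
move=> U oU; rewrite (open_mx_ratbox oU).
apply: (@countable_bigcupT_measurable _ (g_sigma_algebraType mxboxes)) => // ab.
case: asboolP => _; last exact: measurable0.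
apply: sub_sigma_algebra; eexists; last reflexivity.
by move=> i j; exact: measurable_itv.
Qed.

Lemma measurable_funmx d (T : measurableType d) (f : T -> mx) :
  (forall i j, measurable_fun setT (fun x => f x i j : R)) ->
  measurable_fun setT f.
Proof.
move=> mf; apply: (measurability _ measurable_mxboxesE).
move=> _ [_ [A mA ->] <-]; rewrite setTI mxboxE !preimage_bigcap.
rewrite bigcap_mkcond; apply: fin_bigcap_measurable => // i _.
rewrite mem_setT preimage_bigcap; apply: fin_bigcap_measurable => // j _.
by rewrite -[X in measurable X]setTI; apply: mf.
Qed.

(** Boxes form a generating family stable under intersection. They are also the sets on which
    independence of the entries gives an explicit value. *)
Lemma borel_mx_measure_unique (m1 m2 : {measure set mx -> \bar R}) :
  (m1 setT < +oo)%E ->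
  (forall A, (forall i j, measurable (A i j)) -> m1 (mxbox A) = m2 (mxbox A)) ->
  forall B, measurable B -> m1 B = m2 B.
Proof.
move=> m1oo m12; apply: (measure_unique mxboxes (fun=> setT)).
- exact: measurable_mxboxesE.
- move=> _ _ [A mA ->] [B mB ->]; exists (fun i j => A i j `&` B i j).
    by move=> i j; exact: measurableI.
  apply/seteqP; split => X; first by move=> [AX BX] i j; split.
  by move=> ABX; split => i j; have [] := ABX i j.
- by move=> _; exists (fun _ _ => setT) => //; apply/seteqP; split.
- by apply/seteqP; split => // X _; exists 0%N.
- by move=> _ [A mA ->]; exact: m12.
- by [].
Qed.

End borel_matrices.

(** * The Cameron-Martin formula *)

Section gaussian_shift.
Context (R : realType).
Local Notation lambda := (@lebesgue_measure R).
Local Notation phi := (@normal_pdf R 0 1).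
Local Notation gamma := (@normal_prob R 0 1).

Let mphi : measurable_fun setT phi. Proof. exact: measurable_normal_pdf. Qed.
Let phi_ge0 x : 0 <= phi x. Proof. exact: normal_pdf_ge0. Qed.

Lemma ge0_integral_std_normal (f : R -> \bar R) :
  measurable_fun setT f -> (forall x, (0 <= f x)%E) ->
  (\int[gamma]_x f x = \int[lambda]_x (f x * (phi x)%:E))%E.
Proof.
move=> mf f0; have [nu [nuE nuf]] := density_measure_ex lambda mphi phi_ge0.
by rewrite -nuf//; apply: eq_measure_integral => A mA _; rewrite nuE.
Qed.

Lemma ge0_integral_lebesgue_shift (f : R -> \bar R) (a : R) :
  measurable_fun setT f -> (forall x, (0 <= f x)%E) ->
  (\int[lambda]_x f (x + a)%R = \int[lambda]_x f x)%E.
Proof.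
move=> mf f0.
have ms : measurable_fun setT (fun x : measurableTypeR R => (x + a : measurableTypeR R)).
  by apply: measurable_funD.
have [nu [nuE nuf]] := pushforward_measure_ex lambda ms.
rewrite -nuf//; apply: eq_measure_integral => A mA _.
apply/esym; apply: lebesgue_measure_unique => //= _ [[x y]] _ <-.
rewrite nuE [X in _ = lebesgue_measure X](_ : _ = `](x - a), (y - a)]%classic); last first.
  by apply/seteqP; split => z /=; rewrite !in_itv/= => /andP[h1 h2]; apply/andP; split; lra.
rewrite !lebesgue_measure_itv/= !lte_fin ltrD2r.
by case: ifP => // _; rewrite -!EFinB; congr EFin; lra.
Qed.

(** Completing the square: [expR (a * x - a ^+ 2 / 2)] times the standard density at [x] is the
    density at [x - a]; the rest is translation invariance of Lebesgue measure. *)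
Lemma std_normal_shift (a : R) (A : set R) : measurable A ->
  gamma ((fun x => x + a) @^-1` A) =
  (\int[gamma]_x ((\1_A x)%:E * (expR (a * x - a ^+ 2 / 2))%:E))%E.
Proof.
move=> mA; rewrite ge0_integral_std_normal//; last first.
- apply: emeasurable_funM; first by apply/measurable_EFinP.
  apply/measurable_EFinP/measurableT_comp => //.
  by apply: measurable_funB => //; exact: measurable_funM.
rewrite -[RHS](ge0_integral_lebesgue_shift a)//; last 2 first.
- apply: emeasurable_funM; last exact/measurable_EFinP.
  apply: emeasurable_funM; first by apply/measurable_EFinP.
  apply/measurable_EFinP/measurableT_comp => //.
  by apply: measurable_funB => //; exact: measurable_funM.
- by move=> x; rewrite !mule_ge0// ?lee_fin// expR_ge0.
rewrite /gamma integral_mkcond; apply: eq_integral => x _.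
rewrite patchE; have -> : (x \in (fun x => x + a) @^-1` A) = (x + a \in A).
  by apply/idP/idP => /set_mem ?; apply/mem_set.
rewrite indicE; case: ifP => _ /=; last by rewrite !mul0e.
rewrite mul1e -EFinM; congr EFin.
rewrite !normal_pdfE ?oner_neq0// mulrCA; congr (_ * _).
rewrite /normal_fun -expRD; congr expR.
by rewrite !subr0; field.
Qed.

End gaussian_shift.

Definition mxdot (R : realType) p m (A B : 'M[R]_(p, m)) : R :=
  \sum_i \sum_j A i j * B i j.

Section cameron_martin.
Context d (T : measurableType d) (R : realType) (P : probability T R).
Context (p m : nat) (Z : 'I_p * 'I_m -> {RV P >-> R}).
Hypothesis iidZ : iid_standard_normal Z.
Local Notation mx := (borel_mx R p m).
Local Notation gamma := (@normal_prob R 0 1).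

Lemma measurable_noise : measurable_fun setT (noise_mx Z : T -> mx).
Proof.
apply: measurable_funmx => i j; rewrite [X in measurable_fun _ X](_ : _ = (Z (i, j) : T -> R)).
  exact: measurable_funP.
by apply/funext => w; rewrite mxE.
Qed.

Let offcell (ij : 'I_p * 'I_m) (A : 'I_p -> 'I_m -> set R) : set T :=
  \bigcap_(kl in [set` [set~ ij]%SET]) Z kl @^-1` A kl.1 kl.2.

Let measurable_preZ ij (A : set R) : measurable A -> measurable (Z ij @^-1` A).
Proof. by move=> mA; rewrite -[X in measurable X]setTI; exact: measurable_funP. Qed.

Let measurable_offcell ij A : (forall i j, measurable (A i j)) ->
  measurable (offcell ij A).
Proof.
move=> mA; apply: fin_bigcap_measurable => // kl _.
exact: measurable_preZ.
Qed.

Let indep_cell ij A (B : set R) : (forall i j, measurable (A i j)) ->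
  measurable B ->
  P (Z ij @^-1` B `&` offcell ij A) = (P (offcell ij A) * gamma B)%E.
Proof.
move=> mA mB; have [ind law] := iidZ.
pose A' kl := if kl == ij then B else A kl.1 kl.2.
have mA' kl : measurable (A' kl) by rewrite /A'; case: ifP.
have -> : Z ij @^-1` B `&` offcell ij A =
    \bigcap_(kl in [set` [set: 'I_p * 'I_m]%SET]) Z kl @^-1` A' kl.
  apply/seteqP; split => w.
    move=> [Bw Aw] kl _; rewrite /A' /=; case: eqVneq => [->//|ne].
    by apply: Aw => /=; rewrite !inE.
  move=> Aw; split.
    by have /= := Aw ij; rewrite /A' eqxx; apply; rewrite inE.
  move=> kl /=; rewrite !inE => ne.
  by have /= := Aw kl; rewrite /A' (negbTE ne); apply; rewrite inE.
have -> : offcell ij A = \bigcap_(kl in [set` [set~ ij]%SET]) Z kl @^-1` A' kl.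
  apply: eq_bigcapr => kl /=; rewrite !inE => ne.
  by rewrite /A' (negbTE ne).
rewrite !ind//.
rewrite (bigD1 ij) ?inE//= [A' ij]/A' eqxx muleC.
rewrite -[P (Z ij @^-1` B)]/(distribution P (Z ij) B) law//; congr (_ * _)%E.
by apply: eq_bigl => kl; rewrite !inE.
Qed.

Let integral_cell ij A (f : R -> \bar R) : (forall i j, measurable (A i j)) ->
  measurable_fun setT f -> (forall x, (0 <= f x)%E) ->
  (\int[P]_(w in offcell ij A) f (Z ij w) = P (offcell ij A) * \int[gamma]_x f x)%E.
Proof.
move=> mA mf f0; have mC := measurable_offcell ij mA.
have m1C : measurable_fun setT (\1_(offcell ij A) : T -> R) by [].
have p1C w : 0 <= (\1_(offcell ij A) w : R) by rewrite indicE.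
(* [nu] is [P] restricted to the event on the other cells. By independence its image under the
   remaining entry is a multiple of the Gaussian law. *)
have [nu [nuE nuf]] := density_measure_ex P m1C p1C.
have mZ : measurable_fun setT (Z ij : T -> measurableTypeR R).
  by move=> mD B mB; exact: (measurable_funP (Z ij) mD B mB).
have [nu' [nuE' nuf']] := pushforward_measure_ex nu mZ.
have fP : P (offcell ij A) \is a fin_num by exact: fin_num_measure.
have rge0 : (0 <= fine (P (offcell ij A)))%R by exact: fine_ge0.
transitivity (\int[nu']_x f x)%E.
  rewrite nuf'// nuf//; last exact: measurableT_comp.
  rewrite [LHS]integral_mkcond; apply: eq_integral => w _.
  by rewrite patchE indicE; case: ifP => _; rewrite ?mule1 ?mule0.
transitivity (\int[mscale (NngNum rge0) gamma]_x f x)%E.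
  apply: eq_measure_integral => B mB _.
  rewrite nuE' nuE; transitivity (P (offcell ij A) * gamma B)%E; last first.
    by rewrite -[in LHS](fineK fP).
  rewrite -indep_cell// integral_indic; [by rewrite setIC|exact: measurable_preZ|by []].
by rewrite ge0_integral_mscale//= fineK.
Qed.

(** The law of the shifted noise and the reweighted law of the noise are compared on boxes, where
    independence splits off the other entries and leaves [std_normal_shift]. *)
Lemma cameron_martin_cell i0 j0 (a : R) (f : mx -> \bar R) :
  measurable_fun setT f -> (forall X, (0 <= f X)%E) ->
  (\int[P]_w f (noise_mx Z w + a *: delta_mx i0 j0)%R =
   \int[P]_w (f (noise_mx Z w) *
      (expR (a * noise_mx Z w i0 j0 - a ^+ 2 / 2))%:E))%E.
Proof.
move=> mf f0; pose ij := (i0, j0).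
have mg : measurable_fun setT (fun w => noise_mx Z w + a *: delta_mx i0 j0 : mx).
  apply: measurable_funmx => i j.
  rewrite [X in measurable_fun _ X](_ : _ = (fun w => Z (i, j) w + a *+ ((i == i0) && (j == j0)) : R)).
    by apply: measurable_funD => //; exact: measurable_funP.
  by apply/funext => w; rewrite !mxE mulr_natr.
have mh : measurable_fun setT (fun w => expR (a * Z ij w - a ^+ 2 / 2)).
  apply: measurableT_comp => //; apply: measurable_funB => //.
  by apply: measurable_funM => //; exact: measurable_funP.
have h0 w : 0 <= expR (a * Z ij w - a ^+ 2 / 2) by exact: expR_ge0.
have [mu1 [mu1E mu1f]] := pushforward_measure_ex P mg.
have [nu [nuE nuf]] := density_measure_ex P mh h0.
have [mu2 [mu2E mu2f]] := pushforward_measure_ex nu measurable_noise.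
rewrite -mu1f// [RHS](_ : _ = \int[mu2]_x f x)%E; last first.
  rewrite mu2f// nuf//; first by apply: eq_integral => w _; rewrite !mxE.
  exact: (measurableT_comp mf measurable_noise).
apply: eq_measure_integral => B mB _.
apply: borel_mx_measure_unique mB; first by rewrite mu1E -ge0_fin_numE// fin_num_measure// preimage_setT.
move=> A mA; rewrite mu1E mu2E nuE.
have -> : noise_mx Z @^-1` mxbox A = Z ij @^-1` A i0 j0 `&` offcell ij A.
  apply/seteqP; split => w.
    move=> Aw; split; first by have := Aw i0 j0; rewrite mxE.
    by move=> [k l] /= _; have := Aw k l; rewrite mxE.
  move=> [Aw1 Aw2] k l; rewrite mxE.
  have [[-> ->]//|ne] := eqVneq (k, l) ij.
  by apply: (Aw2 (k, l)); rewrite /= !inE.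
have -> : (fun w => noise_mx Z w + a *: delta_mx i0 j0) @^-1` mxbox A =
   Z ij @^-1` ((fun x => x + a) @^-1` A i0 j0) `&` offcell ij A.
  apply/seteqP; split => w.
    move=> Aw; split; first by have := Aw i0 j0; rewrite !mxE !eqxx mulr1.
    move=> [k l] /=; rewrite !inE => ne; have := Aw k l; rewrite !mxE.
    suff -> : (k == i0) && (l == j0) = false by rewrite mulr0 addr0.
    by apply/negP => /andP[/eqP kE /eqP lE]; move: ne; rewrite kE lE eqxx.
  move=> [Aw1 Aw2] k l; rewrite !mxE.
  have [[-> ->]|ne] := eqVneq (k, l) ij; first by rewrite !eqxx mulr1.
  rewrite (_ : (k == i0) && (l == j0) = false) ?mulr0 ?addr0.
    by apply: (Aw2 (k, l)); rewrite /= !inE.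
  by apply/negP => /andP[/eqP kE /eqP lE]; move: ne; rewrite kE lE eqxx.
have ms : measurable ((fun x : R => x + a) @^-1` A i0 j0).
  rewrite -[X in measurable X]setTI.
  have : measurable_fun setT (fun x : R => x + a) by apply: measurable_funD.
  by apply => //; exact: mA.
transitivity (P (offcell ij A) * gamma ((fun x : R => (x + a)%R) @^-1` A i0 j0))%E.
  exact: indep_cell.
rewrite std_normal_shift//.
pose g x : \bar R := ((\1_(A i0 j0) x)%:E * (expR (a * x - a ^+ 2 / 2))%:E)%E.
rewrite -(integral_cell ij (f := g)) => //; last 2 first.
- apply: emeasurable_funM; first exact/measurable_EFinP.
  apply/measurable_EFinP/measurableT_comp => //.
  by apply: measurable_funB => //; exact: measurable_funM.
- by move=> x; rewrite /g mule_ge0// lee_fin ?expR_ge0.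
rewrite setIC [RHS]integral_mkcondr; apply: eq_integral => w _.
rewrite /g patchE indicE.
have -> : (w \in Z ij @^-1` A i0 j0) = (Z ij w \in A i0 j0).
  by apply/idP/idP => /set_mem ?; apply/mem_set.
by case: ifP => _; rewrite ?mul1e ?mul0e.
Qed.

Lemma measurable_mxtranslate (M : 'M[R]_(p, m)) :
  measurable_fun setT (fun X : mx => X + M : mx).
Proof.
apply: measurable_funmx => i j.
rewrite [X in measurable_fun _ X](_ : _ = (fun X : mx => X i j + M i j : R)).
  by apply: measurable_funD => //; exact: measurable_mxcoord.
by apply/funext => X; rewrite mxE.
Qed.

Let cellsum (M : 'M[R]_(p, m)) (s : seq ('I_p * 'I_m)) : 'M[R]_(p, m) :=
  \sum_(ij <- s) M ij.1 ij.2 *: delta_mx ij.1 ij.2.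

Let cameron_martin_seq (M : 'M[R]_(p, m)) (s : seq ('I_p * 'I_m)) :
  uniq s -> forall f : mx -> \bar R,
  measurable_fun setT f -> (forall X, (0 <= f X)%E) ->
  (\int[P]_w f (noise_mx Z w + cellsum M s)%R =
   \int[P]_w (f (noise_mx Z w) *
      (expR (\sum_(ij <- s) (M ij.1 ij.2 * noise_mx Z w ij.1 ij.2 -
                             M ij.1 ij.2 ^+ 2 / 2)))%:E))%E.
Proof.
elim: s => [_ f mf f0|[i j] s IH /= /andP[nis us] f mf f0].
  by apply: eq_integral => w _; rewrite /cellsum !big_nil addr0 expR0 mule1.
pose h (X : mx) : R := expR (M i j * X i j - M i j ^+ 2 / 2).
have mh : measurable_fun setT h.
  apply: measurableT_comp => //; apply: measurable_funB => //.
  by apply: measurable_funM => //; exact: measurable_mxcoord.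
(* The new cell is not among those already shifted, so its density factor takes the same value
   before and after the shift by [cellsum M s]. *)
have S0 : cellsum M s i j = 0.
  rewrite /cellsum summxE big_seq big1// => kl kls.
  rewrite !mxE; case: andP => [[/eqP ek /eqP el]|]; last by rewrite mulr0.
  by move: nis; rewrite ek el -surjective_pairing kls.
transitivity (\int[P]_w ((fun X => f X * (h X)%:E) (noise_mx Z w + cellsum M s)%R))%E.
  rewrite (_ : (fun w => _) = (fun w => (fun X => f (X + cellsum M s)%R)
      (noise_mx Z w + M i j *: delta_mx i j)%R)); last first.
    apply/funext => w; rewrite /cellsum big_cons /=; congr f.
    by rewrite addrA.
  rewrite (@cameron_martin_cell i j (M i j) (fun X => f (X + cellsum M s))); last 2 first.
  - exact: (measurableT_comp mf (measurable_mxtranslate _)).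
  - by move=> X; exact: f0.
  apply: eq_integral => w _; congr (_ * _)%E; rewrite /h.
  by rewrite [(noise_mx Z w + _) i j]mxE S0 addr0.
rewrite (IH us (fun X => f X * (h X)%:E)%E); last 2 first.
- by apply: emeasurable_funM => //; exact/measurable_EFinP.
- by move=> X; rewrite mule_ge0// lee_fin expR_ge0.
apply: eq_integral => w _; rewrite big_cons /= -muleA -EFinM /h -expRD.
by [].
Qed.

Lemma cameron_martin (M : 'M[R]_(p, m)) (f : mx -> \bar R) :
  measurable_fun setT f -> (forall X, (0 <= f X)%E) ->
  (\int[P]_w f (M + noise_mx Z w)%R =
   \int[P]_w (f (noise_mx Z w) *
      (expR (mxdot M (noise_mx Z w) - mxdot M M / 2))%:E))%E.
Proof.
move=> mf f0.
have := cameron_martin_seq M (index_enum_uniq ('I_p * 'I_m)%type) mf f0.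
rewrite /cellsum -(pair_bigA _ (fun i j => M i j *: delta_mx i j))/=.
rewrite -matrix_sum_delta => e.
transitivity (\int[P]_w f (noise_mx Z w + M)%R)%E.
  by apply: eq_integral => w _; rewrite addrC.
rewrite e; apply: eq_integral => w _; congr (_ * (expR _)%:E)%E.
rewrite -(pair_bigA _ (fun i j => M i j * noise_mx Z w i j - M i j ^+ 2 / 2))/=.
rewrite /mxdot mulr_suml -sumrB; apply: eq_bigr => i _.
by rewrite mulr_suml -sumrB; apply: eq_bigr => j _; rewrite expr2.
Qed.

(** The Gaussian Laplace transform: [cameron_martin] for a constant function. *)
Lemma integral_mxdot_expR (M : 'M[R]_(p, m)) :
  (\int[P]_w (expR (mxdot M (noise_mx Z w)))%:E = (expR (mxdot M M / 2))%:E)%E.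
Proof.
pose c : \bar R := (expR (mxdot M M / 2))%:E.
transitivity (\int[P]_w (fun=> c) (M + noise_mx Z w)%R)%E; last first.
  transitivity (\int[P]_w (cst c w))%E; first by [].
  by rewrite integral_cst// -[RHS]mule1; congr (_ * _)%E; exact: probability_setT.
rewrite (@cameron_martin M (fun=> c))//; last by move=> _; rewrite lee_fin expR_ge0.
by apply: eq_integral => w _; rewrite /c -EFinM -expRD addrC subrK.
Qed.

End cameron_martin.

(** * The Frobenius inner product and the singular value decomposition *)

Section mxdot_theory.
Context (R : realType).

Lemma mxdotE p m (A B : 'M[R]_(p, m)) : mxdot A B = \tr (A *m B^T).
Proof.
rewrite /mxdot /mxtrace; apply: eq_bigr => i _; rewrite mxE.
by apply: eq_bigr => j _; rewrite mxE.
Qed.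

Lemma mxdotC p m (A B : 'M[R]_(p, m)) : mxdot A B = mxdot B A.
Proof. by apply: eq_bigr => i _; apply: eq_bigr => j _; rewrite mulrC. Qed.

Lemma mxdotDl p m (A B C : 'M[R]_(p, m)) : mxdot (A + B) C = mxdot A C + mxdot B C.
Proof. by rewrite !mxdotE mulmxDl linearD. Qed.

Lemma mxdotZl p m a (A C : 'M[R]_(p, m)) : mxdot (a *: A) C = a * mxdot A C.
Proof. by rewrite !mxdotE -scalemxAl linearZ. Qed.

Lemma mxdotNl p m (A C : 'M[R]_(p, m)) : mxdot (- A) C = - mxdot A C.
Proof. by rewrite -scaleN1r mxdotZl mulN1r. Qed.

Lemma mxdotBl p m (A B C : 'M[R]_(p, m)) : mxdot (A - B) C = mxdot A C - mxdot B C.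
Proof. by rewrite mxdotDl mxdotNl. Qed.

Lemma mxdotDr p m (A B C : 'M[R]_(p, m)) : mxdot C (A + B) = mxdot C A + mxdot C B.
Proof. by rewrite !(mxdotC C) mxdotDl. Qed.

Lemma mxdotZr p m a (A C : 'M[R]_(p, m)) : mxdot C (a *: A) = a * mxdot C A.
Proof. by rewrite !(mxdotC C) mxdotZl. Qed.

Lemma mxdotBr p m (A B C : 'M[R]_(p, m)) : mxdot C (A - B) = mxdot C A - mxdot C B.
Proof. by rewrite !(mxdotC C) mxdotBl. Qed.

Lemma mxdot0l p m (A : 'M[R]_(p, m)) : mxdot 0 A = 0.
Proof. by rewrite mxdotE mul0mx linear0. Qed.

Lemma mxdot_suml p m (I : Type) (r : seq I) (Q : pred I) (F : I -> 'M[R]_(p, m)) A :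
  mxdot (\sum_(i <- r | Q i) F i) A = \sum_(i <- r | Q i) mxdot (F i) A.
Proof.
apply: (big_morph (fun X => mxdot X A) (id1 := 0)) => [X Y|]; first exact: mxdotDl.
exact: mxdot0l.
Qed.

Lemma mxdot_mull p q m (U : 'M[R]_(p, q)) A (B : 'M[R]_(p, m)) :
  mxdot (U *m A) B = mxdot A (U^T *m B).
Proof. by rewrite !mxdotE trmx_mul trmxK mulmxA -[RHS]mxtrace_mulC mulmxA. Qed.

Lemma mxdot_mulr p q m (V : 'M[R]_(q, m)) A (B : 'M[R]_(p, m)) :
  mxdot (A *m V) B = mxdot A (B *m V^T).
Proof. by rewrite !mxdotE trmx_mul trmxK mulmxA. Qed.

Lemma mxdot_tr p m (A B : 'M[R]_(p, m)) : mxdot A^T B^T = mxdot A B.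
Proof. by rewrite !mxdotE trmxK mxtrace_mulC -mxtrace_tr trmx_mul trmxK. Qed.

Lemma mxdot_ge0 p m (A : 'M[R]_(p, m)) : 0 <= mxdot A A.
Proof. by apply: sumr_ge0 => i _; apply: sumr_ge0 => j _; rewrite -expr2 sqr_ge0. Qed.

Lemma mxdot_eq0 p m (A : 'M[R]_(p, m)) : (mxdot A A == 0) = (A == 0).
Proof.
apply/idP/eqP => [|->]; last by rewrite mxdot0l.
rewrite psumr_eq0 => [/allP h|i _]; last by apply: sumr_ge0 => j _; rewrite -expr2 sqr_ge0.
apply/matrixP => i j; have := h i; rewrite mem_index_enum => /(_ isT) /=.
rewrite psumr_eq0 => [/allP hj|k _]; last by rewrite -expr2 sqr_ge0.
have := hj j; rewrite mem_index_enum => /(_ isT) /=.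
by rewrite mulf_eq0 orbb mxE => /eqP.
Qed.

Lemma mxdot_gt0 p m (A : 'M[R]_(p, m)) : A != 0 -> 0 < mxdot A A.
Proof. by rewrite -mxdot_eq0 lt_neqAle mxdot_ge0 andbT eq_sym. Qed.

Lemma mxdot_CS p m (A B : 'M[R]_(p, m)) :
  mxdot A B ^+ 2 <= mxdot A A * mxdot B B.
Proof.
have [->|B0] := eqVneq B 0; first by rewrite mxdotC !mxdot0l expr0n mulr0.
have b0 := mxdot_gt0 B0.
have := mxdot_ge0 (mxdot B B *: A - mxdot A B *: B).
rewrite mxdotBl !mxdotBr !mxdotZl !mxdotZr (mxdotC B A).
rewrite (_ : _ - _ - _ = mxdot B B * (mxdot A A * mxdot B B - mxdot A B ^+ 2)); last by ring.
by rewrite pmulr_rge0// subr_ge0.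
Qed.

Lemma frobenius_normE p m (A : 'M[R]_(p, m)) : frobenius_norm A = Num.sqrt (mxdot A A).
Proof. by congr Num.sqrt; apply: eq_bigr => i _; apply: eq_bigr => j _; rewrite expr2. Qed.

Lemma mxdot_isometryl p q m (E : 'M[R]_(p, q)) (A B : 'M[R]_(q, m)) :
  E^T *m E = 1%:M -> mxdot (E *m A) (E *m B) = mxdot A B.
Proof. by move=> EE; rewrite mxdot_mull mulmxA EE mul1mx. Qed.

Lemma mxdot_isometryr p q m (F : 'M[R]_(m, q)) (A B : 'M[R]_(p, q)) :
  F^T *m F = 1%:M -> mxdot (A *m F^T) (B *m F^T) = mxdot A B.
Proof. by move=> FF; rewrite mxdot_mulr trmxK -mulmxA FF mulmx1. Qed.

Lemma orthogonal_mxC n (U : 'M[R]_n) : orthogonal_mx U -> U^T *m U = 1%:M.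
Proof. exact: mulmx1C. Qed.

Lemma orthogonal_mx1 n : orthogonal_mx (1%:M : 'M[R]_n).
Proof. by rewrite /orthogonal_mx trmx1 mulmx1. Qed.

Lemma orthogonal_mxM n (U V : 'M[R]_n) :
  orthogonal_mx U -> orthogonal_mx V -> orthogonal_mx (U *m V).
Proof. by move=> hU hV; rewrite /orthogonal_mx trmx_mul mulmxA -(mulmxA U) hV mulmx1. Qed.

Lemma orthogonal_mx_tr n (U : 'M[R]_n) : orthogonal_mx U -> orthogonal_mx U^T.
Proof. by move=> hU; rewrite /orthogonal_mx trmxK orthogonal_mxC. Qed.

Lemma mxdot_orthl p m (U : 'M[R]_p) (A B : 'M[R]_(p, m)) :
  orthogonal_mx U -> mxdot (U *m A) (U *m B) = mxdot A B.
Proof. by move=> hU; rewrite mxdot_isometryl// orthogonal_mxC. Qed.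

Lemma mxdot_orthr p m (V : 'M[R]_m) (A B : 'M[R]_(p, m)) :
  orthogonal_mx V -> mxdot (A *m V) (B *m V) = mxdot A B.
Proof. by move=> hV; rewrite mxdot_mulr -mulmxA hV mulmx1. Qed.

Lemma mxdot_rows p m (A : 'M[R]_(p, m)) :
  mxdot A A = \sum_i mxdot (row i A) (row i A).
Proof.
apply: eq_bigr => i _; rewrite /mxdot big_ord1.
by apply: eq_bigr => j _; rewrite !mxE.
Qed.

Lemma mxdot11 (a b : 'M[R]_1) : mxdot a b = a 0 0 * b 0 0.
Proof. by rewrite /mxdot !big_ord1. Qed.

Lemma mxdot_delta p m (i : 'I_p) (j : 'I_m) :
  mxdot (delta_mx i j : 'M[R]_(p, m)) (delta_mx i j) = 1.
Proof.
rewrite /mxdot (bigD1 i)//= [X in _ + X]big1 ?addr0 => [|k ki]; last first.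
  by rewrite big1// => l _; rewrite !mxE (negbTE ki) mulr0.
rewrite (bigD1 j)//= big1 ?addr0 => [|k kj]; last by rewrite !mxE (negbTE kj) andbF mulr0.
by rewrite !mxE !eqxx mulr1.
Qed.

Lemma rowdotE n (x y : 'rV[R]_n) : x *m y^T = (mxdot x y)%:M.
Proof.
apply/matrixP => i j; rewrite !ord1 !mxE /mxdot big_ord1 eqxx mulr1n.
by apply: eq_bigr => k _; rewrite mxE.
Qed.

(** Reflection in the hyperplane orthogonal to [w]; for [w = 0] the formula gives the identity, so
    that equal vectors need no separate construction. *)
Definition householder n (w : 'rV[R]_n) : 'M[R]_n :=
  1%:M - (2 / mxdot w w) *: (w^T *m w).

Lemma mul_householder n (x w : 'rV[R]_n) :
  x *m householder w = x - (2 * mxdot x w / mxdot w w) *: w.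
Proof.
rewrite /householder mulmxBr mulmx1 -scalemxAr mulmxA rowdotE mul_scalar_mx scalerA.
by congr (_ - _ *: _); ring.
Qed.

Lemma householder_tr n (w : 'rV[R]_n) : (householder w)^T = householder w.
Proof. by rewrite /householder linearB /= linearZ/= trmx1 trmx_mul trmxK. Qed.

Lemma orthogonal_householder n (w : 'rV[R]_n) : orthogonal_mx (householder w).
Proof.
rewrite /orthogonal_mx householder_tr; apply/row_matrixP => i.
rewrite rowE [in RHS]rowE mulmxA mulmx1 !mul_householder.
move: (delta_mx 0 i) => x; rewrite mxdotBl mxdotZl.
have [->|w0] := eqVneq w 0; first by rewrite !scaler0 !subr0.
have q0 : mxdot w w != 0 by rewrite mxdot_eq0.
rewrite -addrA -opprD -scalerDl [X in X *: w](_ : _ = 0) ?scale0r ?subr0//.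
by field.
Qed.

Lemma householder_fix n (x w : 'rV[R]_n) : mxdot x w = 0 -> x *m householder w = x.
Proof. by move=> h; rewrite mul_householder h mulr0 mul0r scale0r subr0. Qed.

(** For vectors of equal length, [2 * mxdot x (x - y)] equals the squared length of [x - y], so the
    reflection subtracts exactly [x - y]. *)
Lemma householder_swap n (x y : 'rV[R]_n) : mxdot x x = mxdot y y ->
  x *m householder (x - y) = y.
Proof.
move=> xy; rewrite mul_householder.
have [/eqP|xy0] := eqVneq (x - y) 0.
  by rewrite subr_eq0 => /eqP ->; rewrite subrr scaler0 subr0.
rewrite (_ : 2 * _ / _ = 1) ?scale1r ?subKr//.
have q0 : mxdot (x - y) (x - y) != 0 by rewrite mxdot_eq0.
apply: (mulIf q0); rewrite mul1r divfK// !mxdotBr !mxdotBl (mxdotC y x) -xy.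
by ring.
Qed.

(** The diagonal is a function on [nat], so that one sequence is indexed by the rows as well as by
    the columns of a rectangular matrix. *)
Definition dgmx p m (d : nat -> R) : 'M[R]_(p, m) :=
  \matrix_(i, j) (d i *+ (i == j :> nat)).

Lemma dgmxD p m d e : dgmx p m (fun i => d i + e i) = dgmx p m d + dgmx p m e.
Proof. by apply/matrixP => i j; rewrite !mxE mulrnDl. Qed.

Lemma mxdot_dgmx p m d e : (forall i, (m <= i)%N -> d i = 0) ->
  mxdot (dgmx p m d) (dgmx p m e) = \sum_(i < p) d i * e i.
Proof.
move=> d0; apply: eq_bigr => i _; have [mi|im] := leqP m i.
  rewrite d0// mul0r big1// => j _; rewrite !mxE d0// mul0rn mul0r//.
rewrite (bigD1 (Ordinal im))//= big1 ?addr0.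
  by rewrite !mxE/= eqxx.
by move=> j ji; rewrite !mxE eq_sym (negbTE (ji : j != i :> nat)) !mulr0n mul0r.
Qed.

Lemma dgmx_pid p m n d : (forall i, (n <= i)%N -> d i = 0) ->
  dgmx p m d = diag_mx (\row_i d i) *m pid_mx n.
Proof.
move=> d0; apply/matrixP => i j; rewrite mul_diag_mx !mxE.
have [ij|] := eqVneq; last by rewrite mulr0.
by case: ltnP => [|ni]; rewrite ?mulr1// d0// mul0r.
Qed.

Lemma continuous_mxdot_mulmx p m (A : 'M[R]_(p, m)) :
  continuous (fun x : 'rV[R]_p => mxdot (x *m A) (x *m A)).
Proof.
rewrite [X in continuous X](_ : _ = fun x : 'rV[R]_p =>
   \sum_j (\sum_i x 0 i * A i j) * (\sum_i x 0 i * A i j)); last first.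
  apply/funext => x; rewrite /mxdot big_ord1.
  by apply: eq_bigr => j _; rewrite !mxE.
have cl j : continuous (fun x : 'rV[R]_p => \sum_i x 0 i * A i j).
  apply: (@continuous_big R _ +%R) => [|i _ x]; first exact: (@add_continuous R^o).
  by apply: (@continuousM R); [exact: coord_continuous|exact: cst_continuous].
apply: (@continuous_big R _ +%R) => [|j _ x]; first exact: (@add_continuous R^o).
by apply: (@continuousM R); exact: cl.
Qed.

(** The unit sphere is compact and the quadratic form continuous; the maximiser is the top left
    singular vector from which [svd] starts. *)
Lemma max_op_norm p m (A : 'M[R]_(p.+1, m)) :
  exists u : 'rV[R]_p.+1, mxdot u u = 1 /\ forall x : 'rV[R]_p.+1,
    mxdot (x *m A) (x *m A) <= mxdot (u *m A) (u *m A) * mxdot x x.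
Proof.
pose S : set 'rV[R]_p.+1 := [set x | mxdot x x = 1].
have cS : compact S.
  apply: bounded_closed_compact.
    exists 1; split=> // y y1 x /= x1; rewrite [`|x|]mx_normrE.
    apply: bigmax_le => [|ij _]; first exact: ltW (lt_trans ltr01 y1).
    have : `|x ij.1 ij.2| ^+ 2 <= 1.
      rewrite -x1 real_normK ?num_real// /mxdot.
      rewrite (bigD1 ij.1)//= (bigD1 ij.2)//= -addrA lerDl addr_ge0//.
        by apply: sumr_ge0 => k _; rewrite -expr2 sqr_ge0.
      by apply: sumr_ge0 => k _; apply: sumr_ge0 => l _; rewrite -expr2 sqr_ge0.
    rewrite expr_le1// => h; exact: le_trans h (ltW y1).
  rewrite (_ : S = (fun x : 'rV[R]_p.+1 => mxdot (x *m 1%:M) (x *m 1%:M)) @^-1` [set 1]).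
    apply: closed_comp; first by move=> x _; exact: continuous_mxdot_mulmx.
    exact: closed_eq.
  by apply/seteqP; split => x; rewrite /S /= mulmx1.
have S0 : S !=set0.
  by exists (delta_mx 0 0); exact: mxdot_delta.
have [u /set_mem Su umax] := EVT_max_rV S0 cS
  (continuous_subspaceT (@continuous_mxdot_mulmx _ _ A)).
exists u; split=> // x; have [->|x0] := eqVneq x 0.
  by rewrite mul0mx !mxdot0l mulr0.
have q0 := mxdot_gt0 x0; pose t := Num.sqrt (mxdot x x).
have t0 : 0 < t by rewrite sqrtr_gt0.
have tt : t * t = mxdot x x by rewrite -expr2 sqr_sqrtr// ltW.
have := umax (t^-1 *: x); rewrite inE /S /= mxdotZl mxdotZr -scalemxAl mxdotZl mxdotZr.
rewrite -tt => /(_ ltac:(by field; rewrite gt_eqF)).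
rewrite mulrA -invfM tt mulrC ler_pdivrMr//.
Qed.

Lemma unit_householder p (u : 'rV[R]_p.+1) : mxdot u u = 1 ->
  exists H : 'M[R]_p.+1, [/\ orthogonal_mx H, H^T = H, u *m H = delta_mx 0 0 &
    delta_mx 0 0 *m H = u].
Proof.
move=> u1; have e1 := mxdot_delta (0 : 'I_1) (0 : 'I_p.+1).
exists (householder (u - delta_mx 0 0)).
have oH := orthogonal_householder (u - delta_mx 0 0).
have uH : u *m householder (u - delta_mx 0 0) = delta_mx 0 0.
  by rewrite householder_swap// u1 e1.
split=> //; first exact: householder_tr.
rewrite -{1}uH -mulmxA -{2}(householder_tr (u - _)).
by rewrite oH mulmx1.
Qed.

End mxdot_theory.

Section singular_values.
Context (R : realType).

Let e0 n : 'rV[R]_n.+1 := delta_mx 0 0.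

Lemma mxdot_row_mx p q (x y : 'rV[R]_p) (z t : 'rV[R]_q) :
  mxdot (row_mx x z) (row_mx y t) = mxdot x y + mxdot z t.
Proof.
rewrite /mxdot !big_ord1 big_split_ord /=; congr (_ + _); apply: eq_bigr => i _.
  by rewrite !row_mxEl.
by rewrite !row_mxEr.
Qed.

(** If the first basis vector attains the operator norm, an entry [c] below the corner of the first
    column would allow a perturbed vector to exceed it. *)
Lemma block_of_max p m (B : 'M[R]_(1 + p, 1 + m)) (s : R) : 0 < s ->
  (delta_mx 0 0 : 'rV[R]_(1 + p)) *m B = s *: delta_mx 0 0 ->
  (forall x : 'rV[R]_(1 + p), mxdot (x *m B) (x *m B) <= s ^+ 2 * mxdot x x) ->
  B = block_mx s%:M 0 0 (drsubmx B).
Proof.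
move=> s0 B0 Bmax.
have row0 j : B 0 j = s *+ (j == 0).
  have := congr1 (fun M : 'rV[R]_(1 + m) => M 0 j) B0.
  by rewrite -rowE !mxE mulr_natr.
have col0 i : B (rshift 1 i) 0 = 0.
  pose c : R := B (rshift 1 i) 0.
  (* The image of [x] has first coordinate [s + c ^+ 2 / s], whose square is at least
     [s ^+ 2 + 2 * c ^+ 2], while the operator bound allows only [s ^+ 2 + c ^+ 2]. *)
  pose x : 'rV[R]_(1 + p) := row_mx 1%:M (c / s *: delta_mx 0 i).
  have := Bmax x.
  have -> : mxdot x x = 1 + (c / s) ^+ 2.
    rewrite /x mxdot_row_mx mxdot11 !mxE mulr1 mxdotZl mxdotZr; congr (_ + _).
    by rewrite mxdot_delta mulr1 expr2.
  have xB : (x *m B) 0 0 = s + c ^+ 2 / s.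
    rewrite mxE big_split_ord /= big_ord1 row_mxEl mxE eqxx mul1r.
    rewrite (_ : lshift p 0 = 0); last exact/val_inj.
    rewrite row0 eqxx; congr (_ + _).
    rewrite (bigD1 i)//= big1; last first.
      by move=> k ki; rewrite row_mxEr !mxE (negbTE ki) andbF mulr0 mul0r.
    by rewrite row_mxEr !mxE !eqxx -/c /= mulr1 addr0 expr2 mulrAC.
  have : (x *m B) 0 0 ^+ 2 <= mxdot (x *m B) (x *m B).
    rewrite /mxdot big_ord1 (bigD1 0)//= expr2 lerDl; apply: sumr_ge0 => k _.
    by rewrite -expr2 sqr_ge0.
  rewrite xB => h1 h2; have := le_trans h1 h2.
  rewrite (_ : s ^+ 2 * _ = s ^+ 2 + c ^+ 2); last by field; rewrite gt_eqF.
  rewrite (_ : (_ + _) ^+ 2 = s ^+ 2 + 2 * c ^+ 2 + (c ^+ 2 / s) ^+ 2); last by field; rewrite gt_eqF.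
  move=> h; apply/eqP; rewrite -sqrf_eq0 eq_le sqr_ge0 andbT -/c.
  by have := sqr_ge0 (c ^+ 2 / s); lra.
rewrite -{1}[B]submxK; congr block_mx.
- apply/matrixP => i j; rewrite !ord1 !mxE eqxx.
  by rewrite (_ : lshift p 0 = 0) ?row0//; exact/val_inj.
- apply/matrixP => i j; rewrite !ord1 !mxE.
  by rewrite (_ : lshift p 0 = 0) ?row0//; exact/val_inj.
- apply/matrixP => i j; rewrite !ord1 !mxE.
  by rewrite (_ : lshift m 0 = 0) ?col0//; exact/val_inj.
Qed.

Lemma dgmx_block p m d (s : R) :
  dgmx (1 + p) (1 + m) (fun i => if i is i'.+1 then d i' else s) =
  block_mx s%:M 0 0 (dgmx p m d).
Proof.
apply/matrixP => i j.
case: (split_ordP i) => i' ->; case: (split_ordP j) => j' ->; rewrite mxE.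
- by rewrite block_mxEul mxE !ord1.
- by rewrite block_mxEur mxE !ord1 /=.
- by rewrite block_mxEdl mxE !ord1 /=.
- by rewrite block_mxEdr mxE.
Qed.

Lemma orthogonal_block p (U : 'M[R]_p) : orthogonal_mx U ->
  orthogonal_mx (block_mx 1%:M 0 0 U : 'M[R]_(1 + p)).
Proof.
move=> hU; rewrite /orthogonal_mx tr_block_mx mulmx_block !trmx0 trmx1.
by rewrite !mul0mx !mulmx0 mulmx1 !addr0 add0r hU -scalar_mx_block.
Qed.

Lemma mul_block_diag p m (s : R) (U : 'M[R]_p) (D : 'M[R]_(p, m)) (V : 'M[R]_m) :
  (block_mx 1%:M 0 0 U : 'M[R]_(1 + p)) *m block_mx s%:M 0 0 D *m
    (block_mx 1%:M 0 0 V : 'M[R]_(1 + m)) = block_mx s%:M 0 0 (U *m D *m V).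
Proof.
by rewrite !mulmx_block !mul0mx !mulmx0 !addr0 !add0r !mul1mx !mulmx1 !mul0mx.
Qed.

(** Induction by deflation: reflections move the top singular pair to the first basis vectors, and
    [block_of_max] splits it off. The values are not claimed to be sorted, only positive exactly
    below the rank. *)
Theorem svd p m (A : 'M[R]_(p, m)) : exists U V d,
  [/\ orthogonal_mx U, orthogonal_mx V, A = U *m dgmx p m d *m V,
    (forall i, (i < \rank A)%N -> 0 < d i) &
    (forall i, (\rank A <= i)%N -> d i = 0)].
Proof.
have zero q n : exists U V d,
  [/\ orthogonal_mx U, orthogonal_mx V, (0 : 'M[R]_(q, n)) = U *m dgmx q n d *m V,
    (forall i, (i < \rank (0%R : 'M[R]_(q, n)))%N -> 0 < d i) &
    (forall i, (\rank (0%R : 'M[R]_(q, n)) <= i)%N -> d i = 0)].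
  exists 1%:M, 1%:M, (fun=> 0); split; rewrite ?mxrank0//.
  - exact: orthogonal_mx1.
  - exact: orthogonal_mx1.
  - by rewrite mul1mx mulmx1; apply/matrixP => i j; rewrite !mxE mul0rn.
elim: p m A => [m A|p IH [|m] A]; first by rewrite flatmx0; exact: zero.
  by rewrite thinmx0; exact: zero.
have [->|A0] := eqVneq A 0; first exact: zero.
have [u [u1 umax]] := max_op_norm A.
have s20 : 0 < mxdot (u *m A) (u *m A).
  rewrite lt_neqAle mxdot_ge0 andbT eq_sym; apply: contra A0 => /eqP h.
  apply/eqP/row_matrixP => i; rewrite row0 rowE; apply/eqP.
  by rewrite -mxdot_eq0 eq_le mxdot_ge0 andbT (le_trans (umax _))// h mul0r.
pose s := Num.sqrt (mxdot (u *m A) (u *m A)).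
have s0 : 0 < s by rewrite sqrtr_gt0.
have ss : s ^+ 2 = mxdot (u *m A) (u *m A) by rewrite sqr_sqrtr// ltW.
pose v := s^-1 *: (u *m A).
have v1 : mxdot v v = 1.
  by rewrite mxdotZl mxdotZr -ss; field; rewrite gt_eqF.
have [H [oH sH _ eH]] := unit_householder u1.
have [K [oK sK vK _]] := unit_householder v1.
pose B : 'M[R]_(1 + p, 1 + m) := H *m A *m K.
have AE : A = H *m B *m K.
  rewrite /B !mulmxA -{1}sH orthogonal_mxC// mul1mx -mulmxA -{2}sK oK mulmx1//.
have BE : B = block_mx s%:M 0 0 (drsubmx B).
  apply: block_of_max => //.
    rewrite /B !mulmxA eH.
    have -> : u *m A = s *: v by rewrite /v scalerA divff ?scale1r// gt_eqF.
    by rewrite -scalemxAl vK.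
  move=> x; rewrite ss /B !mulmxA mxdot_orthr//.
  by apply: le_trans (umax _) _; rewrite mxdot_orthr.
have [U [V [d [oU oV DE dpos d0]]]] := IH _ (drsubmx B).
exists (H *m (block_mx 1%:M 0 0 U : 'M[R]_(1 + p))),
  ((block_mx 1%:M 0 0 V : 'M[R]_(1 + m)) *m K),
  (fun i => if i is i'.+1 then d i' else s).
have rE : \rank A = (\rank (drsubmx B)).+1.
  rewrite AE mxrankMfree; last by rewrite row_free_unit; case: (mulmx1_unit oK).
  rewrite eqmxMfull; last by rewrite row_full_unit; case: (mulmx1_unit oH).
  transitivity (\rank (block_mx s%:M 0 0 (drsubmx B) : 'M[R]_(1 + p, 1 + m))).
    by rewrite -BE.
  rewrite rank_diag_block_mx [X in (X + _)%N](_ : _ = 1%N)//.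
  by rewrite rank_rV (_ : ((s%:M : 'M[R]_1) == 0) = false)// -scalemx1 scaler_eq0 oner_eq0 gt_eqF.
split.
- by apply: orthogonal_mxM => //; exact: orthogonal_block.
- by apply: orthogonal_mxM => //; exact: orthogonal_block.
- rewrite {1}AE {1}BE {1}DE dgmx_block -!mulmxA; congr (_ *m _).
  rewrite !mulmxA; congr (_ *m _).
  exact/esym/mul_block_diag.
- by rewrite rE => -[|i]//; exact: dpos.
- by rewrite rE => -[|i]//; exact: d0.
Qed.

End singular_values.

(** * Unitarily invariant norms *)

Section unitarily_invariant_norms.
Context (R : realType).

Section one_norm.
Context (p m : nat) (N : 'M[R]_(p, m) -> R).
Hypotheses (nN : is_norm N) (uN : unitarily_invariant N).

Lemma uinorm0 : N 0 = 0.
Proof. by rewrite -(scale0r 0) (norm_scale nN) normr0 mul0r. Qed.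

Lemma uinormN A : N (- A) = N A.
Proof. by rewrite -scaleN1r (norm_scale nN) normrN normr1 mul1r. Qed.

Lemma uinorm_ge0 A : 0 <= N A.
Proof.
by have := norm_triangle nN A (- A); rewrite subrr uinorm0 uinormN; lra.
Qed.

Lemma uinormB A B : N (A - B) <= N A + N B.
Proof. by rewrite -(uinormN B); exact: norm_triangle nN _ _. Qed.

Lemma uinorm_sum (I : Type) (r : seq I) (Q : pred I) (F : I -> 'M[R]_(p, m)) :
  N (\sum_(i <- r | Q i) F i) <= \sum_(i <- r | Q i) N (F i).
Proof.
elim/big_rec2 : _ => [|i x y _ h]; first by rewrite uinorm0.
exact: le_trans (norm_triangle nN _ _) (lerD _ _).
Qed.

Lemma uinorm_orthl (U : 'M[R]_p) A : orthogonal_mx U -> N (U *m A) = N A.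
Proof. by move=> oU; rewrite -[U *m A]mulmx1 uN//; exact: orthogonal_mx1. Qed.

Lemma uinorm_orthr (V : 'M[R]_m) A : orthogonal_mx V -> N (A *m V) = N A.
Proof. by move=> oV; rewrite -[A in LHS]mul1mx uN//; exact: orthogonal_mx1. Qed.

Lemma uinorm_gt0 A : A != 0 -> 0 < N A.
Proof.
move=> A0; rewrite lt_neqAle uinorm_ge0 andbT eq_sym.
by apply: contra A0 => /eqP h; apply/eqP/(norm_definite nN).
Qed.

(** For [|t| <= 1] the row scaling is the convex combination, with weights [(1 + t) / 2] and
    [(1 - t) / 2], of the identity and the sign change of that row. *)
Lemma uinorm_scale_row (i : 'I_p) (t : R) A : `|t| <= 1 ->
  N (diag_mx (\row_j (if j == i then t else 1)) *m A) <= N A.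
Proof.
move=> t1; pose S : 'M[R]_p := diag_mx (\row_j (if j == i then -1 else 1)).
have oS : orthogonal_mx S.
  rewrite /orthogonal_mx tr_diag_mx mulmx_diag -diag_const_mx; congr diag_mx.
  by apply/rowP => j; rewrite !mxE; case: ifP; rewrite ?mulrNN mulr1.
have -> : diag_mx (\row_j (if j == i then t else 1)) *m A =
    ((1 + t) / 2) *: A + ((1 - t) / 2) *: (S *m A).
  apply/matrixP => a b; rewrite !mul_diag_mx !mxE; case: ifP => _; first by field.
  by field.
apply: le_trans (norm_triangle nN _ _) _.
rewrite !(norm_scale nN) uinorm_orthl// -mulrDl.
move: t1; rewrite ler_norml => /andP[t1 t2].
by rewrite !ger0_norm ?divr_ge0//; try lra; rewrite (_ : _ + _ = 1) ?mul1r//; field.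
Qed.

(** Rows are scaled one at a time. Together with the invariance this replaces any description of the
    norm by a gauge function of the singular values. *)
Lemma uinorm_contractl (d : 'rV[R]_p) A : (forall i, `|d 0 i| <= 1) ->
  N (diag_mx d *m A) <= N A.
Proof.
move=> d1.
suff h (s : seq 'I_p) : uniq s ->
    N (diag_mx (\row_j (if j \in s then d 0 j else 1)) *m A) <= N A.
  have := h _ (enum_uniq 'I_p); congr (N (diag_mx _ *m A) <= _).
  by apply/rowP => j; rewrite mxE mem_enum.
elim: s => [_|i s IH /= /andP[nis us]].
  rewrite (_ : diag_mx _ = 1%:M) ?mul1mx//.
  by rewrite -diag_const_mx; congr diag_mx; apply/rowP => j; rewrite !mxE.
apply: le_trans (IH us).
rewrite (_ : diag_mx _ = diag_mx (\row_j (if j == i then d 0 i else 1)) *m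
   diag_mx (\row_j (if j \in s then d 0 j else 1))); last first.
  rewrite mulmx_diag; congr diag_mx; apply/rowP => j; rewrite !mxE inE.
  by case: eqVneq => [->|_]; rewrite ?(negbTE nis) ?mulr1 ?mul1r.
by rewrite -mulmxA; exact: uinorm_scale_row.
Qed.

End one_norm.

Lemma is_norm_tr p m (N : 'M[R]_(p, m) -> R) :
  is_norm N -> is_norm (fun A : 'M[R]_(m, p) => N A^T).
Proof.
move=> nN; split => [A B|a A|A h].
- by rewrite linearD; exact: norm_triangle nN _ _.
- by rewrite linearZ; exact: norm_scale nN _ _.
- by rewrite -[A]trmxK (norm_definite nN h) trmx0.
Qed.

Lemma unitarily_invariant_tr p m (N : 'M[R]_(p, m) -> R) :
  unitarily_invariant N -> unitarily_invariant (fun A : 'M[R]_(m, p) => N A^T).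
Proof.
move=> uN A U V oU oV; rewrite !trmx_mul mulmxA uN//; exact: orthogonal_mx_tr.
Qed.

Lemma uinorm_contractr p m (N : 'M[R]_(p, m) -> R) (d : 'rV[R]_m) A :
  is_norm N -> unitarily_invariant N ->
  (forall i, `|d 0 i| <= 1) -> N (A *m diag_mx d) <= N A.
Proof.
move=> nN uN d1.
have := uinorm_contractl (is_norm_tr nN) (unitarily_invariant_tr uN) A^T d1.
by rewrite trmx_mul tr_diag_mx trmxK.
Qed.

(* An orthogonal matrix acting on the range of the isometry [E] extends to the
   whole space by the identity on the orthogonal complement. *)
Definition extend_mx p q (E : 'M[R]_(p, q)) (U : 'M[R]_q) : 'M[R]_p :=
  E *m U *m E^T + (1%:M - E *m E^T).

Lemma extend_mxE p q (E : 'M[R]_(p, q)) (U : 'M[R]_q) : E^T *m E = 1%:M ->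
  extend_mx E U *m E = E *m U.
Proof.
move=> EE; rewrite /extend_mx mulmxDl mulmxBl mul1mx -!mulmxA EE mulmx1.
by rewrite mulmx1 subrr addr0.
Qed.

Lemma extend_mx_tr p q (E : 'M[R]_(p, q)) (U : 'M[R]_q) :
  (extend_mx E U)^T = extend_mx E U^T.
Proof.
by rewrite /extend_mx linearD linearB /= trmx1 !trmx_mul trmxK mulmxA.
Qed.

Lemma orthogonal_extend p q (E : 'M[R]_(p, q)) (U : 'M[R]_q) :
  E^T *m E = 1%:M -> orthogonal_mx U -> orthogonal_mx (extend_mx E U).
Proof.
move=> EE oU; rewrite /orthogonal_mx extend_mx_tr {2}/extend_mx mulmxDr mulmxBr.
rewrite mulmx1 !mulmxA extend_mxE// -(mulmxA E U U^T) oU mulmx1 /extend_mx.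
by rewrite addrAC subrr add0r addrC subrK.
Qed.

Section embedding.
Context (p m q n : nat) (N : 'M[R]_(p, m) -> R).
Context (E : 'M[R]_(p, q)) (F : 'M[R]_(m, n)).
Hypotheses (nN : is_norm N) (uN : unitarily_invariant N).
Hypotheses (EE : E^T *m E = 1%:M) (FF : F^T *m F = 1%:M).

Lemma is_norm_embed : is_norm (fun W : 'M[R]_(q, n) => N (E *m W *m F^T)).
Proof.
split => [A B|a A|A h].
- by rewrite mulmxDr mulmxDl; exact: norm_triangle nN _ _.
- by rewrite -scalemxAr -scalemxAl; exact: norm_scale nN _ _.
- have := congr1 (fun X => E^T *m X *m F) (norm_definite nN h).
  rewrite /= !mulmxA EE mul1mx -mulmxA FF mulmx1 => ->.
  by rewrite mulmx0 mul0mx.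
Qed.

Lemma unitarily_invariant_embed :
  unitarily_invariant (fun W : 'M[R]_(q, n) => N (E *m W *m F^T)).
Proof.
move=> A U V oU oV.
have -> : E *m (U *m A *m V) *m F^T =
    extend_mx E U *m (E *m A *m F^T) *m extend_mx F V.
  rewrite -[extend_mx F V]trmxK extend_mx_tr !mulmxA extend_mxE//.
  rewrite -[_ *m F^T *m _]mulmxA -trmx_mul extend_mxE// trmx_mul trmxK !mulmxA.
  by [].
by rewrite uN//; exact: orthogonal_extend.
Qed.

End embedding.

Lemma isometry_rank p q (E : 'M[R]_(p, q)) : E^T *m E = 1%:M -> \rank E = q.
Proof.
move=> EE; apply/eqP; rewrite eqn_leq rank_leq_col /= -{1}(mxrank1 R q) -EE.
exact: mxrankM_maxr.
Qed.

Lemma isometry_svd p q (E : 'M[R]_(p, q)) : E^T *m E = 1%:M ->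
  exists U V, [/\ orthogonal_mx U, orthogonal_mx V & E = U *m pid_mx q *m V].
Proof.
move=> EE; have rE := isometry_rank EE.
have qp : (q <= p)%N by rewrite -rE rank_leq_row.
have [U [V [d [oU oV Edef dpos d0]]]] := svd E.
exists U, V; split => //; rewrite Edef; congr (_ *m _ *m _).
have DD : (dgmx p q d)^T *m dgmx p q d = 1%:M.
  have := congr1 (fun X => V *m X *m V^T) EE.
  rewrite {1 2}Edef !trmx_mul !mulmxA oV mul1mx mulmx1 oV.
  rewrite -(mulmxA _ U^T U) orthogonal_mxC// mulmx1.
  by rewrite -(mulmxA _ V V^T) oV mulmx1.
apply/matrixP => i j; rewrite !mxE; case: eqVneq => //= ij.
have iq : (i < q)%N by rewrite ij.
rewrite iq; have := congr1 (fun X : 'M[R]_q => X j j) DD.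
rewrite !mxE eqxx (bigD1 i)//= big1 ?addr0.
  (* Singular values of an isometry square to 1; the root -1 is excluded by their positivity. *)
  rewrite !mxE ij eqxx mulr1n -expr2 => /eqP; rewrite -ij sqrf_eq1 => /orP[/eqP //|/eqP/= di].
  by have := dpos i; rewrite rE iq -[d i]mulr1n di => /(_ isT); lra.
move=> k ki; rewrite !mxE -ij (_ : (k == i :> nat) = false) ?mulr0//.
exact/negbTE.
Qed.

(** By [isometry_svd] both isometries are, up to orthogonal factors, the standard one; [extend_mx]
    moves the right-hand factors to the left of it. Hence the norm of an embedded matrix does not
    depend on the embedding. *)
Lemma isometry_orth p q (E E' : 'M[R]_(p, q)) :
  E^T *m E = 1%:M -> E'^T *m E' = 1%:M ->
  exists2 U, orthogonal_mx U & U *m E = E'.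
Proof.
move=> EE EE'; have qp : (q <= p)%N by rewrite -(isometry_rank EE) rank_leq_row.
have JJ : (pid_mx q : 'M[R]_(p, q))^T *m pid_mx q = 1%:M.
  by rewrite tr_pid_mx pid_mx_id// pid_mx_1.
have [U [V [oU oV ->]]] := isometry_svd EE.
have [U' [V' [oU' oV' ->]]] := isometry_svd EE'.
have oe := orthogonal_extend JJ oV; have oe' := orthogonal_extend JJ oV'.
exists (U' *m extend_mx (pid_mx q) V' *m ((extend_mx (pid_mx q) V)^T *m U^T)).
  by do !apply: orthogonal_mxM => //; exact: orthogonal_mx_tr.
rewrite -!mulmxA (mulmxA U^T U) orthogonal_mxC// mul1mx.
rewrite -(extend_mxE V JJ) (mulmxA _^T) orthogonal_mxC// mul1mx.
by rewrite extend_mxE.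
Qed.

Lemma uinorm_isometryl p m q (N : 'M[R]_(p, m) -> R) (E E' : 'M[R]_(p, q)) A :
  is_norm N -> unitarily_invariant N ->
  E^T *m E = 1%:M -> E'^T *m E' = 1%:M -> N (E *m A) = N (E' *m A).
Proof.
move=> nN uN EE EE'; have [U oU <-] := isometry_orth EE EE'.
by rewrite -mulmxA uinorm_orthl.
Qed.

Lemma uinorm_isometry p m q n (N : 'M[R]_(p, m) -> R) (E E' : 'M[R]_(p, q))
    (F F' : 'M[R]_(m, n)) A :
  is_norm N -> unitarily_invariant N ->
  E^T *m E = 1%:M -> E'^T *m E' = 1%:M ->
  F^T *m F = 1%:M -> F'^T *m F' = 1%:M ->
  N (E *m A *m F^T) = N (E' *m A *m F'^T).
Proof.
move=> nN uN EE EE' FF FF'; have [U oU <-] := isometry_orth EE EE'.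
have [V oV <-] := isometry_orth FF FF'.
rewrite trmx_mul -!mulmxA uinorm_orthl// !mulmxA uinorm_orthr//.
exact: orthogonal_mx_tr.
Qed.

(** All singular values are at most [t], so up to rotations the matrix is [t] times a diagonal
    contraction of [pid_mx r]. *)
Lemma uinorm_op_bound p m (N : 'M[R]_(p, m) -> R) (M : 'M[R]_(p, m)) r t :
  is_norm N -> unitarily_invariant N -> (\rank M <= r)%N -> 0 <= t ->
  (forall x : 'rV[R]_p, mxdot (x *m M) (x *m M) <= t ^+ 2 * mxdot x x) ->
  N M <= t * N (pid_mx r).
Proof.
move=> nN uN rM t0 opM; have [U [V [d [oU oV Mdef dpos d0]]]] := svd M.
have dt i : 0 <= d i <= t.
  have [ri|ir] := leqP (\rank M) i; first by rewrite d0// lexx.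
  have ip : (i < p)%N := leq_trans ir (rank_leq_row M).
  have im : (i < m)%N := leq_trans ir (rank_leq_col M).
  rewrite ltW ?dpos//=.
  (* This test vector is the left singular vector of index [i]; its image has length [d i]. *)
  have := opM (delta_mx 0 (Ordinal ip) *m U^T).
  rewrite {1 2}Mdef !mulmxA mxdot_orthr// -(mulmxA _ U^T U) orthogonal_mxC// mulmx1.
  rewrite mxdot_orthr; last exact: orthogonal_mx_tr.
  rewrite mxdot_delta mulr1 -rowE.
  have -> : row (Ordinal ip) (dgmx p m d) = d i *: delta_mx 0 (Ordinal im).
    by apply/rowP => j; rewrite !mxE /= -val_eqE /= eq_sym mulr_natr.
  rewrite mxdotZl mxdotZr mxdot_delta mulr1 -expr2 ler_sqr//.
  by rewrite nnegrE ltW// dpos.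
rewrite Mdef uN//.
have [t00|tn0] := eqVneq t 0.
  have -> : dgmx p m d = 0.
    apply/matrixP => i j; rewrite !mxE.
    have /andP[h1 h2] := dt i; rewrite (_ : d i = 0) ?mul0rn//.
    by apply/eqP; rewrite eq_le h1 -t00 h2.
  by rewrite uinorm0// t00 mul0r.
have tp : 0 < t by rewrite lt_neqAle eq_sym tn0.
have -> : dgmx p m d = t *: (diag_mx (\row_i (d i / t)) *m pid_mx r).
  rewrite (@dgmx_pid _ _ _ r); last by move=> i ri; apply: d0; exact: leq_trans ri.
  rewrite scalemxAl; congr (_ *m _); apply/matrixP => i j; rewrite !mxE.
  by rewrite mulrnAr mulrC divfK// gt_eqF.
rewrite (norm_scale nN) gtr0_norm// ler_wpM2l//; apply: uinorm_contractl => // i.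
rewrite mxE ger0_norm ?ler_pdivrMr ?mul1r//; first by have /andP[] := dt i.
by rewrite divr_ge0//; have /andP[] := dt i.
Qed.

End unitarily_invariant_norms.

(** * Sparse matrices *)

Section sparse_matrices.
Context (R : realType).

Definition projmx p (K : {set 'I_p}) : 'M[R]_p := diag_mx (\row_i (i \in K)%:R).

Lemma projmxE p m (K : {set 'I_p}) (A : 'M[R]_(p, m)) i j :
  (projmx K *m A) i j = if i \in K then A i j else 0.
Proof. by rewrite mul_diag_mx !mxE; case: ifP; rewrite ?mul1r ?mul0r. Qed.

Lemma mulmx_projmxE p m (S : {set 'I_m}) (A : 'M[R]_(p, m)) i j :
  (A *m projmx S) i j = if j \in S then A i j else 0.
Proof. by rewrite mul_mx_diag !mxE; case: ifP; rewrite ?mulr1 ?mulr0. Qed.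

Lemma sparse_mxP p m k s (A : 'M[R]_(p, m)) : sparse_mx k s A <->
  exists (K : {set 'I_p}) (S : {set 'I_m}), [/\ (#|K| <= k)%N, (#|S| <= s)%N & A = projmx K *m A *m projmx S].
Proof.
split => [[hk hs]|[K [S [hK hS AE]]]].
  exists [set i | row i A != 0]%SET, [set j | col j A != 0]%SET; split => //.
  apply/matrixP => i j; rewrite mulmx_projmxE projmxE !inE.
  case: eqVneq => [/colP/(_ i)|_]/=; first by rewrite !mxE.
  by case: eqVneq => [/rowP/(_ j)|_]//=; rewrite !mxE.
split.
  apply: leq_trans hK; apply: subset_leq_card; apply/fintype.subsetP => i.
  rewrite inE; apply: contraNT => iK; apply/eqP/rowP => j.
  by rewrite !mxE AE mulmx_projmxE projmxE (negbTE iK); case: ifP.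
apply: leq_trans hS; apply: subset_leq_card; apply/fintype.subsetP => j.
rewrite inE; apply: contraNT => jS; apply/eqP/colP => i.
by rewrite !mxE AE mulmx_projmxE (negbTE jS).
Qed.

Lemma rank_nonzero_rows p m (A : 'M[R]_(p, m)) :
  (\rank A <= #|[set i | row i A != 0%R]%SET|)%N.
Proof.
set K := [set i | _]%SET.
have sA : (A <= \sum_(i in K) <<row i A>>)%MS.
  apply/row_subP => i; have [->|i0] := eqVneq (row i A) 0; first exact: sub0mx.
  by apply: (sumsmx_sup i); rewrite ?inE// genmxE.
apply: leq_trans (mxrankS sA) _.
apply: leq_trans (mxrank_sum_leqif _).1 _.
rewrite -sum1_card; apply: leq_sum => i _.
by rewrite /= genmxE rank_leq_row.
Qed.

Lemma sparse_rank p m k s (A : 'M[R]_(p, m)) : sparse_mx k s A ->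
  (\rank A <= minn k s)%N.
Proof.
move=> [hk hs]; rewrite leq_min (leq_trans (rank_nonzero_rows A) hk) /=.
rewrite -mxrank_tr; apply: leq_trans (rank_nonzero_rows _) _.
apply: leq_trans hs; rewrite (_ : [set i | _]%SET = [set j | col j A != 0]%SET)//.
by apply/setP => j; rewrite !inE -tr_col trmx_eq0.
Qed.

Lemma mxdot_mulmx_le p m (x : 'rV[R]_p) (A : 'M[R]_(p, m)) :
  mxdot (x *m A) (x *m A) <= mxdot A A * mxdot x x.
Proof.
have h j : (x *m A) 0 j ^+ 2 <= mxdot x x * (\sum_i A i j * A i j).
  have -> : (x *m A) 0 j = mxdot x (col j A)^T.
    by rewrite mxE /mxdot big_ord1; apply: eq_bigr => i _; rewrite !mxE.
  apply: le_trans (mxdot_CS _ _) _; apply: ler_wpM2l; first exact: mxdot_ge0.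
  by rewrite le_eqVlt /mxdot big_ord1; apply/orP; left; apply/eqP;
    apply: eq_bigr => i _; rewrite !mxE.
rewrite [X in _ <= X]mulrC [X in _ <= _ * X]/mxdot exchange_big /= mulr_sumr.
rewrite [X in X <= _]/mxdot big_ord1; apply: ler_sum => j _.
by rewrite -expr2.
Qed.

Section sparse_norm.
Context (p m k s : nat) (N : 'M[R]_(p, m) -> R).
Hypotheses (nN : is_norm N) (uN : unitarily_invariant N).
Hypotheses (kp : (0 < k <= p)%N) (sm : (0 < s <= m)%N).

Local Notation r := (minn k s).
Local Notation L := (sparse_norm_sup k s N).

Lemma uinorm_sparse_pid (A : 'M[R]_(p, m)) : sparse_mx k s A ->
  N A <= Num.sqrt (mxdot A A) * N (pid_mx r).
Proof.
move=> sA; apply: uinorm_op_bound => //; first exact: sparse_rank.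
by move=> x; rewrite sqr_sqrtr ?mxdot_ge0// mxdot_mulmx_le.
Qed.

Let p_gt0 : (0 < p)%N. Proof. by case/andP: kp; apply: leq_trans. Qed.
Let m_gt0 : (0 < m)%N. Proof. by case/andP: sm; apply: leq_trans. Qed.

Let sphere := [set A : 'M[R]_(p, m) | sparse_mx k s A /\ frobenius_norm A = 1].

Let delta_sphere : sphere (delta_mx (Ordinal p_gt0) (Ordinal m_gt0)).
Proof.
split; last by rewrite frobenius_normE mxdot_delta sqrtr1.
have [k0 _] := andP kp; have [s0 _] := andP sm.
apply/sparse_mxP; exists [set Ordinal p_gt0]%SET, [set Ordinal m_gt0]%SET.
split; rewrite ?cards1//; apply/matrixP => i j.
rewrite mulmx_projmxE projmxE !inE !mxE.
by do 2!case: eqP => //=.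
Qed.

(** The Frobenius norm dominates the operator norm, so [N (pid_mx r)] bounds the set. *)
Lemma has_sup_sparse_norm : has_sup (N @` sphere).
Proof.
split; first by exists (N (delta_mx (Ordinal p_gt0) (Ordinal m_gt0)));
  exists (delta_mx (Ordinal p_gt0) (Ordinal m_gt0)); first exact: delta_sphere.
exists (N (pid_mx r)); move=> x [A [sA]]; rewrite frobenius_normE => A1 <-.
by have := uinorm_sparse_pid sA; rewrite A1 mul1r.
Qed.

Lemma sparse_norm_sup_gt0 : 0 < L.
Proof.
have d0 : 0 < N (delta_mx (Ordinal p_gt0) (Ordinal m_gt0)).
  by apply: uinorm_gt0 => //; rewrite -mxdot_eq0 mxdot_delta oner_eq0.
apply: lt_le_trans d0 _; apply: sup_upper_bound; first exact: has_sup_sparse_norm.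
by exists (delta_mx (Ordinal p_gt0) (Ordinal m_gt0)).
Qed.

(** This comparison lets the sign bound absorb a logarithmic term whose logarithm is bounded. *)
Lemma sparse_norm_sup_le : L <= N (pid_mx r).
Proof.
apply: ge_sup; first by have [] := has_sup_sparse_norm.
move=> x [A [sA]]; rewrite frobenius_normE => A1 <-.
by have := uinorm_sparse_pid sA; rewrite A1 mul1r.
Qed.

Lemma uinorm_sparse_sup (A : 'M[R]_(p, m)) : sparse_mx k s A ->
  N A <= L * Num.sqrt (mxdot A A).
Proof.
move=> sA; have [->|A0] := eqVneq A 0.
  by rewrite uinorm0// mxdot0l sqrtr0 mulr0.
have t0 : 0 < Num.sqrt (mxdot A A) by rewrite sqrtr_gt0 mxdot_gt0.
rewrite -ler_pdivrMr// mulrC -[X in X * _]gtr0_norm ?invr_gt0// -(norm_scale nN).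
apply: sup_upper_bound; first exact: has_sup_sparse_norm.
exists ((Num.sqrt (mxdot A A))^-1 *: A) => //; split.
  have [K [S [hK hS AE]]] := (sparse_mxP k s A).1 sA.
  by apply/sparse_mxP; exists K, S; split => //; rewrite -scalemxAr -scalemxAl -AE.
rewrite frobenius_normE mxdotZl mxdotZr -{3}[mxdot A A]sqr_sqrtr ?mxdot_ge0//.
by rewrite (_ : _ * _ = 1) ?sqrtr1//; field; rewrite gt_eqF.
Qed.

(** A maximiser up to a factor 2 is enough for the rate, so attainment of the supremum is never
    discussed. *)
Lemma sparse_norm_sup_near : exists A : 'M[R]_(p, m),
  [/\ sparse_mx k s A, mxdot A A = 1 & L / 2 <= N A].
Proof.
have L2 : 0 < L / 2 by rewrite divr_gt0// sparse_norm_sup_gt0.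
have [_ [A [sA A1] <-] h] := sup_adherent L2 has_sup_sparse_norm.
exists A; split => //; last by move: h; rewrite -/(sparse_norm_sup k s N); lra.
by move: A1; rewrite frobenius_normE => /(congr1 (fun x => x ^+ 2)); rewrite sqr_sqrtr ?mxdot_ge0// expr1n.
Qed.

End sparse_norm.
End sparse_matrices.

(** * Equalising row lengths, coordinate isometries, continuity of norms *)

Section rotations_and_selections.
Context (R : realType).

(** A quadratic form in the plane with values below and above [t] on the two axes takes the value
    [t] on the unit circle. Division by [c ^+ 2] leaves a quadratic equation for the tangent [y],
    whose reduced discriminant [D] is nonnegative as [a < t < b]. *)
Lemma quadratic_rotation (a b g t : R) : a < t -> t < b ->
  exists c s, c ^+ 2 + s ^+ 2 = 1 /\ c ^+ 2 * a + 2 * c * s * g + s ^+ 2 * b = t.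
Proof.
move=> at_ tb; pose D := g ^+ 2 + (t - a) * (b - t).
have D0 : 0 <= D by rewrite addr_ge0 ?sqr_ge0// mulr_ge0//; lra.
pose y := (Num.sqrt D - g) / (b - t).
have bt0 : b - t != 0 by rewrite subr_eq0 gt_eqF.
have yE : (a - t) + 2 * g * y + (b - t) * y ^+ 2 = 0.
  have -> : (a - t) + 2 * g * y + (b - t) * y ^+ 2 =
      ((a - t) * (b - t) - g ^+ 2 + Num.sqrt D ^+ 2) / (b - t).
    by rewrite /y; field.
  by rewrite sqr_sqrtr// /D (_ : _ + _ = 0) ?mul0r//; ring.
have y0 : 0 < 1 + y ^+ 2 by rewrite ltr_wpDr ?sqr_ge0.
pose c := (Num.sqrt (1 + y ^+ 2))^-1.
have cE : c ^+ 2 = (1 + y ^+ 2)^-1 by rewrite exprVn sqr_sqrtr// ltW.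
exists c, (y * c); split.
  by rewrite exprMn cE; field; rewrite gt_eqF.
have -> : c ^+ 2 * a + 2 * c * (y * c) * g + (y * c) ^+ 2 * b =
  c ^+ 2 * ((a - t) + 2 * g * y + (b - t) * y ^+ 2) + t * (c ^+ 2 * (1 + y ^+ 2)) by ring.
by rewrite yE mulr0 add0r cE mulVf ?mulr1// gt_eqF.
Qed.

Lemma mxdot_delta_row n (i j : 'I_n) :
  mxdot (delta_mx 0 i : 'rV[R]_n) (delta_mx 0 j) = (i == j)%:R.
Proof.
rewrite /mxdot big_ord1 (bigD1 i)//= big1 ?addr0 => [|k ki].
  by rewrite !mxE !eqxx mul1r.
by rewrite !mxE (negbTE ki) mul0r.
Qed.

(** Induction on the number of rows whose length is not the average: a row that is too short and one
    that is too long span a plane in which a reflection gives the first exactly the average length.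
    The second was already bad and the others do not change. *)
Lemma equal_row_norms k m (A : 'M[R]_(k, m)) : exists2 U, orthogonal_mx U &
  forall i, mxdot (row i (U *m A)) (row i (U *m A)) = mxdot A A / k%:R.
Proof.
pose bad (B : 'M[R]_(k, m)) := [set i | mxdot (row i B) (row i B) != mxdot B B / k%:R]%SET.
have [n] := ubnP #|bad A|; elim: n A => // n IH A badn.
have [/eqP b0|[i0 i0bad]] := set_0Vmem (bad A).
  exists 1%:M; first exact: orthogonal_mx1.
  move=> i; rewrite mul1mx; apply/eqP; move: b0 => /eqP/setP/(_ i).
  by rewrite !inE => /negbFE.
have k0 : (0 < k)%N by apply: leq_ltn_trans (ltn_ord i0).
have kn0 : (k%:R : R) != 0 by rewrite pnatr_eq0 -lt0n.
set t := mxdot A A / k%:R.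
have sumt : \sum_i (mxdot (row i A) (row i A) - t) = 0.
  rewrite big_split /= -mxdot_rows sumrN sumr_const card_ord -mulr_natr.
  by rewrite divfK// subrr.
have [i it] : exists i, mxdot (row i A) (row i A) < t.
  apply/not_existsP => h; move: i0bad; rewrite inE => /eqP; apply.
  have h' i : 0 <= mxdot (row i A) (row i A) - t.
    by rewrite subr_ge0 leNgt; apply/negP/h.
  move/eqP: sumt; rewrite psumr_eq0// => /allP/(_ i0); rewrite mem_index_enum => /(_ isT).
  by rewrite subr_eq0 => /eqP.
have [j jt] : exists j, t < mxdot (row j A) (row j A).
  apply/not_existsP => h; move: i0bad; rewrite inE => /eqP; apply.
  have h' i' : 0 <= - (mxdot (row i' A) (row i' A) - t).
    by rewrite oppr_ge0 subr_le0 leNgt; apply/negP/h.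
  move/eqP: sumt; rewrite -oppr_eq0 -sumrN psumr_eq0// => /allP/(_ i0).
  by rewrite mem_index_enum => /(_ isT); rewrite oppr_eq0 subr_eq0 => /eqP.
have [c [s [cs ct]]] := quadratic_rotation (mxdot (row i A) (row j A)) it jt.
have ij : i != j by apply: contraTneq it => ->; rewrite -leNgt ltW.
(* [x] is a unit vector whose image under [A] has squared length [t]; the reflection exchanging it
   with the basis vector of index [i] turns this image into the new row [i]. *)
pose x : 'rV[R]_k := c *: delta_mx 0 i + s *: delta_mx 0 j.
have xx : mxdot (delta_mx 0 i : 'rV[R]_k) (delta_mx 0 i) = mxdot x x.
  rewrite /x !(mxdotDl, mxdotDr, mxdotZl, mxdotZr) !mxdot_delta_row !eqxx (negbTE ij).
  by rewrite (eq_sym j) (negbTE ij) mulr1n mulr0n -[LHS]cs; ring.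
pose H := householder (delta_mx 0 i - x).
have oH : orthogonal_mx H := orthogonal_householder _.
have rowi : row i (H *m A) = c *: row i A + s *: row j A.
  by rewrite rowE mulmxA householder_swap// /x mulmxDl -!scalemxAl -!rowE.
have rowl l : l != i -> l != j -> row l (H *m A) = row l A.
  move=> li lj; rewrite rowE mulmxA householder_fix -?rowE//.
  rewrite /x mxdotBr mxdotDr !mxdotZr !mxdot_delta_row (negbTE li) (negbTE lj).
  by rewrite !mulr0 addr0 subrr.
have HA : mxdot (H *m A) (H *m A) = mxdot A A by rewrite mxdot_orthl.
have [|U oU hU] := IH (H *m A).
  apply: (@leq_ltn_trans #|(bad A :\ i)%SET|); last first.
    by move: badn; rewrite (cardsD1 i) inE (lt_eqF it) add1n ltnS.
  apply: subset_leq_card; apply/fintype.subsetP => l; rewrite !inE HA -/t.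
  have [->|li] /= := eqVneq l i.
    rewrite rowi !(mxdotDl, mxdotDr, mxdotZl, mxdotZr) (mxdotC (row j A) (row i A)).
    by rewrite -ct => /eqP[]; ring.
  have [->|lj] := eqVneq l j; first by move=> _; rewrite gt_eqF.
  by rewrite rowl.
exists (U *m H); first exact: orthogonal_mxM.
by move=> l; rewrite -mulmxA hU HA.
Qed.

(** Supports are encoded by 0/1 matrices, isometries for injective [f], so that the norm lemmas for
    isometric embeddings apply to the placement of rows. *)
Definition selmx p k (f : 'I_k -> 'I_p) : 'M[R]_(p, k) := \matrix_(i, j) (i == f j)%:R.

Lemma tr_selmx_mulE p k m (f : 'I_k -> 'I_p) (A : 'M[R]_(p, m)) j l :
  ((selmx f)^T *m A) j l = A (f j) l.
Proof.
rewrite mxE (bigD1 (f j))//= big1 ?addr0 => [|i ij]; first by rewrite !mxE eqxx mul1r.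
by rewrite !mxE (negbTE ij) mul0r.
Qed.

Lemma selmx_isometry p k (f : 'I_k -> 'I_p) : injective f ->
  (selmx f)^T *m selmx f = 1%:M.
Proof.
by move=> fI; apply/matrixP => i j; rewrite tr_selmx_mulE !mxE (inj_eq fI).
Qed.

Lemma selmx_mulE p k m (f : 'I_k -> 'I_p) (A : 'M[R]_(k, m)) j l : injective f ->
  (selmx f *m A) (f j) l = A j l.
Proof.
by move=> fI; rewrite -(tr_selmx_mulE f) mulmxA selmx_isometry// mul1mx.
Qed.

Lemma selmx_mul0 p k m (f : 'I_k -> 'I_p) (A : 'M[R]_(k, m)) i l :
  (forall j, f j != i) -> (selmx f *m A) i l = 0.
Proof.
by move=> h; rewrite mxE big1// => j _; rewrite mxE eq_sym (negbTE (h j)) mul0r.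
Qed.

Lemma superset_card (T : finType) (K : {set T}) n : (#|K| <= n <= #|T|)%N ->
  exists2 K' : {set T}, K \subset K' & #|K'| = n.
Proof.
move=> /andP[]; elim: n => [|n IH]; first by rewrite leqn0 => /eqP K0 _; exists K.
rewrite leq_eqVlt => /orP[/eqP <-|]; first by exists K.
rewrite ltnS => Kn nT; have [K' KK' K'n] := IH Kn (ltnW nT).
have /set0Pn[x] : (~: K' != finset.set0)%SET.
  by rewrite -card_gt0 cardsCs finset.setCK subn_gt0 K'n.
rewrite inE => xK'; exists (x |: K')%SET; last by rewrite cardsU1 xK' K'n.
exact: (fintype.subset_trans KK' (finset.subsetUr _ _)).
Qed.

Lemma set_enumeration (T : finType) (K : {set T}) n : #|K| = n ->
  exists f : 'I_n -> T, injective f /\ K =i codom f.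
Proof.
move=> Kn; exists (fun i => enum_val (cast_ord (esym Kn) i)); split.
  by move=> i j /enum_val_inj/cast_ord_inj.
move=> x; apply/idP/codomP => [xK|[i ->]]; last exact: enum_valP.
exists (cast_ord Kn (enum_rank_in xK x)).
by rewrite cast_ordK enum_rankK_in.
Qed.

Lemma selmx_projmx p k (f : 'I_k -> 'I_p) (K : {set 'I_p}) : injective f ->
  K =i codom f ->
  selmx f *m (selmx f)^T = projmx R K.
Proof.
move=> fI fK; apply/matrixP => i j.
have [/codomP[a ->]|iK] := boolP (i \in codom f).
  by rewrite selmx_mulE// !mxE fK codom_f eq_sym.
rewrite selmx_mul0; last by move=> a; apply: contraNneq iK => <-; exact: codom_f.
by rewrite !mxE fK (negbTE iK) mul0rn.
Qed.

Lemma continuous_uinorm p m (N : 'M[R]_(p, m) -> R) : is_norm N -> continuous N.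
Proof.
move=> nN X.
(* The sum is a Lipschitz constant for the entrywise maximum; the added 1 makes [C] positive even
   for empty matrices and leaves the slack needed for an open ball. *)
pose C := \sum_i \sum_j N (delta_mx i j) + 1.
have Nd i j : 0 <= N (delta_mx i j) by exact: uinorm_ge0.
have C0 : 0 < C.
  by rewrite ltr_wpDl//; apply: sumr_ge0 => i _; apply: sumr_ge0.
have lip (Y : 'M[R]_(p, m)) (e : R) : (forall i j, `|X i j - Y i j| <= e) -> `|N X - N Y| <= C * e - e.
  move=> XY.
  have h Y1 Y2 : N Y1 - N Y2 <= N (Y1 - Y2).
    by rewrite lerBlDr; have := norm_triangle nN (Y1 - Y2) Y2; rewrite subrK.
  apply: (@le_trans _ _ (N (X - Y))).
    have := h X Y; have := h Y X; rewrite -(uinormN nN (Y - X)) opprB ler_norml.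
    by move=> h1 h2; apply/andP; split; lra.
  rewrite {1}[X - Y]matrix_sum_delta; apply: le_trans (uinorm_sum nN _ _ _) _.
  rewrite /C mulrDl mul1r addrK mulr_suml; apply: ler_sum => i _.
  apply: le_trans (uinorm_sum nN _ _ _) _; rewrite mulr_suml; apply: ler_sum => j _.
  by rewrite (norm_scale nN) mulrC ler_wpM2l// !mxE.
move=> A /= /nbhs_ballP [e /= e0 sA]; apply/nbhs_ballP.
have eC : 0 < e / C by rewrite divr_gt0.
exists (e / C) => //= Y [_ XY]; apply: sA; rewrite /ball /=.
have := @lip Y (e / C) (fun i j => ltW (XY i j)).
by rewrite mulrC divfK ?gt_eqF// => h; apply: le_lt_trans h _; rewrite ltrBlDr ltrDl.
Qed.

End rotations_and_selections.

(** * Bayes risk and likelihood overlaps *)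

Lemma measurable_fun_inv_ge0 d (T : measurableType d) (R : realType) (f : T -> R) :
  measurable_fun setT f -> (forall x, 0 <= f x) ->
  measurable_fun setT (fun x => (f x)^-1).
Proof.
move=> mf f0; rewrite (_ : (fun x => _) = (fun x => f x `^ (-1))).
  exact: (measurableT_comp (measurable_powR (-1)) mf).
by apply/funext => x; rewrite powR_inv1.
Qed.

(** The weights [x i * x j / \sum_l x l] have marginals [x], so each of the two terms of the
    triangle inequality contributes the same sum. *)
Lemma symmetrized_weighted_sum (R : realType) (I : finType) (x Nx : I -> R) (D : I -> I -> R) :
  (forall i, 0 < x i) -> (forall i j, D i j <= Nx i + Nx j) ->
  \sum_i \sum_j D i j * (x i * x j / \sum_l x l) <= 2 * \sum_i Nx i * x i.
Proof.
move=> x0 DN; set S := \sum_l x l.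
have [i0 _|I0] := pickP I; last first.
  rewrite !big1 ?mulr0// => i; by have := I0 i.
have S0 : 0 < S.
  rewrite /S (bigD1 i0)//= ltr_wpDr//; apply: sumr_ge0 => i _; exact: ltW.
have half : \sum_i \sum_j Nx i * (x i * x j / S) = \sum_i Nx i * x i.
  apply: eq_bigr => i _; rewrite -mulr_sumr; congr (_ * _).
  by rewrite -mulr_suml -mulr_sumr -/S mulfK// gt_eqF.
have half' : \sum_i \sum_j Nx j * (x i * x j / S) = \sum_i Nx i * x i.
  rewrite exchange_big -half; apply: eq_bigr => i _; apply: eq_bigr => j _.
  by rewrite (mulrC (x i)).
rewrite mulr_natl mulr2n -{1}half -half' -big_split /=; apply: ler_sum => i _.
rewrite -big_split /=; apply: ler_sum => j _; rewrite -mulrDl ler_wpM2r//.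
by rewrite divr_ge0 ?mulr_ge0// ltW.
Qed.

Section bayes_risk.
Context d (T : measurableType d) (R : realType) (P : probability T R).
Context (p m k s : nat) (Z : 'I_p * 'I_m -> {RV P >-> R}) (N : 'M[R]_(p, m) -> R).
Hypotheses (iidZ : iid_standard_normal Z) (nN : is_norm N).
Context (O : finType) (M : O -> 'M[R]_(p, m)).
Hypothesis sM : forall o, sparse_mx k s (M o).
Local Notation mx := (borel_mx R p m).

(** Density of the law of [A] plus noise with respect to the law of the noise, by
    [cameron_martin]. *)
Definition likelihood (A X : 'M[R]_(p, m)) : R := expR (mxdot A X - mxdot A A / 2).

Lemma likelihood_gt0 A X : 0 < likelihood A X. Proof. exact: expR_gt0. Qed.

Lemma measurable_mxdot (A : 'M[R]_(p, m)) :
  measurable_fun setT (fun X : mx => mxdot A X).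
Proof.
apply: measurable_sum => i; apply: measurable_sum => j.
by apply: measurable_funM => //; exact: measurable_mxcoord.
Qed.

Lemma measurable_likelihood A : measurable_fun setT (likelihood A : mx -> R).
Proof.
by apply: measurableT_comp => //; apply: measurable_funB => //; exact: measurable_mxdot.
Qed.

Lemma measurable_uinorm : measurable_fun setT (N : mx -> R).
Proof. by apply: continuous_measurable_mx; exact: continuous_uinorm. Qed.

(** Integrated over the noise, this is the mean under the hypothesis [M o] of the posterior weight
    of [o'] for the uniform prior. *)
Definition overlap (o o' : O) (X : 'M[R]_(p, m)) : R :=
  likelihood (M o) X * likelihood (M o') X / \sum_o'' likelihood (M o'') X.

Lemma overlap_ge0 o o' X : 0 <= overlap o o' X.
Proof.
apply: divr_ge0; first by rewrite mulr_ge0 ?ltW ?likelihood_gt0.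
by apply: sumr_ge0 => i _; exact: expR_ge0.
Qed.

Lemma measurable_overlap o o' : measurable_fun setT (overlap o o' : mx -> R).
Proof.
apply: measurable_funM.
  by apply: measurable_funM; exact: measurable_likelihood.
apply: measurable_fun_inv_ge0 => [|X].
  by apply: measurable_sum => i; exact: measurable_likelihood.
by apply: sumr_ge0 => i _; exact: expR_ge0.
Qed.

Definition pair_overlap (o o' : O) : \bar R :=
  (\int[P]_w (overlap o o' (noise_mx Z w))%:E)%E.

(** The supremum over sparse matrices dominates the risk at each [M o]. Summing the linearised
    risks, with all expectations moved to pure noise, makes the triangle inequality applicable
    pointwise in the observation. *)
Lemma bayes_risk_bound (a q : R) (n := #|O|) : (0 < n)%N -> 0 <= a ->
  (q%:E <= \sum_o \sum_o' (N (M o - M o') / n%:R)%:E * pair_overlap o o')%E ->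
  ((a * q - a ^+ 2)%:E <= minimax_risk k s N Z)%E.
Proof.
move=> n0 a0 hq; have nR : 0 < n%:R :> R by rewrite ltr0n.
apply: le_ereal_inf_tmp => _ [est _ <-].
set B := ereal_sup _.
pose loss o (X : mx) : R := N (est X - M o).
have mloss o : measurable_fun setT (loss o).
  apply: (measurableT_comp measurable_uinorm).
  apply: (measurableT_comp (measurable_mxtranslate (- M o))).
  exact: measurable_funP.
have loss0 o X : 0 <= loss o X by exact: uinorm_ge0 nN _.
have hB o : (\int[P]_w ((loss o (M o + noise_mx Z w)) ^+ 2)%:E <= B)%E.
  by apply: ereal_sup_ubound; exists (M o) => //; rewrite unlock.
have mnoise := measurable_noise Z.
have mMn o : measurable_fun setT (fun w => M o + noise_mx Z w : mx).
  rewrite (_ : (fun w => _) = (fun w => noise_mx Z w + M o)).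
    exact: (measurableT_comp (measurable_mxtranslate (M o)) mnoise).
  by apply/funext => w; rewrite addrC.
have mll o : measurable_fun setT (fun w =>
    (2 * a * loss o (noise_mx Z w) * likelihood (M o) (noise_mx Z w))%:E).
  apply/measurable_EFinP/measurable_funM; last first.
    exact: (measurableT_comp (measurable_likelihood _) mnoise).
  apply: measurable_funM => //; exact: (measurableT_comp (mloss o) mnoise).
(* [2 * a * l <= l ^+ 2 + a ^+ 2] under [M o], followed by the change of measure to the noise. *)
have hB2 o : (\int[P]_w (2 * a * loss o (noise_mx Z w) * likelihood (M o) (noise_mx Z w))%:E <=
    B + (a ^+ 2)%:E)%E.
  pose f : mx -> \bar R := fun X => (2 * a * loss o X)%:E.
  have <- : (\int[P]_w f (M o + noise_mx Z w)%R = \int[P]_w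
      (2 * a * loss o (noise_mx Z w) * likelihood (M o) (noise_mx Z w))%:E)%E.
    rewrite (cameron_martin iidZ)//.
      by apply/measurable_EFinP/measurable_funM.
    by move=> X; rewrite lee_fin !mulr_ge0.
  have -> : (a ^+ 2)%:E = (\int[P]_w (cst (a ^+ 2)%:E w))%E.
    by rewrite integral_cst// -[LHS]mule1; congr (_ * _)%E; apply/esym; exact: probability_setT.
  apply: le_trans (leeD (hB o) (lexx _)).
  rewrite -ge0_integralD//; last 3 first.
  - by move=> w _; rewrite lee_fin sqr_ge0.
  - by apply/measurable_EFinP/measurable_funX; exact: (measurableT_comp (mloss o) (mMn o)).
  - by move=> w _; rewrite /= lee_fin sqr_ge0.
  apply: ge0_le_integral => //.
  - by move=> w _; rewrite lee_fin !mulr_ge0.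
  - by apply/measurable_EFinP/measurable_funM => //; exact: (measurableT_comp (mloss o) (mMn o)).
  - apply: emeasurable_funD => //; apply/measurable_EFinP/measurable_funX.
    exact: (measurableT_comp (mloss o) (mMn o)).
  - move=> w _; rewrite /f /= lee_fin -subr_ge0.
    by rewrite (_ : _ - _ = (loss o (M o + noise_mx Z w) - a) ^+ 2) ?sqr_ge0//; ring.
pose ov (X : mx) := \sum_o \sum_o' N (M o - M o') / n%:R * overlap o o' X.
have mov : measurable_fun setT (fun w => (ov (noise_mx Z w))%:E).
  apply/measurable_EFinP/(measurableT_comp _ mnoise).
  apply: measurable_sum => o; apply: measurable_sum => o'.
  by apply: measurable_funM => //; exact: measurable_overlap.
have N0 o o' : 0 <= N (M o - M o') / n%:R by rewrite divr_ge0 ?uinorm_ge0.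
have mpo o o' : measurable_fun setT
    (fun w => (N (M o - M o') / n%:R * overlap o o' (noise_mx Z w))%:E).
  apply/measurable_EFinP/measurable_funM => //.
  exact: (measurableT_comp (measurable_overlap o o') mnoise).
have hov : (q%:E <= \int[P]_w (ov (noise_mx Z w))%:E)%E.
  apply: le_trans hq _.
  rewrite (_ : (fun w => _) = (fun w => \sum_o \sum_o'
     (N (M o - M o') / n%:R * overlap o o' (noise_mx Z w))%:E)%E); last first.
    by apply/funext => w; rewrite -sumEFin; apply: eq_bigr => o _; rewrite -sumEFin.
  rewrite ge0_integral_sum//; last 2 first.
  - by move=> o; apply: emeasurable_sum.
  - by move=> o w _; apply: sume_ge0 => o' _; rewrite lee_fin mulr_ge0 ?overlap_ge0.
  apply: lee_sum => o _; rewrite ge0_integral_sum//; last first.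
    by move=> o' w _; rewrite lee_fin mulr_ge0 ?overlap_ge0.
  apply: lee_sum => o' _; rewrite -ge0_integralZl_EFin//.
  - by move=> w _; rewrite lee_fin overlap_ge0.
  - by apply/measurable_EFinP; exact: (measurableT_comp (measurable_overlap o o') mnoise).
have key : ((a * n%:R * q)%:E <= \sum_(o : O) (B + (a ^+ 2)%:E))%E.
  apply: (@le_trans _ _ (\sum_(o : O) \int[P]_w (2 * a * loss o (noise_mx Z w) *
      likelihood (M o) (noise_mx Z w))%:E)%E); last by apply: lee_sum => o _; exact: hB2.
  rewrite -ge0_integral_sum//; last first.
    by move=> o w _; rewrite lee_fin !mulr_ge0// ltW// likelihood_gt0.
  rewrite EFinM; apply: (@le_trans _ _ ((a * n%:R)%:E * \int[P]_w (ov (noise_mx Z w))%:E)%E).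
    by apply: lee_wpmul2l => //; rewrite lee_fin mulr_ge0// ltW.
  have ov0 X : 0 <= ov X.
    by apply: sumr_ge0 => o _; apply: sumr_ge0 => o' _; rewrite mulr_ge0 ?overlap_ge0.
  rewrite -ge0_integralZl_EFin//; last 2 first.
  - by move=> w _; rewrite lee_fin.
  - by rewrite mulr_ge0// ltW.
  apply: ge0_le_integral => //.
  - by move=> w _; rewrite mule_ge0// lee_fin// mulr_ge0// ltW.
  - by apply: emeasurable_funM.
  - exact: emeasurable_sum.
  move=> w _; rewrite sumEFin -EFinM lee_fin; set X := noise_mx Z w.
  have := @symmetrized_weighted_sum R O (fun o => likelihood (M o) X) (loss^~ X)
     (fun o o' => N (M o - M o')) (fun o => likelihood_gt0 _ _).
  have tri o o' : N (M o - M o') <= loss o X + loss o' X.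
    have := norm_triangle nN (M o - est X) (est X - M o').
    by rewrite addrA subrK -(uinormN nN (M o - est X)) opprB.
  move=> /(_ tri) h.
  have -> : a * n%:R * ov X = a * \sum_o \sum_o' N (M o - M o') * overlap o o' X.
    rewrite -mulrA; congr (_ * _); rewrite /ov mulr_sumr; apply: eq_bigr => o _.
    rewrite mulr_sumr; apply: eq_bigr => o' _.
    by field; rewrite gt_eqF.
  apply: le_trans (ler_wpM2l a0 h) _.
  rewrite mulrA mulr_sumr.
  by rewrite le_eqVlt; apply/orP; left; apply/eqP; apply: eq_bigr => o _; ring.
have /card_gt0P[i1 _] := n0.
have B0 : (0 <= B)%E.
  by apply: le_trans (hB i1); apply: integral_ge0 => w _; rewrite lee_fin sqr_ge0.
move: key B0; case: B {hB hB2} => [b| |] //; last by move=> _ _; exact: leey.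
rewrite -EFinD sumEFin !lee_fin sumr_const -[X in _ <= X]mulr_natl -/n => key _.
have : a * q <= b + a ^+ 2.
  by rewrite -(ler_pM2l nR) mulrCA mulrA.
lra.
Qed.

(** The choice [a = q / 2] maximises [a * q - a ^+ 2]. *)
Lemma bayes_risk_bound_sq (q : R) (n := #|O|) : (0 < n)%N -> 0 <= q ->
  (q%:E <= \sum_o \sum_o' (N (M o - M o') / n%:R)%:E * pair_overlap o o')%E ->
  ((q ^+ 2 / 4)%:E <= minimax_risk k s N Z)%E.
Proof.
move=> n0 q0 hq; have := @bayes_risk_bound (q / 2) q n0 (ltac:(lra)) hq.
by congr (_%:E <= _)%E; field.
Qed.

End bayes_risk.

(** * Finiteness and total mass of the overlaps *)

Section real_overlap.
Context d (T : measurableType d) (R : realType) (P : probability T R).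
Context (p m : nat) (Z : 'I_p * 'I_m -> {RV P >-> R}).
Hypothesis iidZ : iid_standard_normal Z.
Local Notation mx := (borel_mx R p m).

Lemma integral_likelihood (A : 'M[R]_(p, m)) :
  (\int[P]_w (likelihood A (noise_mx Z w))%:E = 1)%E.
Proof.
rewrite -[RHS](_ : ((expR (- (mxdot A A / 2)))%:E * \int[P]_w (expR (mxdot A (noise_mx Z w)))%:E = 1)%E); last first.
  by rewrite integral_mxdot_expR// -EFinM -expRD addNr expR0.
rewrite -ge0_integralZl_EFin ?expR_ge0//.
- by apply: eq_integral => w _; rewrite /likelihood -EFinM -expRD addrC.
- apply/measurable_EFinP/measurableT_comp => //.
  exact: (measurableT_comp (measurable_mxdot A) (measurable_noise Z)).
Qed.

(** The squared likelihood of [A] is [expR (mxdot A A)] times the likelihood of [2 *: A], which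
    integrates to 1. *)
Lemma integral_likelihood_sq (A : 'M[R]_(p, m)) :
  (\int[P]_w (likelihood A (noise_mx Z w) ^+ 2)%:E = (expR (mxdot A A))%:E)%E.
Proof.
have mlik : measurable_fun setT (fun w => (likelihood (2 *: A) (noise_mx Z w))%:E).
  apply/measurable_EFinP.
  exact: (measurableT_comp (measurable_likelihood _) (measurable_noise Z)).
transitivity ((expR (mxdot A A))%:E * \int[P]_w (likelihood (2 *: A) (noise_mx Z w))%:E)%E;
  last by rewrite integral_likelihood mule1.
have l0 w : setT w -> (0 <= (likelihood (2 *: A) (noise_mx Z w))%:E)%E.
  by move=> _; rewrite lee_fin expR_ge0.
rewrite -(ge0_integralZl_EFin P measurableT l0 mlik (expR_ge0 _)).
apply: eq_integral => w _; rewrite /likelihood -EFinM expr2 -!expRD.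
by rewrite !mxdotZl !mxdotZr; congr (expR _)%:E; field.
Qed.

Context (O : finType) (M : O -> 'M[R]_(p, m)).

Lemma pair_overlap_ge0 o o' : (0 <= pair_overlap Z M o o')%E.
Proof. by apply: integral_ge0 => w _; rewrite lee_fin overlap_ge0. Qed.

Lemma pair_overlap_le1 o o' : (pair_overlap Z M o o' <= 1)%E.
Proof.
rewrite -(integral_likelihood (M o)); apply: ge0_le_integral => //.
- by move=> w _; rewrite lee_fin overlap_ge0.
- apply/measurable_EFinP.
  exact: (measurableT_comp (measurable_overlap M o o') (measurable_noise Z)).
- apply/measurable_EFinP.
  exact: (measurableT_comp (measurable_likelihood _) (measurable_noise Z)).
move=> w _; rewrite lee_fin /overlap -mulrA ger_pMr ?likelihood_gt0//.
have S0 : 0 < \sum_o'' likelihood (M o'') (noise_mx Z w).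
  rewrite (bigD1 o)//= ltr_pwDl ?likelihood_gt0//.
  by apply: sumr_ge0 => i _; exact: expR_ge0.
rewrite ler_pdivrMr// mul1r (bigD1 o')//= lerDl.
by apply: sumr_ge0 => i _; exact: expR_ge0.
Qed.

Definition ov (o o' : O) : R := fine (pair_overlap Z M o o').

Lemma ovE o o' : pair_overlap Z M o o' = (ov o o')%:E.
Proof.
rewrite fineK// ge0_fin_numE ?pair_overlap_ge0//.
by apply: le_lt_trans (pair_overlap_le1 _ _) _; rewrite ltry.
Qed.

Lemma ov_ge0 o o' : 0 <= ov o o'.
Proof. by rewrite fine_ge0// pair_overlap_ge0. Qed.

(* With [S] the sum of the likelihoods and [Q] the sum of their squares,
   [Q / S <= #|O| / 2 + 2 Q / #|O|]: use [Q <= S ^ 2] when [S < #|O| / 2]. *)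
Lemma sum_ov_lb (rho : R) : (0 < #|O|)%N ->
  (forall o, mxdot (M o) (M o) <= rho) -> expR rho <= #|O|%:R / 8 ->
  #|O|%:R / 4 <= \sum_o \sum_(o' | o' != o) ov o o'.
Proof.
move=> O0 Mrho rhoO; set n : R := #|O|%:R; have n0 : 0 < n by rewrite ltr0n.
pose y o w := likelihood (M o) (noise_mx Z w).
have y0 o w : 0 < y o w by exact: expR_gt0.
have my o : measurable_fun setT (y o).
  exact: (measurableT_comp (measurable_likelihood _) (measurable_noise Z)).
have key : (\sum_o \int[P]_w (y o w)%:E <=
    \sum_o \sum_(o' | o' != o) pair_overlap Z M o o' + (n / 2)%:E +
    \sum_o (2 / n)%:E * \int[P]_w (y o w ^+ 2)%:E)%E.
  have mov o o' : measurable_fun setT (fun w => (overlap M o o' (noise_mx Z w))%:E).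
    apply/measurable_EFinP.
    exact: (measurableT_comp (measurable_overlap M o o') (measurable_noise Z)).
  have -> : (\sum_o \sum_(o' | o' != o) pair_overlap Z M o o' = \int[P]_w
      (\sum_o \sum_(o' | o' != o) overlap M o o' (noise_mx Z w))%:E)%E.
    transitivity (\int[P]_w (\sum_o \sum_(o' <- seq.filter (predC1 o) (index_enum O))
        (overlap M o o' (noise_mx Z w))%:E)%E)%E.
      rewrite ge0_integral_sum//; last 2 first.
      - by move=> o; apply: emeasurable_sum.
      - by move=> o w _; apply: sume_ge0 => o' _; rewrite lee_fin overlap_ge0.
      apply: eq_bigr => o _; rewrite ge0_integral_sum//; first by rewrite big_filter.
      by move=> o' w _; rewrite lee_fin overlap_ge0.
    apply: eq_integral => w _; rewrite -sumEFin; apply: eq_bigr => o _.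
    by rewrite big_filter sumEFin.
  have -> : ((n / 2)%:E = \int[P]_w (cst (n / 2)%:E w))%E.
    by rewrite integral_cst// -[LHS]mule1; congr (_ * _)%E; apply/esym; exact: probability_setT.
  have -> : (\sum_o (2 / n)%:E * \int[P]_w (y o w ^+ 2)%:E =
      \int[P]_w (\sum_o 2 / n * y o w ^+ 2)%:E)%E.
    transitivity (\int[P]_w (\sum_o (2 / n * y o w ^+ 2)%:E)%E)%E.
      rewrite ge0_integral_sum//; last 2 first.
      - by move=> o; apply/measurable_EFinP/measurable_funM => //; exact: measurable_funX.
      - by move=> o w _; rewrite lee_fin mulr_ge0 ?sqr_ge0 ?divr_ge0// ltW.
      apply: eq_bigr => o _; rewrite -ge0_integralZl_EFin//.
      - by move=> w _; rewrite lee_fin sqr_ge0.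
      - by apply/measurable_EFinP; exact: measurable_funX.
      - by rewrite divr_ge0// ltW.
    by apply: eq_integral => w _; rewrite sumEFin.
  have mS : measurable_fun setT (fun w =>
     (\sum_o \sum_(o' | o' != o) overlap M o o' (noise_mx Z w))%:E).
    apply/measurable_EFinP; apply: measurable_sum => o.
    rewrite (_ : (fun w => _) = (fun w => \sum_(o' <- seq.filter (predC1 o) (index_enum O))
        overlap M o o' (noise_mx Z w))); last by apply/funext => w; rewrite big_filter.
    by apply: measurable_sum => o'; apply/measurable_EFinP; exact: mov.
  have mQ : measurable_fun setT (fun w => (\sum_o 2 / n * y o w ^+ 2)%:E).
    apply/measurable_EFinP; apply: measurable_sum => o.
    by apply: measurable_funM => //; exact: measurable_funX.
  have S0' w : (0 <= (\sum_o \sum_(o' | o' != o) overlap M o o' (noise_mx Z w))%:E)%E.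
    by rewrite lee_fin; apply: sumr_ge0 => o _; apply: sumr_ge0 => o' _; exact: overlap_ge0.
  have Q0' w : (0 <= (\sum_o 2 / n * y o w ^+ 2)%:E)%E.
    by rewrite lee_fin; apply: sumr_ge0 => o _; rewrite mulr_ge0 ?sqr_ge0// divr_ge0// ltW.
  have c0 : (0 <= (n / 2)%:E)%E by rewrite lee_fin divr_ge0// ltW.
  rewrite -ge0_integralD// -ge0_integralD//; last 2 first.
  - by move=> w _; rewrite adde_ge0.
  - exact: emeasurable_funD.
  rewrite -ge0_integral_sum//; last 2 first.
  - by move=> o; exact/measurable_EFinP.
  - by move=> o w _; rewrite lee_fin ltW.
  apply: ge0_le_integral => //.
  - by move=> w _; apply: sume_ge0 => o _; rewrite lee_fin ltW.
  - by apply: emeasurable_sum => o; exact/measurable_EFinP.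
  - by apply: emeasurable_funD => //; exact: emeasurable_funD.
  move=> w _; rewrite sumEFin -!EFinD lee_fin.
  set S := \sum_o y o w; pose Q := \sum_o y o w ^+ 2.
  have [i1 _] := card_gt0P O0.
  have S0 : 0 < S.
    by rewrite /S (bigD1 i1)//= ltr_pwDl//; apply: sumr_ge0 => o _; exact: ltW.
  have -> : \sum_o 2 / n * y o w ^+ 2 = 2 / n * Q by rewrite mulr_sumr.
  have -> : \sum_o \sum_(o' | o' != o) overlap M o o' (noise_mx Z w) = S - Q / S.
    rewrite -[S in S - _](mulfK (_ : S != 0)) ?gt_eqF// -mulrBl.
    have -> : S * S - Q = \sum_o \sum_(o' | o' != o) y o w * y o' w.
      rewrite /S mulr_suml -sumrB; apply: eq_bigr => o _.
      by rewrite mulr_sumr (bigD1 o)//= expr2 addrAC subrr add0r.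
    rewrite mulr_suml; apply: eq_bigr => o _; rewrite mulr_suml.
    by apply: eq_bigr.
  have Q0 : 0 <= Q by apply: sumr_ge0 => o _; exact: sqr_ge0.
  have QS : Q <= S * S.
    rewrite /Q /S mulr_suml; apply: ler_sum => o _; rewrite mulr_sumr (bigD1 o)//= expr2 lerDl.
    by apply: sumr_ge0 => o' _; rewrite mulr_ge0// ltW.
  have [hS|hS] := leP (n / 2) S.
    have : Q / S <= 2 / n * Q.
      rewrite mulrC ler_wpM2r// -(invrK (2 / n)) lef_pV2 ?posrE// ?invf_div//.
      by rewrite divr_gt0.
    by lra.
  have : Q / S <= n / 2.
    by rewrite ler_pdivrMr//; apply: le_trans QS _; rewrite ler_wpM2r// ltW.
  have : 0 <= 2 / n * Q by rewrite mulr_ge0// divr_ge0// ltW.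
  by lra.
move: key; rewrite (eq_bigr (fun=> 1%E)); last by move=> o _; exact: integral_likelihood.
under [X in (_ <= X + _ + _)%E]eq_bigr do under eq_bigr do rewrite ovE.
under [X in (_ <= X + _ + _)%E]eq_bigr do rewrite sumEFin.
rewrite [X in (_ <= _ + _ + X)%E](eq_bigr (fun o => (2 / n * expR (mxdot (M o) (M o)))%:E)); last first.
  by move=> o _; rewrite integral_likelihood_sq EFinM.
rewrite !sumEFin -!EFinD lee_fin sumr_const -/n.
(* The expected total likelihood is [n]; subtracting [n / 2] and this [n / 4] leaves the claimed
   quarter. *)
have : \sum_o 2 / n * expR (mxdot (M o) (M o)) <= n / 4.
  apply: (@le_trans _ _ (\sum_(o : O) 2 / n * (n / 8))).
    apply: ler_sum => o _; apply: ler_wpM2l; first by rewrite divr_ge0// ltW.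
    by apply: le_trans rhoO; rewrite ler_expR.
  rewrite sumr_const -mulr_natr -/n le_eqVlt; apply/orP; left; apply/eqP.
  by field; rewrite gt_eqF.
by rewrite -/n; lra.
Qed.

End real_overlap.

(** * The lower bound *)

Section product_prior.
Context d (T : measurableType d) (R : realType) (P : probability T R).
Context (p m : nat) (Z : 'I_p * 'I_m -> {RV P >-> R}).
Hypothesis iidZ : iid_standard_normal Z.
Local Notation mx := (borel_mx R p m).
Context (I B : finType) (M : I -> B -> 'M[R]_(p, m)).
Hypothesis orthM : forall i l b b', i != l -> mxdot (M i b) (M l b') = 0.

Definition prodmx (o : {ffun I -> B}) : 'M[R]_(p, m) := \sum_i M i (o i).

Lemma likelihood_sum (J : pred I) (o : I -> B) X :
  likelihood (\sum_(i | J i) M i (o i)) X = \prod_(i | J i) likelihood (M i (o i)) X.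
Proof.
rewrite /likelihood -expR_sum; congr expR.
rewrite !mxdot_suml sumrB; congr (_ - _); rewrite mulr_suml; apply: eq_bigr => i Ji.
rewrite mxdotC mxdot_suml (bigD1 i)//= big1 ?addr0// => l /andP[_ li].
exact: orthM.
Qed.

Lemma sum_likelihood_prod X :
  \sum_o likelihood (prodmx o) X = \prod_i \sum_b likelihood (M i b) X.
Proof. by rewrite bigA_distr_bigA; apply: eq_bigr => o _; exact: likelihood_sum. Qed.

(** Orthogonality factors all likelihoods over the pieces. Summing out the free coordinates of [o']
    cancels the same factors in the denominator, and only piece [i] keeps a mixture. *)
Lemma sum_overlap_prod (o : {ffun I -> B}) i b X :
  \sum_(o' : {ffun I -> B} | o' i == b) overlap prodmx o o' X =
  likelihood (\sum_(l | l != i) M l (o l)) X * overlap (M i) (o i) b X.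
Proof.
have S0 l : 0 < \sum_b likelihood (M l b) X.
  by rewrite (bigD1 (o l))//= ltr_pwDl ?likelihood_gt0//; apply: sumr_ge0 => c _; exact: expR_ge0.
have e : \sum_(o' : {ffun I -> B} | o' i == b) likelihood (prodmx o') X =
    likelihood (M i b) X * \prod_(l | l != i) \sum_c likelihood (M l c) X.
  pose g l c := if (l != i) || (c == b) then likelihood (M l c) X else 0.
  transitivity (\sum_(o' : {ffun I -> B}) \prod_l g l (o' l)).
    rewrite big_mkcond; apply: eq_bigr => o' _; case: ifPn => [/eqP oib|oib].
      rewrite likelihood_sum; apply: eq_bigr => l _; rewrite /g.
      by case: eqVneq => //= ->; rewrite oib eqxx.
    by rewrite (bigD1 i)//= /g eqxx (negbTE oib) mul0r.
  rewrite -(bigA_distr_bigA g) (bigD1 i)//=; congr (_ * _).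
    rewrite (bigD1 b)//= big1 ?addr0 /g ?eqxx//.
    by move=> c cb; rewrite (negbTE cb).
  by apply: eq_bigr => l li; apply: eq_bigr => c _; rewrite /g li.
under eq_bigr do rewrite /overlap sum_likelihood_prod.
rewrite -mulr_suml -mulr_sumr e [\prod_i \sum_b likelihood _ _](bigD1 i)//=.
rewrite [prodmx o](bigD1 i)//= {1}/likelihood.
have -> : expR (mxdot (M i (o i) + \sum_(l | l != i) M l (o l)) X -
    mxdot (M i (o i) + \sum_(l | l != i) M l (o l)) (M i (o i) + \sum_(l | l != i) M l (o l)) / 2) =
    likelihood (M i (o i)) X * likelihood (\sum_(l | l != i) M l (o l)) X.
  have h : mxdot (\sum_(l | l != i) M l (o l)) (M i (o i)) = 0.
    by rewrite mxdot_suml big1// => l li; exact: orthM.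
  rewrite /likelihood -expRD !(mxdotDl, mxdotDr) h (mxdotC (M i _) (\sum_(_ | _) _)) h.
  by congr expR; field.
rewrite /overlap; set u := \prod_(l | _) _.
have u0 : u != 0 by rewrite gt_eqF// prodr_gt0.
by field; rewrite u0 gt_eqF// S0.
Qed.

(** The likelihood of the other pieces is a change of measure that shifts the noise by [M']; as [M']
    is orthogonal to piece [i], the overlap at this piece does not see the shift. *)
Lemma sum_ov_prod (o : {ffun I -> B}) i b :
  \sum_(o' : {ffun I -> B} | o' i == b) ov Z prodmx o o' = ov Z (M i) (o i) b.
Proof.
apply: EFin_inj; rewrite -sumEFin.
under eq_bigr do rewrite -(ovE iidZ).
rewrite -(ovE iidZ) /pair_overlap -big_filter -ge0_integral_sum//; last 2 first.
- move=> o'; apply/measurable_EFinP.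
  exact: (measurableT_comp (measurable_overlap prodmx o o') (measurable_noise Z)).
- by move=> o' w _; rewrite lee_fin overlap_ge0.
pose M' := \sum_(l | l != i) M l (o l).
pose f : mx -> \bar R := fun X => (overlap (M i) (o i) b X)%:E.
transitivity (\int[P]_w f (M' + noise_mx Z w)%R)%E.
  rewrite (cameron_martin iidZ).
  - apply: eq_integral => w _; rewrite big_filter sumEFin sum_overlap_prod.
    by rewrite EFinM muleC.
  - by apply/measurable_EFinP; exact: measurable_overlap.
  - by move=> X; rewrite lee_fin overlap_ge0.
apply: eq_integral => w _; rewrite /f /overlap.
have lik c : likelihood (M i c) (M' + noise_mx Z w) = likelihood (M i c) (noise_mx Z w).
  rewrite /likelihood mxdotDr (_ : mxdot (M i c) M' = 0) ?add0r//.
  by rewrite mxdotC mxdot_suml big1// => l li; exact: orthM.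
by rewrite !lik; under eq_bigr do rewrite lik.
Qed.

Lemma sum_ffun_coord (F : B -> R) i :
  \sum_(o : {ffun I -> B}) F (o i) = #|B|%:R ^+ #|I|.-1 * \sum_b F b.
Proof.
transitivity (\sum_(o : {ffun I -> B}) \prod_l (if l == i then F (o l) else 1)).
  apply: eq_bigr => o _; rewrite (bigD1 i)//= eqxx big1 ?mulr1//.
  by move=> l li; rewrite (negbTE li).
rewrite -(bigA_distr_bigA (fun l b => if l == i then F b else 1)) (bigD1 i)//= eqxx mulrC.
congr (_ * _); rewrite (eq_bigr (fun=> #|B|%:R)); last first.
  by move=> l li; rewrite (negbTE li) sumr_const.
by rewrite prodr_const cardC1.
Qed.

Lemma sum_ov_prod_neq (o : {ffun I -> B}) i :
  \sum_(o' : {ffun I -> B} | o' i != o i) ov Z prodmx o o' =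
  \sum_(b | b != o i) ov Z (M i) (o i) b.
Proof.
rewrite (partition_big (fun o' : {ffun I -> B} => o' i) (fun b => b != o i))//=.
apply: eq_bigr => b bo; rewrite -sum_ov_prod; apply: eq_bigl => o'.
by have [->|] := eqVneq (o' i) b; rewrite ?bo// andbF.
Qed.

End product_prior.

(** * Prior with rows at random positions *)

Section row_prior.
Context d (T : measurableType d) (R : realType) (P : probability T R).
Context (p m k s : nat) (Z : 'I_p * 'I_m -> {RV P >-> R}) (N : 'M[R]_(p, m) -> R).
Hypotheses (iidZ : iid_standard_normal Z) (nN : is_norm N) (uN : unitarily_invariant N).

Lemma bayes_risk_ov (O : finType) (M : O -> 'M[R]_(p, m)) (q : R) (n := #|O|) :
  (forall o, sparse_mx k s (M o)) -> (0 < n)%N -> 0 <= q ->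
  q <= \sum_o \sum_o' (ov Z M o o' / n%:R) * N (M o - M o') ->
  ((q ^+ 2 / 4)%:E <= minimax_risk k s N Z)%E.
Proof.
move=> sM n0 q0 hq; apply: (bayes_risk_bound_sq iidZ nN sM n0 q0).
under eq_bigr do under eq_bigr do rewrite (ovE iidZ) -EFinM.
under eq_bigr do rewrite sumEFin.
rewrite sumEFin lee_fin; apply: le_trans hq _.
rewrite le_eqVlt; apply/orP; left; apply/eqP.
apply: eq_bigr => o _; apply: eq_bigr => o' _; rewrite /n; ring.
Qed.

Lemma sparse_selmx (f : 'I_k -> 'I_p) (S : {set 'I_m}) (A : 'M[R]_(k, m)) :
  injective f -> (#|S| <= s)%N -> A = A *m projmx R S -> sparse_mx k s (selmx R f *m A).
Proof.
move=> fI Ss AS; apply/sparse_mxP; exists [set f i | i : 'I_k]%SET, S; split => //.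
  by rewrite card_imset// card_ord.
rewrite -(selmx_projmx R fI); last by move=> x; apply/imsetP/codomP => -[i]; [move=> _ ->; exists i|move=> ->; exists i].
by rewrite -!mulmxA -AS (mulmxA _^T) selmx_isometry// mul1mx.
Qed.

Context (b : nat) (A : 'M[R]_(k, m)) (S : {set 'I_m}) (rho : R) (E : 'M[R]_(p, k)).
Hypotheses (kbp : (k * b <= p)%N) (Ss : (#|S| <= s)%N) (AS : A = A *m projmx R S).
Hypothesis Arho : forall i, mxdot (row i A) (row i A) = rho.
Hypotheses (rhob : expR rho <= b%:R / 8) (EE : E^T *m E = 1%:M).

Let pos_lt (i : 'I_k) (j : 'I_b) : (i * b + j < p)%N.
Proof.
apply: leq_trans kbp; apply: (@leq_trans (i * b + b)).
  by rewrite ltn_add2l.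
by rewrite -mulSnr leq_mul2r ltn_ord orbT.
Qed.

(** Each row of [A] owns a block of [b] consecutive positions, so that different rows never collide
    and the pieces are orthogonal. *)
Let pos i j : 'I_p := Ordinal (pos_lt i j).

Let pos_inj i j i' j' : pos i j = pos i' j' -> i = i' /\ j = j'.
Proof.
move=> /(congr1 val) /= h; have b0 : (0 < b)%N by apply: leq_ltn_trans (ltn_ord j).
have := congr1 (fun n => n %/ b)%N h; have := congr1 (fun n => n %% b)%N h.
rewrite /= !modnMDl !modn_small// !divnMDl// !divn_small// !addn0 => hj hi.
by split; exact: val_inj.
Qed.

Let M i j : 'M[R]_(p, m) := delta_mx (pos i j) i *m A.

Let sel (o : {ffun 'I_k -> 'I_b}) := fun i => pos i (o i).

Let sel_inj o : injective (sel o).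
Proof. by move=> i i' /pos_inj[]. Qed.

Let prodmxE o : prodmx M o = selmx R (sel o) *m A.
Proof.
rewrite /prodmx /M -mulmx_suml; congr (_ *m A); apply/matrixP => u i.
rewrite summxE (bigD1 i)//= big1 ?addr0 => [|l li].
  by rewrite !mxE eqxx andbT.
by rewrite !mxE [i == l]eq_sym (negbTE li) andbF.
Qed.

Let orthM i l j j' : i != l -> mxdot (M i j) (M l j') = 0.
Proof.
move=> il; rewrite /M mxdot_mull mulmxA trmx_delta mul_delta_mx_0 ?mul0mx.
  by rewrite mxdotC mxdot0l.
by apply: contraNneq il => /pos_inj[->].
Qed.

Let normM i j : mxdot (M i j) (M i j) <= rho.
Proof.
have -> : M i j = delta_mx (pos i j) (0 : 'I_1) *m row i A.
  by rewrite /M rowE mulmxA mul_delta_mx.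
rewrite mxdot_isometryl ?Arho// trmx_delta mul_delta_mx.
by apply/matrixP => u v; rewrite !ord1 !mxE.
Qed.

Let sparse_prodmx o : sparse_mx k s (prodmx M o).
Proof. by rewrite prodmxE; exact: (sparse_selmx (@sel_inj o) Ss AS). Qed.

Let ind (o o' : {ffun 'I_k -> 'I_b}) : 'rV[R]_k := \row_i (o' i != o i)%:R.

(** At the positions chosen by [o] for the rows that move, the second matrix vanishes. Keeping only
    those rows is a contraction, and what is left has the same norm when embedded by the fixed [E],
    so that the differences can be averaged inside one norm. *)
Let diff_lb o o' : N (E *m (diag_mx (ind o o') *m A)) <= N (prodmx M o - prodmx M o').
Proof.
rewrite (uinorm_isometryl _ nN uN EE (selmx_isometry R (@sel_inj o))).
pose D : 'rV[R]_p := \row_u [exists i, (u == sel o i) && (o' i != o i)]%:R.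
have -> : selmx R (sel o) *m (diag_mx (ind o o') *m A) =
    diag_mx D *m (prodmx M o - prodmx M o').
  rewrite !prodmxE; apply/matrixP => u v; rewrite [diag_mx D *m _]mul_diag_mx.
  rewrite [RHS]mxE [X in _ * X]mxE [in X in _ * (_ + X)]mxE.
  have [[i ->]|nu] := pselect (exists i, u = sel o i); last first.
    rewrite selmx_mul0; last by move=> i; apply/eqP => iu; apply: nu; exists i.
    rewrite mxE; case: existsP => [[i /andP[/eqP ui _]]|_]; last by rewrite mul0r.
    by case: nu; exists i.
  rewrite !selmx_mulE// mul_diag_mx [LHS]mxE [ind o o' 0 i]mxE [D 0 _]mxE.
  have -> : [exists l, (sel o i == sel o l) && (o' l != o l)] = (o' i != o i).
    apply/existsP/idP => [[l /andP[/eqP/sel_inj <-]]//|h].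
    by exists i; rewrite eqxx.
  case: eqVneq => [_|ne]; first by rewrite !mul0r.
  rewrite selmx_mul0 ?subr0//.
  by move=> l; apply: contraNneq ne => /pos_inj[-> ->].
apply: uinorm_contractl => // u.
by rewrite mxE; case: existsP; rewrite ?normr1 ?normr0 ?ler01.
Qed.

(** Averaging the differences inside the norm gives [diag_mx q *m A] with all entries of [q] at
    least 1/4, hence a mean loss of at least a quarter of [N (E *m A)]; [bayes_risk_ov] squares it
    and divides by 4, which gives 64. *)
Lemma row_lower_bound : ((N (E *m A) ^+ 2 / 64)%:E <= minimax_risk k s N Z)%E.
Proof.
have b0 : (0 < b)%N.
  case: posnP rhob => // ->; rewrite mul0r => h.
  by have := expR_gt0 rho; lra.
have bR : 0 < b%:R :> R by rewrite ltr0n.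
have [k0|k0] := posnP k.
  have -> : E *m A = 0.
    by apply/matrixP => i j; rewrite !mxE big1// => l; have := ltn_ord l; rewrite {2}k0.
  rewrite uinorm0// expr0n mul0r; apply: le_ereal_inf_tmp => _ [est _ <-].
  have s0 : sparse_mx k s (0 : 'M[R]_(p, m)).
    have h : [set i | row i (0 : 'M[R]_(p, m)) != 0]%SET = finset.set0.
      by apply/setP => i; rewrite !inE row0 eqxx.
    have h' : [set j | col j (0 : 'M[R]_(p, m)) != 0]%SET = finset.set0.
      by apply/setP => i; rewrite !inE col0 eqxx.
    by split; rewrite ?h ?h' cards0.
  apply: le_trans (ereal_sup_ubound _); last by exists 0; [exact: s0|reflexivity].
  by rewrite unlock; apply: integral_ge0 => w _; rewrite lee_fin sqr_ge0.
pose O := {ffun 'I_k -> 'I_b}; pose n := #|O|.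
have nE : n = (b ^ k)%N by rewrite /n card_ffun !card_ord.
have n0 : (0 < n)%N by rewrite nE expn_gt0 b0.
have nR : 0 < n%:R :> R by rewrite ltr0n.
pose c o o' : R := ov Z (prodmx M) o o' / n%:R.
have c0 o o' : 0 <= c o o' by rewrite divr_ge0// ov_ge0.
pose q : 'rV[R]_k := \sum_o \sum_o' c o o' *: ind o o'.
(* The entry [q 0 i] is the mean one-piece overlap of row [i] with its other positions, bounded by
   [sum_ov_lb] because every row has squared length [rho]. *)
have q_lb i : 1 / 4 <= q 0 i.
  have -> : q 0 i = (\sum_(o : O) \sum_(o' : O | o' i != o i) ov Z (prodmx M) o o') / n%:R.
    rewrite /q summxE mulr_suml; apply: eq_bigr => o _.
    rewrite summxE mulr_suml [RHS]big_mkcond; apply: eq_bigr => o' _.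
    by rewrite !mxE /c; case: ifP => _; rewrite ?mulr1 ?mulr0.
  under eq_bigr do rewrite sum_ov_prod_neq//.
  rewrite (sum_ffun_coord (fun j => \sum_(j' | j' != j) ov Z (M i) j j')) !card_ord.
  rewrite ler_pdivlMr//.
  have := @sum_ov_lb _ _ _ P p m Z iidZ 'I_b (M i) rho.
  rewrite card_ord => /(_ b0 (normM i) rhob) h.
  apply: le_trans (ler_wpM2l _ h); last by rewrite exprn_ge0// ltW.
  rewrite nE -(prednK k0) /= natrX exprSr le_eqVlt; apply/orP; left; apply/eqP.
  by field.
have -> : N (E *m A) ^+ 2 / 64 = (N (E *m A) / 4) ^+ 2 / 4 by field.
apply: (bayes_risk_ov (M := prodmx M)) => //; first by rewrite divr_ge0 ?(uinorm_ge0 nN).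
pose N' (W : 'M[R]_(k, m)) := N (E *m W).
have nN' : is_norm N'.
  split => [X Y|a X|X h].
  - by rewrite /N' mulmxDr; exact: norm_triangle nN _ _.
  - by rewrite /N' -scalemxAr; exact: norm_scale nN _ _.
  - by rewrite -[X]mul1mx -EE -mulmxA (norm_definite nN h) mulmx0.
have uN' : unitarily_invariant N'.
  move=> X U V oU oV; rewrite /N' !mulmxA -(extend_mxE U EE) -(mulmxA _ E X).
  by rewrite uN//; exact: orthogonal_extend.
apply: (@le_trans _ _ (N' (diag_mx q *m A))).
  (* The entries of [e] are at most 1, so the diagonal rescaling that recovers [A] is a
     contraction. *)
  pose e : 'rV[R]_k := \row_i (4 * q 0 i)^-1.
  have AE : A = diag_mx e *m (4 *: (diag_mx q *m A)).
    apply/matrixP => i j; rewrite !mul_diag_mx [RHS]mxE [e 0 i]mxE.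
    rewrite [X in _ * X]mxE [X in _ * (_ * X)]mxE.
    by have qi := q_lb i; field; rewrite gt_eqF//; lra.
  rewrite {1}AE.
  apply: (@le_trans _ _ (N' (4 *: (diag_mx q *m A)) / 4)).
    rewrite ler_pM2r ?invr_gt0//; apply: (uinorm_contractl nN' uN') => i.
    have := q_lb i => qi; rewrite mxE ger0_norm ?invr_ge0; last by lra.
    by rewrite invf_le1; lra.
  by rewrite (norm_scale nN') gtr0_norm// mulrAC divff ?mul1r.
have -> : diag_mx q *m A = \sum_o \sum_o' c o o' *: (diag_mx (ind o o') *m A).
  rewrite /q linear_sum mulmx_suml; apply: eq_bigr => o _.
  rewrite linear_sum mulmx_suml; apply: eq_bigr => o' _.
  by rewrite linearZ scalemxAl.
apply: le_trans (uinorm_sum nN' _ _ _) _; apply: ler_sum => o _.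
apply: le_trans (uinorm_sum nN' _ _ _) _; apply: ler_sum => o' _.
rewrite (norm_scale nN') ger0_norm// ler_wpM2l//.
exact: diff_lb.
Qed.

End row_prior.

(** * Norms of random sign matrices *)

Section signs.
Context (R : realType).

Lemma orthogonal_perm_mx n (s : 'S_n) : orthogonal_mx (perm_mx s : 'M[R]_n).
Proof. by rewrite /orthogonal_mx tr_perm_mx -perm_mxM mulgV perm_mx1. Qed.

Lemma diag_mx_perm n (s : 'S_n) (d : 'rV[R]_n) :
  perm_mx s *m diag_mx d *m (perm_mx s)^T = diag_mx (\row_i d 0 (s i)).
Proof.
rewrite tr_perm_mx -row_permE -col_permE; apply/matrixP => i j.
by rewrite !mxE (inj_eq perm_inj).
Qed.

(** The average of a diagonal matrix over all cyclic shifts of its entries is its mean times the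
    identity, and every shift has the same norm. *)
Lemma uinorm_mean_diag n (N : 'M[R]_n -> R) (d : 'rV[R]_n) :
  is_norm N -> unitarily_invariant N ->
  (\sum_i d 0 i) * N 1%:M <= n%:R * N (diag_mx d).
Proof.
move=> nN uN; case: n N d nN uN => [|n] N d nN uN.
  by rewrite big_ord0 !mul0r.
pose shift (c : 'I_n.+1) : 'S_n.+1 := perm (@GRing.addrI _ c).
have shN c : N (diag_mx (\row_i d 0 (shift c i))) = N (diag_mx d).
  rewrite -diag_mx_perm uN//; first exact: orthogonal_perm_mx.
  by apply: orthogonal_mx_tr; exact: orthogonal_perm_mx.
have sumE : \sum_c diag_mx (\row_i d 0 (shift c i)) = (\sum_i d 0 i) *: 1%:M.
  apply/matrixP => i j; rewrite summxE mxE mulr_suml.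
  have [->|ij] := eqVneq i j; last first.
    by rewrite !big1// => l _; rewrite !mxE (negbTE ij) ?mulr0.
  rewrite [RHS](reindex_inj (@GRing.addIr _ j)); apply: eq_bigr => c _.
  by rewrite !mxE eqxx permE mulr1.
have := uinorm_sum nN (index_enum 'I_n.+1) xpredT (fun c => diag_mx (\row_i d 0 (shift c i))).
rewrite sumE (norm_scale nN) [X in _ <= X -> _](_ : _ = n.+1%:R * N (diag_mx d)); last first.
  by rewrite (eq_bigr _ (fun c _ => shN c)) sumr_const card_ord [RHS]mulr_natl.
by apply: le_trans; rewrite ler_wpM2r ?(uinorm_ge0 nN)// ler_norm.
Qed.

(* [1 - u + 4 u^3 / 27 = (1 - 2 u / 3)^2 (1 + u / 3) >= 0]. *)
Lemma le_quartic (x t : R) : 0 <= x -> 0 < t ->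
  x ^+ 2 / t - 4 / 27 * x ^+ 4 / t ^+ 3 <= x.
Proof.
move=> x0 t0; rewrite -subr_ge0.
have -> : x - (x ^+ 2 / t - 4 / 27 * x ^+ 4 / t ^+ 3) =
   x * ((1 - 2 * x / t / 3) ^+ 2 * (1 + x / t / 3)) by field; rewrite gt_eqF.
have u0 : 0 <= x / t by rewrite divr_ge0// ltW.
by apply: mulr_ge0 => //; apply: mulr_ge0; [exact: sqr_ge0|lra].
Qed.

(** By [uinorm_mean_diag], [N X] is at least the mean singular value times [N (pid_mx s)].
    [le_quartic] bounds the sum of the singular values by their second and fourth moments, which are
    polynomials in the entries. *)
Lemma uinorm_moments_lb k s (N : 'M[R]_(k, s) -> R) (X : 'M[R]_(k, s)) (t : R) :
  is_norm N -> unitarily_invariant N -> (s <= k)%N -> 0 < t ->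
  (mxdot X X / t - 4 / 27 * mxdot (X^T *m X) (X^T *m X) / t ^+ 3) * N (pid_mx s) <=
  s%:R * N X.
Proof.
move=> nN uN sk t0; have [U [V [d [oU oV Xdef dpos d0]]]] := svd X.
have dge0 i : 0 <= d i by have [/d0->|/dpos/ltW] := leqP (\rank X) i.
have ds i : (s <= i)%N -> d i = 0.
  by move=> si; apply: d0; apply: leq_trans si; exact: rank_leq_col.
pose J : 'M[R]_(k, s) := pid_mx s.
have JJ : J^T *m J = 1%:M by rewrite tr_pid_mx pid_mx_id// pid_mx_1.
have I1 : (1%:M : 'M[R]_s)^T *m 1%:M = 1%:M by rewrite trmx1 mulmx1.
have nN' := is_norm_embed nN JJ I1; have uN' := unitarily_invariant_embed uN JJ I1.
have DJ : dgmx k s d = J *m diag_mx (\row_(i < s) d i).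
  apply/matrixP => i j; rewrite mul_mx_diag !mxE.
  case: eqVneq => [ij|]; last by rewrite mul0r.
  by rewrite ij ltn_ord mul1r.
have XX : mxdot X X = \sum_(i < s) d i ^+ 2.
  rewrite Xdef mxdot_orthr// mxdot_orthl// DJ mxdot_isometryl// /mxdot.
  apply: eq_bigr => i _; rewrite (bigD1 i)//= big1 ?addr0 ?mxE ?eqxx//.
  by move=> j ji; rewrite !mxE eq_sym (negbTE ji) mulr0n mul0r.
have XX2 : mxdot (X^T *m X) (X^T *m X) = \sum_(i < s) d i ^+ 4.
  rewrite Xdef !trmx_mul !mulmxA -(mulmxA _ U^T U) orthogonal_mxC// mulmx1.
  rewrite mxdot_orthr// -(mulmxA V^T) mxdot_orthl; last exact: orthogonal_mx_tr.
  rewrite DJ trmx_mul tr_diag_mx !mulmxA -(mulmxA _ J^T) JJ mulmx1 mulmx_diag /mxdot.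
  apply: eq_bigr => i _; rewrite (bigD1 i)//= big1 ?addr0 ?mxE ?eqxx//.
    by rewrite mulr1n -!expr2 -exprM.
  by move=> j ji; rewrite !mxE eq_sym (negbTE ji) mulr0n mul0r.
have := uinorm_mean_diag (\row_(i < s) d i) nN' uN'.
have NX : N X = N (dgmx k s d) by rewrite Xdef uN.
rewrite trmx1 !mulmx1 -/J -DJ -NX.
apply: le_trans; rewrite ler_wpM2r ?(uinorm_ge0 nN)// XX XX2.
rewrite mulr_suml mulr_sumr mulr_suml -sumrB; apply: ler_sum => i _.
by rewrite mxE; exact: le_quartic.
Qed.

Context (k s : nat).
Local Notation O := {ffun 'I_k * 'I_s -> bool}.

Definition sgmx (o : O) : 'M[R]_(k, s) := \matrix_(i, j) (-1) ^+ o (i, j).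

Lemma mxdot_sgmx o : mxdot (sgmx o) (sgmx o) = (k * s)%:R.
Proof.
rewrite /mxdot (eq_bigr (fun=> s%:R)) => [|i _].
  by rewrite sumr_const card_ord natrM [RHS]mulr_natl.
rewrite (eq_bigr (fun=> 1)) => [|j _]; first by rewrite sumr_const card_ord.
by rewrite mxE -expr2 sqrr_sign.
Qed.

(** An entry of the Gram matrix is [k] on the diagonal and has mean square [k] off it, as cross
    terms cancel. The total is [s * k * (k + s - 1)]. *)
Lemma sum_sgmx_quartic : (s <= k)%N ->
  \sum_(o : O) mxdot ((sgmx o)^T *m sgmx o) ((sgmx o)^T *m sgmx o) <=
  #|O|%:R * (2 * s%:R * k%:R ^+ 2).
Proof.
move=> sk; set n : R := #|O|%:R.
have cross j l i i' : j != l -> i != i' ->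
    \sum_(o : O) sgmx o i j * sgmx o i l * (sgmx o i' j * sgmx o i' l) = 0.
  move=> jl ii'; set S := \sum_o _.
  (* Flipping one sign that occurs once in the product pairs the terms with opposite values. *)
  pose flip (o : O) : O := [ffun x => if x == (i, j) then ~~ o x else o x].
  have flipK : involutive flip.
    by move=> o; apply/ffunP => x; rewrite !ffunE; case: (x == (i, j)) => //; rewrite negbK.
  have : S = - S.
    rewrite {1}/S (reindex_inj (inv_inj flipK)) -sumrN; apply: eq_bigr => o _.
    rewrite !mxE !ffunE eqxx !xpair_eqE eqxx (eq_sym l) (negbTE jl) (eq_sym i') (negbTE ii') /=.
    by rewrite signrN !mulNr.
  lra.
have pair j l : \sum_(o : O) ((sgmx o)^T *m sgmx o) j l ^+ 2 <=
    n * (k%:R * (if j == l then k%:R else 1)).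
  case: eqVneq => [->|jl].
    rewrite (eq_bigr (fun=> k%:R ^+ 2)) => [|o _].
      by rewrite sumr_const -[X in X <= _]mulr_natl expr2.
    rewrite mxE (eq_bigr (fun=> 1)) => [|i _]; first by rewrite sumr_const card_ord.
    by rewrite !mxE -expr2 sqrr_sign.
  rewrite mulr1; under eq_bigr => o _.
    rewrite mxE expr2 mulr_suml; under eq_bigr do rewrite mulr_sumr.
    under eq_bigr do under eq_bigr do rewrite [_^T _ _]mxE [X in _ * (X * _)]mxE.
    over.
  rewrite exchange_big /=; under eq_bigr do rewrite exchange_big /=.
  rewrite (eq_bigr (fun=> n)) => [|i _]; first by rewrite sumr_const card_ord [X in _ <= X]mulr_natr.
  rewrite (bigD1 i)//= [X in _ + X]big1 ?addr0 => [|i' i'i]; last by rewrite cross// eq_sym.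
  rewrite (eq_bigr (fun=> 1)) => [|o _]; first by rewrite sumr_const.
  by rewrite -expr2 exprMn !mxE !sqrr_sign mulr1.
rewrite /mxdot exchange_big /=.
under eq_bigr do rewrite exchange_big /=.
apply: (@le_trans _ _ (\sum_(j < s) \sum_(l < s) n * (k%:R * (if j == l then k%:R else 1)))).
  apply: ler_sum => j _; apply: ler_sum => l _.
  by under eq_bigr do rewrite -expr2; exact: pair.
rewrite (eq_bigr (fun=> n * (k%:R * (k%:R + s%:R - 1)))) => [|j _]; last first.
  rewrite -!mulr_sumr (bigD1 j)//= eqxx (eq_bigr (fun=> 1)); last first.
    by move=> l; rewrite eq_sym => /negbTE ->.
  by rewrite sumr_const cardC1 card_ord -{2}(@prednK s) ?(leq_ltn_trans _ (ltn_ord j))// -natr1; congr (_ * (_ * _)); ring.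
rewrite sumr_const card_ord -[X in X <= _]mulr_natl.
have sk' : (s%:R : R) <= k%:R by rewrite ler_nat.
have n0 : 0 <= n by exact: ler0n.
have s0 : 0 <= s%:R :> R by exact: ler0n.
rewrite mulrCA; apply: ler_wpM2l => //.
rewrite (_ : 2 * s%:R * k%:R ^+ 2 = s%:R * (k%:R * (k%:R + k%:R))); last by ring.
by apply: ler_wpM2l => //; apply: ler_wpM2l; [exact: ler0n|lra].
Qed.

End signs.

(** * Lower bound from random signs *)

Section sign_prior.
Context d (T : measurableType d) (R : realType) (P : probability T R).
Context (p m : nat) (Z : 'I_p * 'I_m -> {RV P >-> R}).
Hypothesis iidZ : iid_standard_normal Z.

Lemma ge0_integral_entry i j (h : R -> \bar R) :
  measurable_fun setT h -> (forall x, (0 <= h x)%E) ->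
  (\int[P]_w h (noise_mx Z w i j) = \int[@normal_prob R 0 1]_x h x)%E.
Proof.
move=> mh h0; have [_ law] := iidZ.
have mZ : measurable_fun setT (Z (i, j) : T -> measurableTypeR R).
  by move=> mD B mB; exact: (measurable_funP (Z (i, j)) mD B mB).
have [nu [nuE nuf]] := pushforward_measure_ex P mZ.
transitivity (\int[nu]_x h x)%E.
  by rewrite nuf//; apply: eq_integral => w _; rewrite mxE.
by apply: eq_measure_integral => B mB _; rewrite nuE; exact: law.
Qed.

Definition signed_delta (i : 'I_p) (j : 'I_m) (b : bool) : 'M[R]_(p, m) :=
  (-1) ^+ b *: delta_mx i j.

Lemma mxdot_deltal (i : 'I_p) (j : 'I_m) (X : 'M[R]_(p, m)) : mxdot (delta_mx i j) X = X i j.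
Proof.
rewrite /mxdot (bigD1 i)//= [X in _ + X]big1 ?addr0 => [|a ai]; last first.
  by rewrite big1// => b _; rewrite mxE (negbTE ai) mul0r.
rewrite (bigD1 j)//= big1 ?addr0 => [|b bj]; first by rewrite mxE !eqxx mul1r.
by rewrite mxE (negbTE bj) andbF mul0r.
Qed.

Lemma likelihood_signed_delta i j b X :
  likelihood (signed_delta i j b) X = expR ((-1) ^+ b * X i j - 1 / 2).
Proof.
rewrite /likelihood /signed_delta !mxdotZl !mxdotZr !mxdot_deltal mxE !eqxx mulr1.
by rewrite -expr2 sqrr_sign.
Qed.

Let h (x : R) : R := expR (- 1) / (expR (x - 1 / 2) + expR (- x - 1 / 2)).

Let h_ge0 x : 0 <= h x.
Proof. by rewrite divr_ge0 ?expR_ge0// addr_ge0// expR_ge0. Qed.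

Let mh : measurable_fun setT h.
Proof.
apply: measurable_funM => //; apply: measurable_fun_inv_ge0.
  apply: measurable_funD; apply: measurableT_comp => //; apply: measurable_funB => //.
by move=> x; rewrite addr_ge0// expR_ge0.
Qed.

Let overlap_h i j b X : overlap (signed_delta i j) b (~~ b) X = h (X i j).
Proof.
rewrite /overlap big_bool /= !likelihood_signed_delta /h -expRD signrN.
rewrite [X in expR X / _](_ : _ = - 1); last by field.
by rewrite expr0 expr1 mulN1r !mul1r [X in _ / X]addrC.
Qed.

Definition sign_ov : R := fine (\int[@normal_prob R 0 1]_x (h x)%:E)%E.

Lemma ov_signed_delta i j b : ov Z (signed_delta i j) b (~~ b) = sign_ov.
Proof.
rewrite /ov /pair_overlap /sign_ov -(ge0_integral_entry i j).
- by congr fine; apply: eq_integral => w _; rewrite overlap_h.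
- exact/measurable_EFinP.
- by move=> x; rewrite lee_fin h_ge0.
Qed.

(** With [S] the sum of the two likelihoods, [1 / S >= 1 - S / 4], the tangent at [S = 2]; since [S]
    has mean 2, the mean of [1 / S] is at least 1/2. The factor [expR (- 1)] is the product of the
    likelihoods, which is constant for entries of size 1. *)
Lemma sign_ov_lb (i : 'I_p) (j : 'I_m) : expR (- 1) / 2 <= sign_ov.
Proof.
rewrite -(ov_signed_delta i j true) -lee_fin -(ovE iidZ).
pose y b w := likelihood (signed_delta i j b) (noise_mx Z w).
have my b : measurable_fun setT (fun w => (y b w)%:E).
  by apply/measurable_EFinP; exact: (measurableT_comp (measurable_likelihood _) (measurable_noise Z)).
have y0 b w : 0 < y b w by exact: expR_gt0.
have mo : measurable_fun setT (fun w => (overlap (signed_delta i j) true false (noise_mx Z w))%:E).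
  by apply/measurable_EFinP; exact: (measurableT_comp (measurable_overlap _ _ _) (measurable_noise Z)).
have key : ((expR (-1))%:E <= pair_overlap Z (signed_delta i j) true false +
   (expR (-1) / 4)%:E * (\int[P]_w (y true w)%:E + \int[P]_w (y false w)%:E))%E.
  have -> : (expR (-1))%:E = (\int[P]_w (cst (expR (-1))%:E w))%E.
    by rewrite integral_cst// -[LHS]mule1; congr (_ * _)%E; apply/esym; exact: probability_setT.
  have l0 b w : setT w -> (0 <= (y b w)%:E)%E by move=> _; rewrite lee_fin ltW.
  rewrite -(ge0_integralD P measurableT (l0 true) (my true) (l0 false) (my false)).
  have l1 w : setT w -> (0 <= (y true w)%:E + (y false w)%:E)%E by move=> h'; rewrite adde_ge0 ?l0.
  have ms := emeasurable_funD (my true) (my false).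
  have e4 : 0 <= (expR (-1) / 4 : R) by rewrite divr_ge0// expR_ge0.
  rewrite -(ge0_integralZl_EFin P measurableT l1 ms e4).
  have l2 w : setT w -> (0 <= (expR (-1) / 4)%:E * ((y true w)%:E + (y false w)%:E))%E.
    by move=> h'; apply: mule_ge0; [rewrite lee_fin|exact: l1].
  have ms' : measurable_fun setT (fun w => (expR (-1) / 4)%:E * ((y true w)%:E + (y false w)%:E))%E.
    exact: emeasurable_funM.
  have l3 w : setT w -> (0 <= (overlap (signed_delta i j) true false (noise_mx Z w))%:E)%E.
    by move=> _; rewrite lee_fin overlap_ge0.
  rewrite -(ge0_integralD P measurableT l3 mo l2 ms').
  apply: ge0_le_integral => //.
  - by move=> w _; rewrite lee_fin expR_ge0.
  - exact: emeasurable_funD.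
  move=> w _; rewrite -!EFinD lee_fin (overlap_h i j true).
  set x := noise_mx Z w i j; rewrite /h.
  have -> : y true w + y false w = expR (x - 1 / 2) + expR (- x - 1 / 2).
    by rewrite /y !likelihood_signed_delta -/x expr0 expr1 mulN1r !mul1r addrC.
  set S := expR (x - 1 / 2) + _.
  have S0 : 0 < S by rewrite addr_gt0// expR_gt0.
  rewrite -subr_ge0 (_ : _ - _ = expR (-1) * ((S / 2 - 1) ^+ 2 / S)); last first.
    by field; rewrite gt_eqF.
  by rewrite mulr_ge0 ?expR_ge0// divr_ge0 ?sqr_ge0// ltW.
have i1 b : (\int[P]_w (y b w)%:E = 1%:E)%E by exact: integral_likelihood.
move: key; rewrite !i1 !(ovE iidZ) -[(1 + 1)%E]/((1 + 1)%:E) -EFinM -EFinD !lee_fin /=.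
have := expR_gt0 (-1 : R); lra.
Qed.

Context (k s : nat) (N : 'M[R]_(p, m) -> R).
Hypotheses (nN : is_norm N) (uN : unitarily_invariant N).

(** The average loss around a sign matrix is at least [2 * sign_ov] times the norm of this matrix,
    and the mean norm is at least [19 / 27] times the square root of [k] times [N (pid_mx s)]. *)
Lemma sign_lower_bound : (0 < s)%N -> (s <= k)%N -> (k <= p)%N -> (s <= m)%N ->
  ((expR (- 1) ^+ 2 / 16 * (k%:R * N (pid_mx s) ^+ 2))%:E <= minimax_risk k s N Z)%E.
Proof.
move=> s0 sk kp sm.
pose f := widen_ord kp; pose g := widen_ord sm.
have fI : injective f by move=> a b /(congr1 val) ab; exact: val_inj.
have gI : injective g by move=> a b /(congr1 val) ab; exact: val_inj.
pose M (ij : 'I_k * 'I_s) := signed_delta (f ij.1) (g ij.2).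
have orthM ij kl b b' : ij != kl -> mxdot (M ij b) (M kl b') = 0.
  move=> ne; rewrite /M /signed_delta !mxdotZl !mxdotZr mxdot_deltal mxE.
  rewrite (inj_eq fI) (inj_eq gI).
  have -> : (ij.1 == kl.1) && (ij.2 == kl.2) = false.
    by apply: contraNF ne => /andP[/eqP h1 /eqP h2]; apply/eqP; rewrite [ij]surjective_pairing h1 h2 -surjective_pairing.
  by rewrite !mulr0.
pose E := selmx R f; pose F := selmx R g.
have EE : E^T *m E = 1%:M by exact: selmx_isometry.
have FF : F^T *m F = 1%:M by exact: selmx_isometry.
pose N' (W : 'M[R]_(k, s)) := N (E *m W *m F^T).
have nN' : is_norm N' by exact: is_norm_embed.
have uN' : unitarily_invariant N' by exact: unitarily_invariant_embed.
have MdE i j b : M (i, j) b = E *m ((-1) ^+ b *: delta_mx i j) *m F^T.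
  rewrite -scalemxAr -scalemxAl; congr (_ *: _); apply/matrixP => u v; rewrite !mxE.
  rewrite (bigD1 j)//= big1 ?addr0 => [|l lj].
    rewrite !mxE (bigD1 i)//= big1 ?addr0 => [|l li]; first by rewrite !mxE !eqxx mulr1 -natrM mulnb.
    by rewrite !mxE (negbTE li) mulr0.
  by rewrite !mxE big1 ?mul0r// => l' _; rewrite !mxE (negbTE lj) andbF mulr0.
have pE o : prodmx M o = E *m sgmx R o *m F^T.
  rewrite /prodmx (eq_bigr (fun ij => E *m ((-1) ^+ o ij *: delta_mx ij.1 ij.2) *m F^T)); last first.
    by move=> [i j] _; rewrite MdE.
  rewrite -mulmx_suml -mulmx_sumr; congr (_ *m _ *m _).
  rewrite [RHS]matrix_sum_delta pair_big /=.
  by apply: eq_bigr => -[i j] _ /=; rewrite mxE.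
have Npid : N' (pid_mx s) = N (pid_mx s).
  have Js : (pid_mx s : 'M[R]_(k, s))^T *m pid_mx s = 1%:M.
    by rewrite tr_pid_mx pid_mx_id// pid_mx_1.
  have J1 : (pid_mx s : 'M[R]_(p, s))^T *m pid_mx s = 1%:M.
    by rewrite tr_pid_mx pid_mx_id ?pid_mx_1// (leq_trans sk).
  have J2 : (pid_mx s : 'M[R]_(m, s))^T *m pid_mx s = 1%:M.
    by rewrite tr_pid_mx pid_mx_id// pid_mx_1.
  have EJ : (E *m pid_mx s)^T *m (E *m pid_mx s : 'M[R]_(p, s)) = 1%:M.
    by rewrite trmx_mul -mulmxA (mulmxA E^T) EE mul1mx Js.
  have := uinorm_isometry 1%:M nN uN EJ J1 FF J2.
  rewrite !mulmx1 /N' => ->; congr N; rewrite tr_pid_mx pid_mx_id//.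
pose O := {ffun 'I_k * 'I_s -> bool}; pose n : R := #|O|%:R.
have n0 : (0 < #|O|)%N by rewrite card_ffun card_bool expn_gt0.
have nR : 0 < n by rewrite ltr0n.
have k0 : (0 < k)%N := leq_trans s0 sk.
have kR : 0 < k%:R :> R by rewrite ltr0n.
have sR : 0 < s%:R :> R by rewrite ltr0n.
have ovc : expR (-1) / 2 <= sign_ov := sign_ov_lb (f (Ordinal k0)) (g (Ordinal s0)).
have e1 := expR_gt0 (- 1 : R).
have so0 : 0 <= sign_ov by lra.
pose q : R := expR (- 1) / 2 * Num.sqrt k%:R * N (pid_mx s).
have -> : expR (- 1) ^+ 2 / 16 * (k%:R * N (pid_mx s) ^+ 2) = q ^+ 2 / 4.
  by rewrite /q !exprMn sqr_sqrtr ?(ltW kR)//; field.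
have N0 : 0 <= N (pid_mx s) by exact: uinorm_ge0 nN _.
apply: (bayes_risk_ov iidZ nN (M := prodmx M)) => //.
- move=> o; rewrite pE; apply/sparse_mxP.
  exists [set f i | i : 'I_k]%SET, [set g i | i : 'I_s]%SET.
  split; rewrite ?card_imset ?card_ord//.
  rewrite -(selmx_projmx R fI); last by move=> x; apply/imsetP/codomP => -[i]; [move=> _ ->; exists i|move=> ->; exists i].
  rewrite -(selmx_projmx R gI); last by move=> x; apply/imsetP/codomP => -[i]; [move=> _ ->; exists i|move=> ->; exists i].
  by rewrite -/E -/F !mulmxA -(mulmxA E E^T) EE mulmx1 -(mulmxA _ F^T F) FF mulmx1.
- by rewrite /q !mulr_ge0// ?sqrtr_ge0// ltW// divr_gt0.
(* Each entry of the difference is 0 or twice the sign in [o], and the hypotheses that disagree at a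
   given entry have total overlap [sign_ov]. The weighted sum of differences is therefore a multiple
   of [sgmx R o]. *)
have inner o : 2 * sign_ov * N' (sgmx R o) <=
    \sum_(o' : O) ov Z (prodmx M) o o' * N (prodmx M o - prodmx M o').
  pose I o' : 'M[R]_(k, s) := \matrix_(i, j) (if o' (i, j) != o (i, j) then sgmx R o i j else 0).
  have -> : 2 * sign_ov * N' (sgmx R o) = N' (\sum_(o' : O) (2 * ov Z (prodmx M) o o') *: I o').
    rewrite -[2 * sign_ov]ger0_norm ?mulr_ge0// -(norm_scale nN'); congr N'.
    apply/matrixP => i j; rewrite summxE mxE.
    transitivity (\sum_(o' : O | o' (i, j) != o (i, j)) ov Z (prodmx M) o o' * (2 * sgmx R o i j)).
      rewrite -mulr_suml (sum_ov_prod_neq iidZ orthM) (eq_bigl (pred1 (~~ o (i, j)))); last first.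
        by move=> b /=; case: b; case: (o _).
      by rewrite big_pred1_eq /M ov_signed_delta; ring.
    rewrite [LHS]big_mkcond; apply: eq_bigr => o' _.
    by rewrite ![in RHS]mxE; case: ifP => _; [rewrite [sgmx R o i j]mxE; ring|rewrite mulr0].
  apply: le_trans (uinorm_sum nN' _ _ _) _; apply: ler_sum => o' _.
  rewrite (norm_scale nN') ger0_norm ?mulr_ge0 ?ov_ge0// mulrC mulrA mulrC.
  rewrite ler_wpM2l ?ov_ge0//.
  have -> : prodmx M o - prodmx M o' = 2 *: (E *m I o' *m F^T).
    rewrite !pE -mulmxBl -mulmxBr scalemxAl scalemxAr; congr (_ *m _ *m _).
    apply/matrixP => i j; rewrite !mxE.
    by case: (o (i, j)); case: (o' (i, j)); rewrite /= ?expr0 ?expr1; ring.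
  by rewrite (norm_scale nN) ger0_norm// /N' mulrC.
apply: (@le_trans _ _ (\sum_(o : O) 2 * sign_ov / n * N' (sgmx R o))); last first.
  apply: ler_sum => o _; rewrite mulrAC ler_pdivrMr//; apply: le_trans (inner o) _.
  rewrite mulr_suml; apply: ler_sum => o' _; rewrite le_eqVlt; apply/orP; left; apply/eqP.
  by move: nR; rewrite /n /O => nR'; field; rewrite gt_eqF.
rewrite -mulr_sumr.
pose t := Num.sqrt (k%:R : R); have t0 : 0 < t by rewrite sqrtr_gt0.
have tt : t ^+ 2 = k%:R by rewrite sqr_sqrtr// ltW.
(* With [t ^+ 2 = k] the second moment gives [s * t] and the fourth costs at most [8 / 27] of it. *)
have mom : n * (19 / 27 * t) * N (pid_mx s) <= \sum_(o : O) N' (sgmx R o).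
  rewrite -(ler_pM2l sR) mulr_sumr.
  apply: (@le_trans _ _ (\sum_(o : O) (mxdot (sgmx R o) (sgmx R o) / t - 4 / 27 *
     mxdot ((sgmx R o)^T *m sgmx R o) ((sgmx R o)^T *m sgmx R o) / t ^+ 3) * N (pid_mx s))).
    rewrite -mulr_suml mulrA ler_wpM2r// sumrB.
    rewrite (eq_bigr (fun=> (k * s)%:R / t)); last by move=> o _; rewrite mxdot_sgmx.
    rewrite sumr_const -[X in _ <= X - _]mulr_natl -/n -mulr_suml -mulr_sumr.
    have := @sum_sgmx_quartic R k s sk; rewrite -/O -/n -tt => qb.
    set S4 := \sum_o _ in qb.
    have h1 : 4 / 27 * S4 / t ^+ 3 <= 4 / 27 * (n * (2 * s%:R * (t ^+ 2) ^+ 2)) / t ^+ 3.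
      by rewrite ler_pM2r ?invr_gt0 ?exprn_gt0// ler_wpM2l// divr_ge0.
    rewrite lerBrDl; apply: le_trans (lerD h1 (lexx _)) _.
    rewrite natrM -tt le_eqVlt; apply/orP; left; apply/eqP.
    by field; rewrite gt_eqF.
  apply: ler_sum => o _; rewrite -Npid; exact: uinorm_moments_lb.
apply: (@le_trans _ _ (2 * sign_ov / n * (n * (19 / 27 * t) * N (pid_mx s)))).
  have -> : 2 * sign_ov / n * (n * (19 / 27 * t) * N (pid_mx s)) =
     (38 / 27 * sign_ov) * t * N (pid_mx s) by field; rewrite gt_eqF.
  by rewrite /q ler_wpM2r// ler_wpM2r ?(ltW t0)//; lra.
by rewrite ler_wpM2l// divr_ge0 ?mulr_ge0// ltW.
Qed.

End sign_prior.

(** * Transposition and assembly of the lower bound *)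

Section lower_bound.
Context d (T : measurableType d) (R : realType) (P : probability T R).

Lemma estimator_ex p m (f : borel_mx R p m -> borel_mx R p m) :
  measurable_fun setT f -> exists est : estimator R p m, est =1 f.
Proof.
by move=> mf; exists (mfun_Sub (mem_set mf)).
Qed.

Lemma measurable_mx_tr p m :
  measurable_fun setT (fun X : borel_mx R p m => X^T : borel_mx R m p).
Proof.
apply: measurable_funmx => i j.
rewrite (_ : (fun X => _) = (fun X : borel_mx R p m => X j i)); first exact: measurable_mxcoord.
by apply/funext => X; rewrite mxE.
Qed.

Lemma sparse_mx_tr p m k s (A : 'M[R]_(p, m)) : sparse_mx k s A -> sparse_mx s k A^T.
Proof.
move=> [hk hs]; split.
  rewrite (_ : [set i | _]%SET = [set j | col j A != 0]%SET)//.
  by apply/setP => j; rewrite !inE -tr_col trmx_eq0.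
rewrite (_ : [set i | _]%SET = [set j | row j A != 0]%SET)//.
by apply/setP => j; rewrite !inE -tr_row trmx_eq0.
Qed.

Section transposition.
Context (p m : nat) (Z : 'I_p * 'I_m -> {RV P >-> R}).

Definition noise_tr (ji : 'I_m * 'I_p) : {RV P >-> R} := Z (ji.2, ji.1).

Lemma noise_trE w : noise_mx noise_tr w = (noise_mx Z w)^T.
Proof. by apply/matrixP => i j; rewrite !mxE. Qed.

Lemma iid_noise_tr : iid_standard_normal Z -> iid_standard_normal noise_tr.
Proof.
move=> [ind law]; split; last by move=> ji A mA; exact: law.
move=> J A mA; pose sw (x : 'I_m * 'I_p) := (x.2, x.1).
pose A' (x : 'I_p * 'I_m) := A (x.2, x.1).
have swI : injective sw by move=> [? ?] [? ?] [-> ->].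
have := ind (sw @: J)%SET A' _.
have -> : \bigcap_(i in [set` (sw @: J)%SET]) Z i @^-1` A' i =
    \bigcap_(i in [set` J]) noise_tr i @^-1` A i.
  apply/seteqP; split => w h.
    move=> [j i] /= ij; have /= := h (i, j); apply.
    by apply/imsetP; exists (j, i).
  move=> [i j] /= /imsetP[[j' i'] jJ [-> ->]].
  exact: (h (j', i')).
move=> ->; last by move=> x /imsetP[[j i] ji ->]; exact: mA.
by rewrite big_imset /=; [apply: eq_bigr => -[j i] _|move=> x y _ _; exact: swI].
Qed.

(** Conjugation of an estimator by transposition. In this direction a lower bound for the transposed
    problem passes to the original one, which gives the column logarithm and the case [k < s]. *)
Lemma minimax_risk_tr k s (N : 'M[R]_(p, m) -> R) :
  (minimax_risk s k (fun A : 'M[R]_(m, p) => N A^T) noise_tr <= minimax_risk k s N Z)%E.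
Proof.
apply: le_ereal_inf_tmp => _ [est _ <-].
have [est' est'E] : exists est' : estimator R m p, est' =1 (fun X => (est X^T)^T).
  apply: estimator_ex.
  apply: (measurableT_comp (@measurable_mx_tr p m)).
  exact: (measurableT_comp (measurable_funP est) (@measurable_mx_tr m p)).
apply: (@le_trans _ _ (ereal_sup [set ('E_P[fun w => (N (est' (M + noise_mx noise_tr w) - M)^T ^+ 2)%R])%E | M in sparse_mx s k])).
  by apply: ereal_inf_lbound; exists est'.
apply: ge_ereal_sup => _ [M sM <-]; apply: ereal_sup_ubound.
exists M^T; first exact: sparse_mx_tr.
congr ('E_P[_])%E; apply/funext => w.
by rewrite est'E noise_trE linearB /= trmxK linearD /= trmxK.
Qed.

End transposition.

Lemma expR1_le4 : expR 1 <= 4 :> R.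
Proof.
have h : 1 / 2 <= expR (- (1 / 2)) :> R by apply: le_trans (expR_ge1Dx _); lra.
have e : expR (1 / 2) * expR (- (1 / 2)) = 1 :> R by rewrite -expRD addrN expR0.
have e0 := expR_gt0 (1 / 2 : R).
have h2 : expR (1 / 2) <= 2 :> R.
  have : expR (1 / 2) * (1 / 2) <= 1 :> R by rewrite -[leRHS]e ler_wpM2l// ltW.
  by lra.
have -> : expR 1 = expR (1 / 2) * expR (1 / 2) :> R by rewrite -expRD; congr expR; field.
by nra.
Qed.

(** With a ratio at most 64, [1 + ln 64 <= 1 + 64] by the crude bound [ln x <= x]. *)
Lemma log_le_ratio (a c : nat) : (0 < c <= a)%N -> (a %/ c < 64)%N ->
  ln (expR 1 * a%:R / c%:R) <= 65 :> R.
Proof.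
move=> /andP[c0 ca] ac; have cR : 0 < c%:R :> R by rewrite ltr0n.
have aR : 0 < a%:R :> R by rewrite ltr0n (leq_trans c0).
have x0 : 0 < a%:R / c%:R :> R by rewrite divr_gt0.
rewrite -mulrA lnM ?posrE ?expR_gt0// expRK.
have : a%:R / c%:R <= 64 :> R.
  rewrite ler_pdivrMr// -natrM ler_nat; apply: ltnW.
  by apply: (leq_trans (ltn_ceil a c0)); rewrite leq_mul2r ac orbT.
have : ln (a%:R / c%:R) <= a%:R / c%:R :> R.
  by have := expR_ge1Dx (ln (a%:R / c%:R : R)); rewrite lnK ?posrE//; lra.
by lra.
Qed.

Section bounds.
Context (p m k s : nat) (Z : 'I_p * 'I_m -> {RV P >-> R}) (N : 'M[R]_(p, m) -> R).
Hypotheses (iidZ : iid_standard_normal Z) (nN : is_norm N) (uN : unitarily_invariant N).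
Hypotheses (kp : (0 < k <= p)%N) (sm : (0 < s <= m)%N).
Local Notation L := (sparse_norm_sup k s N).
Local Notation V := (minimax_risk k s N Z).

(** The prior spreads a nearly maximal matrix over blocks of [b] positions with squared row length
    [ln (b / 8)], the largest that [sum_ov_lb] allows. The constant is [1024 = 64 * 4 * 4]: the row
    bound, the factor 2 in near-maximality squared, and the comparison of logarithms. *)
Lemma log_row_lower_bound : (64 <= p %/ k)%N ->
  ((L ^+ 2 * (k%:R * ln (expR 1 * p%:R / k%:R)) / 1024)%:E <= V)%E.
Proof.
move=> b64; set b := (p %/ k)%N; have [k0 kp'] := andP kp.
have kR : 0 < k%:R :> R by rewrite ltr0n.
have pR : 0 < p%:R :> R by rewrite ltr0n (leq_trans k0).
have bR : 64 <= b%:R :> R by rewrite (ler_nat _ 64).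
have ln8 : 0 <= ln (b%:R / 8 : R) by rewrite ln_ge0//; lra.
(* For [x = b / 8 >= 8] one has [4 * (b + 1) = 32 * x + 4 <= x ^+ 4]; this is what the threshold 64
   is for. *)
have lnb : ln (expR 1 * p%:R / k%:R) <= 4 * ln (b%:R / 8) :> R.
  rewrite -[4]/(4%:R) mulr_natl -lnXn; last by lra.
  have pb : p%:R / k%:R <= b%:R + 1 :> R.
    rewrite ler_pdivrMr// natr1 -natrM ler_nat mulnC.
    by apply: ltnW; rewrite mulnC; exact: ltn_ceil.
  rewrite ler_ln ?posrE; [|by rewrite !mulr_gt0 ?invr_gt0 ?expR_gt0|by rewrite exprn_gt0//; lra].
  rewrite -mulrA; apply: (@le_trans _ _ (4 * (b%:R + 1))).
    by apply: ler_pM => //; exact: expR1_le4.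
  set x := b%:R / 8 : R; have x8 : 8 <= x by rewrite /x; lra.
  have -> : 4 * (b%:R + 1) = 32 * x + 4 :> R by rewrite /x; field.
  have : 512 * x <= x ^+ 4.
    rewrite exprS mulrC ler_wpM2l//; first by lra.
    by rewrite (_ : 512 = 8 ^+ 3 :> R) ?lerXn2r ?nnegrE//; [lra|ring].
  by lra.
have [A [sA AA NA]] := sparse_norm_sup_near nN uN kp sm.
have [K0 [S [hK hS AE]]] := (sparse_mxP k s A).1 sA.
have [K K0K cK] : exists2 K : {set 'I_p}, K0 \subset K & #|K| = k.
  by apply: superset_card; rewrite hK card_ord.
have [f [fI fK]] := set_enumeration cK.
have EE := selmx_isometry R fI; set E := selmx R f in EE.
have EA : E *m (E^T *m A) = A.
  rewrite mulmxA (selmx_projmx R fI fK) {1}AE !mulmxA [in RHS]AE; congr (_ *m _ *m _).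
  apply/matrixP => i j; rewrite projmxE !mxE; case: ifPn => // iK.
  have -> : i \in K0 = false by apply: contraNF iK; apply: (fintype.subsetP K0K).
  by rewrite mul0rn.
have [U oU Urow] := equal_row_norms (E^T *m A).
pose eps : R := Num.sqrt (k%:R * ln (b%:R / 8)).
have ee : eps ^+ 2 = k%:R * ln (b%:R / 8) by rewrite sqr_sqrtr// mulr_ge0// ltW.
pose B := eps *: (U *m (E^T *m A)).
have BS : B = B *m projmx R S.
  rewrite /B -scalemxAl; congr (_ *: _); rewrite -!mulmxA; congr (_ *m (_ *m _)).
  rewrite {2}AE -!mulmxA mulmx_diag {1}AE -!mulmxA; congr (_ *m (_ *m _)).
  rewrite /projmx; congr diag_mx; apply/rowP => i; rewrite !mxE.
  by case: (i \in S); rewrite ?mulr1 ?mulr0.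
have Brow i : mxdot (row i B) (row i B) = ln (b%:R / 8).
  rewrite /B linearZ /= mxdotZl mxdotZr Urow mulrA -expr2 ee.
  have -> : mxdot (E^T *m A) (E^T *m A) = 1.
    by rewrite -(mxdot_isometryl _ _ EE) EA.
  by field; rewrite gt_eqF.
have kbp : (k * b <= p)%N by rewrite mulnC leq_trunc_div.
have eb : expR (ln (b%:R / 8)) <= b%:R / 8 :> R by rewrite lnK// posrE; lra.
have := row_lower_bound iidZ nN uN kbp hS BS Brow eb EE.
have -> : N (E *m B) = eps * N A.
  rewrite /B -scalemxAr (norm_scale nN) ger0_norm ?sqrtr_ge0//; congr (_ * _).
  (* The rotation that equalises the rows only changes the isometry in front, hence not the norm. *)
  have EU : (E *m U)^T *m (E *m U) = 1%:M.
    by rewrite trmx_mul mulmxA -(mulmxA U^T) EE mulmx1; exact: orthogonal_mxC.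
  by rewrite (mulmxA E U) (uinorm_isometryl _ nN uN EU EE) EA.
apply: le_trans; rewrite lee_fin exprMn ee.
have L0 : 0 < L := sparse_norm_sup_gt0 nN uN kp sm.
have LA : L ^+ 2 <= 4 * N A ^+ 2.
  rewrite (_ : 4 * _ = (2 * N A) ^+ 2); last by ring.
  by rewrite ler_sqr ?nnegrE ?mulr_ge0 ?(uinorm_ge0 nN) ?(ltW L0)//; lra.
have h1 : k%:R * ln (expR 1 * p%:R / k%:R) <= k%:R * (4 * ln (b%:R / 8)) :> R.
  by rewrite ler_wpM2l// ltW.
have h2 : L ^+ 2 * (k%:R * ln (expR 1 * p%:R / k%:R)) <= L ^+ 2 * (k%:R * (4 * ln (b%:R / 8))).
  by rewrite ler_wpM2l// sqr_ge0.
have h3 : L ^+ 2 * (k%:R * (4 * ln (b%:R / 8))) <= 4 * N A ^+ 2 * (k%:R * (4 * ln (b%:R / 8))).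
  by rewrite ler_wpM2r// !mulr_ge0// ltW.
by lra.
Qed.

End bounds.

(** [2048 = 2 * 1024] pays for the two logarithmic bounds, and [132 = 2 + 65 + 65] counts the uses
    of the sign bound: once for [k + s <= 2 * k], and once for each logarithm that is at most 65. *)
Definition lower_const : R := (2048 + 132 * 16 / expR (- 1) ^+ 2)^-1.

Lemma lower_const_gt0 : 0 < lower_const.
Proof.
have e0 : 0 < (expR (- 1) ^+ 2)^-1 :> R by rewrite invr_gt0 exprn_gt0 ?expR_gt0.
by rewrite invr_gt0; lra.
Qed.

Lemma rate_tr p m k s (N : 'M[R]_(p, m) -> R) :
  rate s k (fun A : 'M[R]_(m, p) => N A^T) = rate k s N.
Proof.
rewrite /rate minnC tr_pid_mx addnC [X in _ + _ * X]addrC; congr (_ + _ ^+ 2 * _).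
rewrite /sparse_norm_sup; congr sup; apply/seteqP; split => _ [A [sA A1] <-].
  exists A^T => //; split; first exact: sparse_mx_tr.
  by rewrite -A1 !frobenius_normE mxdot_tr.
exists A^T; last by rewrite trmxK.
split; first exact: sparse_mx_tr.
by rewrite -A1 !frobenius_normE mxdot_tr.
Qed.

Lemma rate_lower_bound_tall p m k s (Z : 'I_p * 'I_m -> {RV P >-> R}) (N : 'M[R]_(p, m) -> R) :
  iid_standard_normal Z -> is_norm N -> unitarily_invariant N ->
  (0 < k <= p)%N -> (0 < s <= m)%N -> (s <= k)%N ->
  ((lower_const * rate k s N)%:E <= minimax_risk k s N Z)%E.
Proof.
move=> iidZ nN uN kp sm sk; have [k0 kp'] := andP kp; have [s0 sm'] := andP sm.
have sign := sign_lower_bound iidZ nN uN s0 sk kp' sm'.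
have rows := @log_row_lower_bound p m k s Z N iidZ nN uN kp sm.
have cols := @log_row_lower_bound m p s k (noise_tr Z) (fun A => N A^T)
  (iid_noise_tr iidZ) (is_norm_tr nN) (unitarily_invariant_tr uN) sm kp.
have trV := minimax_risk_tr Z k s N.
have L0 := sparse_norm_sup_gt0 nN uN kp sm.
have LN := sparse_norm_sup_le nN uN kp sm.
rewrite (minn_idPr sk) in LN.
have LE : sparse_norm_sup s k (fun A : 'M[R]_(m, p) => N A^T) = sparse_norm_sup k s N.
  rewrite /sparse_norm_sup; congr sup; apply/seteqP; split => _ [A [sA A1] <-].
    by exists A^T => //; split; [exact: sparse_mx_tr|rewrite -A1 !frobenius_normE mxdot_tr].
  exists A^T; last by rewrite trmxK.
  by split; [exact: sparse_mx_tr|rewrite -A1 !frobenius_normE mxdot_tr].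
rewrite LE in cols.
have {}cols h := le_trans (cols h) trV.
set c1 : R := expR (-1) ^+ 2 / 16 in sign.
have c10 : 0 < c1 by rewrite divr_gt0// exprn_gt0// expR_gt0.
have kR : 0 < k%:R :> R by rewrite ltr0n.
have sR : 0 < s%:R :> R by rewrite ltr0n.
have skR : s%:R <= k%:R :> R by rewrite ler_nat.
case E : (minimax_risk k s N Z) sign rows cols => [v| |] sign rows cols; last 2 first.
- exact: leey.
- by move: sign; rewrite leNgt ltNyr.
rewrite !lee_fin in sign rows cols *.
rewrite /rate (minn_idPr sk); set L := sparse_norm_sup k s N in L0 LN rows cols *.
set Ns := N (pid_mx s) in LN sign *.
have Ns0 : 0 < Ns := lt_le_trans L0 LN.
have L2 : L ^+ 2 <= Ns ^+ 2 by rewrite ler_sqr ?nnegrE ?(ltW L0) ?(ltW Ns0).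
have L20 : 0 < L ^+ 2 by rewrite exprn_gt0.
have signv : k%:R * Ns ^+ 2 <= v / c1 by rewrite ler_pdivlMr// mulrC.
have v0 : 0 <= v.
  by apply: le_trans sign; rewrite !mulr_ge0 ?sqr_ge0// ltW.
have vc0 : 0 <= v / c1 by rewrite divr_ge0// ltW.
set l1 := ln (expR 1 * p%:R / k%:R) in rows *.
set l2 := ln (expR 1 * m%:R / s%:R) in cols *.
have h1 : Ns ^+ 2 * (k + s)%:R <= 2 * (v / c1).
  apply: (@le_trans _ _ (2 * (k%:R * Ns ^+ 2))); last by rewrite ler_wpM2l.
  rewrite natrD mulrC mulrA ler_wpM2r ?sqr_ge0//; lra.
have kL : k%:R * L ^+ 2 <= v / c1.
  by apply: le_trans signv; rewrite ler_wpM2l// ltW.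
have sL : s%:R * L ^+ 2 <= v / c1 by apply: le_trans kL; rewrite ler_wpM2r// ltW.
have h2 : L ^+ 2 * (k%:R * l1) <= 1024 * v + 65 * (v / c1).
  have [/rows h|pk] := leqP 64 (p %/ k); first by lra.
  have hl := log_le_ratio kp pk; rewrite -/l1 in hl.
  apply: (@le_trans _ _ (65 * (k%:R * L ^+ 2))); last by lra.
  rewrite (_ : L ^+ 2 * _ = l1 * (k%:R * L ^+ 2)); last by ring.
  by apply: ler_wpM2r hl; apply: mulr_ge0; [exact: ler0n|exact: ltW].
have h3 : L ^+ 2 * (s%:R * l2) <= 1024 * v + 65 * (v / c1).
  have [/cols h|pk] := leqP 64 (m %/ s); first by lra.
  have hl := log_le_ratio sm pk; rewrite -/l2 in hl.
  apply: (@le_trans _ _ (65 * (s%:R * L ^+ 2))); last by lra.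
  rewrite (_ : L ^+ 2 * _ = l2 * (s%:R * L ^+ 2)); last by ring.
  by apply: ler_wpM2r hl; apply: mulr_ge0; [exact: ler0n|exact: ltW].
rewrite /lower_const mulrC ler_pdivrMr; last by rewrite -invr_gt0; exact: lower_const_gt0.
have -> : 132 * 16 / expR (-1) ^+ 2 = 132 / c1 :> R.
  by rewrite /c1; field; rewrite gt_eqF// expR_gt0.
rewrite mulrDr (_ : v * (2048 + 132 / c1) = 2048 * v + 132 * (v / c1)); last by field; rewrite gt_eqF.
by lra.
Qed.

Lemma rate_lower_bound p m k s (Z : 'I_p * 'I_m -> {RV P >-> R}) (N : 'M[R]_(p, m) -> R) :
  iid_standard_normal Z -> is_norm N -> unitarily_invariant N ->
  (0 < k <= p)%N -> (0 < s <= m)%N ->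
  ((lower_const * rate k s N)%:E <= minimax_risk k s N Z)%E.
Proof.
move=> iidZ nN uN kp sm; have [sk|/ltnW ks] := leqP s k.
  exact: rate_lower_bound_tall.
rewrite -rate_tr; apply: le_trans (minimax_risk_tr Z k s N).
apply: rate_lower_bound_tall => //; [exact: iid_noise_tr|exact: is_norm_tr|exact: unitarily_invariant_tr].
Qed.

End lower_bound.

(** * Nets for low-rank matrices *)

Section nets.
Context (R : realType).

Lemma geometric_sum2 (N : nat) : \sum_(i < N) (2 ^-1) ^+ i <= 2 :> R.
Proof.
have h : \sum_(i < N) (2 ^-1) ^+ i = 2 - 2 * (2^-1) ^+ N :> R.
  elim: N => [|N ih]; first by rewrite big_ord0 expr0 mulr1 subrr.
  by rewrite big_ord_recr /= ih exprS; field.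
by rewrite h gerBl mulr_ge0// exprn_ge0// invr_ge0.
Qed.

(* Points of the grid of mesh 1/(4 sqrt n) in the ball of R^J, n = #|J|; each is
   stored as its signs together with the absolute values of its coordinates. *)
Definition grid (J : finType) (n : nat) :=
  {f : {ffun J -> bool * 'I_(16 * n).+1} | (\sum_j (f j).2 * (f j).2 <= 16 * n)%N}.

HB.instance Definition _ J n := Finite.on (grid J n).

(** On the grid the absolute coordinates sum to at most [16 * n], being integers below their
    squares. Hence [2 ^ (16 * n)] times the product of the weights [2 ^ (- z)] is at least 1, and
    the weights of one signed coordinate sum to at most 4. *)
Lemma card_grid (J : finType) : (#|{: grid J #|J|}| <= 2 ^ (18 * #|J|))%N.
Proof.
set n := #|J|; rewrite card_sig.
rewrite -(ler_nat R) -sum1_card natr_sum.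
pose w (x : bool * 'I_(16 * n).+1) : R := (2^-1) ^+ x.2.
have w0 x : 0 <= w x by rewrite exprn_ge0// invr_ge0.
apply: (@le_trans _ _ (\sum_(f : {ffun J -> bool * 'I_(16 * n).+1}) 2 ^+ (16 * n) * \prod_j w (f j))).
  rewrite big_mkcond; apply: ler_sum => f _; rewrite inE.
  case: ifPn => hf; last by rewrite mulr_ge0 ?exprn_ge0// prodr_ge0.
  rewrite /w prodrXr.
  have hs : (\sum_j (f j).2 <= 16 * n)%N.
    apply: leq_trans hf; apply: leq_sum => j _.
    by case: (nat_of_ord _) => // l; rewrite leq_pmulr.
  rewrite exprVn ler_pdivlMr ?exprn_gt0// mul1r.
  by apply: ler_weXn2l => //; rewrite ler1n.
rewrite -mulr_sumr -(bigA_distr_bigA (fun _ => w)) /=.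
rewrite prodr_const -/n.
have -> : (18 * n = 16 * n + 2 * n)%N by rewrite -mulnDl.
rewrite natrX exprD ler_wpM2l ?exprn_ge0// exprM lerXn2r ?nnegrE ?exprn_ge0 ?sumr_ge0//.
rewrite -(pair_bigA _ (fun b i => w (b, i))) /= big_bool /= /w /=.
have := geometric_sum2 (16 * n).+1; lra.
Qed.

(** Rounding the coordinates towards zero stays in the ball; each of the [n] squared errors is at
    most [1 / (16 * n)]. *)
Lemma ball_net (J : finType) :
  exists (A : finType) (h : A -> J -> R),
  [/\ (#|A| <= 2 ^ (18 * #|J|))%N, (forall a, \sum_j h a j ^+ 2 <= 1) &
      forall x : J -> R, \sum_j x j ^+ 2 <= 1 ->
        exists a, \sum_j (x j - h a j) ^+ 2 <= 1 / 16].
Proof.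
pose n := #|J|; pose rt : R := Num.sqrt (16 * n)%:R.
have rt2 : rt ^+ 2 = (16 * n)%:R by rewrite sqr_sqrtr.
have rt0 : 0 <= rt := sqrtr_ge0 _.
pose h (a : grid J n) j : R := (-1) ^+ (val a j).1 * (val a j).2%:R / rt.
have hE a j : h a j ^+ 2 = ((val a j).2 * (val a j).2)%:R / (16 * n)%:R.
  by rewrite /h exprMn exprVn rt2 exprMn sqrr_sign mul1r (natrM _ (val a j).2) -expr2.
exists (grid J n), h; split; first exact: card_grid.
  move=> a; rewrite (eq_bigr _ (fun j _ => hE a j)) -mulr_suml -natr_sum.
  have div_le1 (S l : nat) : (S <= l)%N -> S%:R / l%:R <= 1 :> R.
    case: l => [|l] hS; first by rewrite invr0 mulr0.
    by rewrite ler_pdivrMr ?ltr0n// mul1r ler_nat.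
  exact: div_le1 (valP a).
move=> x x1; pose z j := Num.truncn (`|x j| * rt).
have zP j : (z j)%:R <= `|x j| * rt < (z j).+1%:R by rewrite truncn_itv// mulr_ge0.
have z2 : (\sum_j z j * z j <= 16 * n)%N.
  rewrite -(ler_nat R) natr_sum -rt2; apply: (@le_trans _ _ (\sum_j x j ^+ 2 * rt ^+ 2)).
    apply: ler_sum => j _; have /andP[h1 _] := zP j.
    by rewrite natrM -expr2 -[x j ^+ 2]real_normK ?num_real// -exprMn lerXn2r ?nnegrE ?mulr_ge0.
  by rewrite -mulr_suml -[leRHS]mul1r ler_wpM2r ?sqr_ge0.
have zb j : (z j < (16 * n).+1)%N.
  rewrite ltnS; apply: leq_trans z2; rewrite (bigD1 j)//=; apply: leq_trans (leq_addr _ _).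
  by case: (z j) => // l; rewrite leq_pmulr.
pose f : {ffun J -> bool * 'I_(16 * n).+1} := [ffun j => (x j < 0, Ordinal (zb j))].
have fP : (\sum_j (f j).2 * (f j).2 <= 16 * n)%N.
  by apply: leq_trans z2; apply: leq_sum => j _; rewrite ffunE.
exists (exist _ f fP).
apply: (@le_trans _ _ (\sum_(j : J) (16 * n)%:R^-1)); last first.
  rewrite sumr_const -/n -[leLHS]mulr_natl natrM.
  have [->|n0] := posnP n; first by rewrite mul0r.
  by rewrite invfM mulrCA divff ?mulr1 ?mul1r// pnatr_eq0 -lt0n.
apply: ler_sum => j _; have n0 : 0 < (16 * n)%:R :> R.
  by rewrite ltr0n muln_gt0 /=; apply/card_gt0P; exists j.
have rtp : 0 < rt by rewrite sqrtr_gt0.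
have -> : x j - h (exist _ f fP) j = (-1) ^+ (x j < 0)%R * (`|x j| * rt - (z j)%:R) / rt.
  rewrite /h /= ffunE /= {1}[x j]numEsign.
  by field; rewrite gt_eqF.
rewrite exprMn exprVn rt2 exprMn sqrr_sign mul1r ler_piMl ?invr_ge0 ?(ltW n0)//.
have /andP[h1 h2] := zP j; rewrite -natr1 in h2.
by rewrite expr_le1//; lra.
Qed.

End nets.

Section low_rank_net.
Context (R : realType).

(** The first [j] left singular vectors span the columns of [X], completed when [X] is rank
    deficient, so that net points need not be independent. *)
Lemma orthonormal_hull (k j : nat) (X : 'M[R]_(k, j)) : (j <= k)%N ->
  exists2 Q : 'M[R]_(k, j), Q^T *m Q = 1%:M & Q *m (Q^T *m X) = X.
Proof.
move=> jk; have [U [V [d [oU oV XE _ _]]]] := svd X.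
have UU : U^T *m U = 1%:M by exact: orthogonal_mxC.
exists (U *m pid_mx j).
  by rewrite trmx_mul mulmxA -(mulmxA _ U^T) UU mulmx1 tr_pid_mx pid_mx_id// pid_mx_1.
rewrite {}XE trmx_mul -!mulmxA; congr (U *m _).
rewrite !mulmxA -(mulmxA _ U^T) UU mulmx1; congr (_ *m V).
rewrite tr_pid_mx pid_mx_id//; apply/matrixP => a b; rewrite mxE (bigD1 a)//= big1 ?addr0.
  rewrite !mxE eqxx /=; case: ltnP => aj; rewrite ?mul1r ?mul0r//.
  by case: eqP => // ab; move: aj; rewrite ab leqNgt ltn_ord.
move=> c ca; rewrite !mxE; case: eqP => [/val_inj ac|_]; last by rewrite mul0r.
by rewrite ac eqxx in ca.
Qed.

(** The projection on a space containing [x] loses at most the squared distance from [u] to [x];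
    expanding [|Q^T u - Q^T x|^2 >= 0] says so. *)
Lemma hull_approximation (k j n : nat) (Q : 'M[R]_(k, j)) (u x : 'M[R]_(k, n)) :
  Q^T *m Q = 1%:M -> Q *m (Q^T *m x) = x ->
  mxdot u u - mxdot (u - x) (u - x) <= mxdot (Q^T *m u) (Q^T *m u).
Proof.
move=> QQ Qx; have := mxdot_ge0 (Q^T *m u - Q^T *m x).
rewrite !mxdotBl !mxdotBr.
have -> : mxdot (Q^T *m x) (Q^T *m x) = mxdot x x by rewrite -(mxdot_isometryl _ _ QQ) Qx.
have -> : mxdot (Q^T *m u) (Q^T *m x) = mxdot u x by rewrite mxdot_mull trmxK Qx.
have -> : mxdot (Q^T *m x) (Q^T *m u) = mxdot u x by rewrite mxdotC mxdot_mull trmxK Qx.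
rewrite (mxdotC x u); lra.
Qed.

Lemma mxdot_mulmx_dgmx (n k s : nat) (G : 'M[R]_(n, k)) (d : nat -> R) :
  (forall i, (s <= i)%N -> d i = 0) ->
  mxdot (G *m dgmx k s d) (G *m dgmx k s d) = \sum_(l < k) d l ^+ 2 * mxdot (col l G) (col l G).
Proof.
move=> d0; rewrite mxdot_mulr -mulmxA.
have -> : dgmx k s d *m (dgmx k s d)^T = diag_mx (\row_l d l ^+ 2).
  apply/matrixP => a b; rewrite mxE (eq_bigr (fun c : 'I_s =>
    if c == a :> nat then d a * (d b *+ (a == b)) else 0)); last first.
    move=> c _; rewrite !mxE (eq_sym (a : nat)) (eq_sym (b : nat)) mulrnAl.
    by case: (@eqP _ (c : nat) a) => [->|_]; rewrite ?mulr1n ?mulr0n.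
  rewrite -big_mkcond !mxE; have [as_|sa] := ltnP a s.
    rewrite (big_pred1 (Ordinal as_)) => [|c//].
    by case: eqP => [->|_]; rewrite ?mulr1n ?expr2 ?mulr0n ?mulr0.
  by rewrite (d0 a sa) expr0n mul0rn big1// => c _; rewrite mul0r.
rewrite /mxdot exchange_big; apply: eq_bigr => l _.
rewrite mulr_sumr; apply: eq_bigr => i _.
by rewrite mul_mx_diag !mxE big_ord1 !mxE; ring.
Qed.

(** Two nets are combined: [j] points near the chosen left singular vectors determine a space [Q],
    and a net of the [j x s] ball approximates the direction of [Q^T W]. Their entropies are
    [18 * j * k] and [18 * j * s]. *)
Lemma svd_net (k s j : nat) : (j <= k)%N ->
  exists (A : finType) (b : A -> 'M[R]_(k, s)),
  [/\ (#|A| <= 2 ^ (18 * (j * (k + s))))%N, (forall a, mxdot (b a) (b a) <= 1) &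
    forall (U : 'M[R]_k) (V : 'M[R]_s) (d : nat -> R) (I : {set 'I_k}),
      orthogonal_mx U -> orthogonal_mx V -> (forall i, (s <= i)%N -> d i = 0) ->
      #|I| = j ->
      exists a, Num.sqrt (\sum_(i in I) d i ^+ 2) / 2 <=
                mxdot (U *m dgmx k s d *m V) (b a)].
Proof.
move=> jk.
have [A1 [h1 [cA1 _ net1]]] := ball_net R 'I_k.
have [A2 [h2 [cA2 h2b net2]]] := ball_net R ('I_j * 'I_s)%type.
pose X (f : {ffun 'I_j -> A1}) : 'M[R]_(k, j) := \matrix_(i, l) h1 (f l) i.
have /choice[Q QP] : forall f, exists Q : 'M[R]_(k, j), Q^T *m Q = 1%:M /\ Q *m (Q^T *m X f) = X f.
  by move=> f; have [Q] := orthonormal_hull (X f) jk; exists Q.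
pose Y a : 'M[R]_(j, s) := \matrix_(i, l) h2 a (i, l).
have Y1 a : mxdot (Y a) (Y a) <= 1.
  apply: le_trans (h2b a); rewrite /mxdot pair_bigA /= le_eqVlt; apply/orP; left.
  by apply/eqP; apply: eq_bigr => -[i l] _; rewrite !mxE expr2.
exists ({ffun 'I_j -> A1} * A2)%type, (fun a => Q a.1 *m Y a.2); split.
- rewrite card_prod card_ffun card_ord mulnDr mulnDr expnD leq_mul//.
    rewrite card_ord in cA1; rewrite mulnCA mulnC expnM.
    case: (j) => // j'; rewrite leq_exp2r//.
  by move: cA2; rewrite card_prod !card_ord.
- by move=> a; rewrite mxdot_isometryl ?Y1//; have [] := QP a.1.
move=> U V d I oU oV d0 cI.
have [e [eI eK]] := set_enumeration cI.
have UU : U^T *m U = 1%:M by exact: orthogonal_mxC.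
have colU l : mxdot (col l U) (col l U) = 1.
  have := congr1 (fun M : 'M[R]_k => M l l) UU; rewrite !mxE eqxx mulr1n => <-.
  by rewrite /mxdot; apply: eq_bigr => i _; rewrite big_ord1 !mxE.
have /choice[f fP] : forall l : 'I_j, exists a, \sum_i (U i (e l) - h1 a i) ^+ 2 <= 1 / 16.
  move=> l; apply: (net1 (fun i => U i (e l))); rewrite -[leRHS](colU (e l)) /mxdot.
  by rewrite le_eqVlt; apply/orP; left; apply/eqP; apply: eq_bigr => i _; rewrite big_ord1 !mxE expr2.
pose F := [ffun l => f l]; have [QQ QX] := QP F; set q := Q F in QQ QX.
have colQ i : i \in I -> 15 / 16 <= mxdot (q^T *m col i U) (q^T *m col i U).
  rewrite eK => /codomP[l ->].
  have qx : q *m (q^T *m col l (X F)) = col l (X F).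
    by rewrite !colE (mulmxA q^T) mulmxA QX.
  apply: le_trans (hull_approximation _ QQ qx); rewrite colU.
  have : mxdot (col (e l) U - col l (X F)) (col (e l) U - col l (X F)) <= 1 / 16.
    apply: le_trans (fP l); rewrite le_eqVlt; apply/orP; left; apply/eqP.
    by apply: eq_bigr => i' _; rewrite big_ord1 !mxE ffunE expr2.
  lra.
set W := U *m dgmx k s d *m V; set t := \sum_(i in I) d i ^+ 2.
have t0 : 0 <= t by apply: sumr_ge0 => i _; exact: sqr_ge0.
set T := q^T *m W; pose n := Num.sqrt (mxdot T T).
have n0 : 0 <= n := sqrtr_ge0 _.
have nn : n ^+ 2 = mxdot T T by rewrite sqr_sqrtr ?mxdot_ge0.
(* The energy of [Q^T W] splits over the left singular vectors of all of [W]; those outside [I] only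
   add to it. *)
have tn : 15 / 16 * t <= n ^+ 2.
  rewrite nn /T /W !mulmxA.
  have -> : mxdot (q^T *m U *m dgmx k s d *m V) (q^T *m U *m dgmx k s d *m V) =
    mxdot (q^T *m U *m dgmx k s d) (q^T *m U *m dgmx k s d) by exact: mxdot_orthr.
  rewrite mxdot_mulmx_dgmx// /t mulr_sumr big_mkcond; apply: ler_sum => i _.
  case: ifPn => iI; last by rewrite mulr_ge0 ?sqr_ge0 ?mxdot_ge0.
  by rewrite mulrC ler_wpM2l ?sqr_ge0// colE -mulmxA -colE colQ.
(* For [n = 0] the scaled matrix is 0 by the convention on inverses and still lies in the ball. *)
have [a2 a2P] : exists a2, mxdot (n^-1 *: T - Y a2) (n^-1 *: T - Y a2) <= 1 / 16.
  have [a2 h] : exists a2, \sum_il ((n^-1 *: T) il.1 il.2 - h2 a2 il) ^+ 2 <= 1 / 16.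
    apply: net2; rewrite -(pair_bigA _ (fun i l => ((n^-1 *: T) i l) ^+ 2)) /=.
    rewrite (_ : \sum_i _ = mxdot (n^-1 *: T) (n^-1 *: T)).
      rewrite mxdotZl mxdotZr -nn; have [->|n1] := eqVneq n 0; first by rewrite invr0 mul0r.
      by rewrite expr2 mulKf// mulVf.
    by apply: eq_bigr => i _; apply: eq_bigr => l _; rewrite expr2.
  exists a2; apply: le_trans h; rewrite /mxdot pair_bigA /= le_eqVlt; apply/orP; left; apply/eqP.
  by apply: eq_bigr => -[i l] _; rewrite !mxE expr2.
exists (F, a2) => /=; rewrite -/q mxdotC mxdot_mull mxdotC -/T.
have h3 : 3 / 4 * n <= mxdot T (Y a2).
  set D := n^-1 *: T - Y a2 in a2P.
  have TY : mxdot T (Y a2) = n - mxdot T D.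
    rewrite /D mxdotBr mxdotZr -nn; have [n1|n1] := eqVneq n 0.
      by rewrite n1 invr0 mul0r !sub0r opprK.
    by field.
  have := mxdot_CS T D; rewrite -nn => cs.
  have : mxdot T D <= n / 4.
    apply: le_trans (ler_norm _) _.
    rewrite -(@ler_pXn2r _ 2) ?nnegrE ?divr_ge0// real_normK ?num_real//.
    apply: le_trans cs _; rewrite exprMn ler_wpM2l ?sqr_ge0//; apply: le_trans a2P _; lra.
  rewrite TY; lra.
(* Squared, the claim is [1 / 4 <= 9 / 16 * (15 / 16)]. *)
apply: le_trans h3; rewrite -(@ler_pXn2r _ 2) ?nnegrE ?mulr_ge0 ?divr_ge0 ?sqrtr_ge0//.
rewrite !exprMn sqr_sqrtr//; lra.
Qed.

End low_rank_net.

(** * Splitting a matrix at a singular value threshold *)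

Section threshold.
Context (R : realType).

Lemma mxdot_mul_isometry (n p k : nat) (E : 'M[R]_(p, k)) (x : 'M[R]_(n, p)) :
  E^T *m E = 1%:M -> mxdot (x *m E) (x *m E) <= mxdot x x.
Proof.
move=> EE; have := mxdot_ge0 (x - x *m E *m E^T).
rewrite mxdotBl !mxdotBr mxdot_isometryr// (mxdotC x).
by rewrite (mxdot_mulr E^T) trmxK; lra.
Qed.

Lemma sparse_selmx2 (p m k s : nat) (f : 'I_k -> 'I_p) (g : 'I_s -> 'I_m) (X : 'M[R]_(k, s)) :
  injective f -> injective g -> sparse_mx k s (selmx R f *m X *m (selmx R g)^T).
Proof.
move=> fI gI; apply/sparse_mxP.
exists [set f i | i : 'I_k]%SET, [set g i | i : 'I_s]%SET.
split; rewrite ?card_imset ?card_ord//.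
rewrite -(selmx_projmx R fI); last by move=> x; apply/imsetP/codomP => -[i]; [move=> _ ->; exists i|move=> ->; exists i].
rewrite -(selmx_projmx R gI); last by move=> x; apply/imsetP/codomP => -[i]; [move=> _ ->; exists i|move=> ->; exists i].
by rewrite !mulmxA -(mulmxA (selmx R f) _ (selmx R f)) (selmx_isometry R fI) mulmx1
  -(mulmxA _ (selmx R g)^T (selmx R g)) (selmx_isometry R gI) mulmx1.
Qed.

(* The singular values at most t contribute through the operator norm, the
   others through the Frobenius norm. *)
Lemma uinorm_threshold (p m k s : nat) (N : 'M[R]_(p, m) -> R)
    (f : 'I_k -> 'I_p) (g : 'I_s -> 'I_m) (W : 'M[R]_(k, s)) (t : R) :
  is_norm N -> unitarily_invariant N -> (0 < k <= p)%N -> (0 < s <= m)%N ->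
  injective f -> injective g -> 0 <= t ->
  exists (U : 'M[R]_k) (V : 'M[R]_s) (d : nat -> R) (I : {set 'I_k}),
  [/\ [/\ orthogonal_mx U, orthogonal_mx V & forall i, (s <= i)%N -> d i = 0],
      W = U *m dgmx k s d *m V, t ^+ 2 * #|I|%:R <= \sum_(i in I) d i ^+ 2 &
      N (selmx R f *m W *m (selmx R g)^T) <=
      t * N (pid_mx (minn k s)) + sparse_norm_sup k s N * Num.sqrt (\sum_(i in I) d i ^+ 2)].
Proof.
move=> nN uN kp sm fI gI t0; have [U [V [d [oU oV WE dpos d0]]]] := svd W.
have dge i : 0 <= d i by have [/dpos/ltW//|/d0 ->] := ltnP i (\rank W).
have ds i : (s <= i)%N -> d i = 0.
  by move=> si; apply: d0; apply: leq_trans si; exact: rank_leq_col.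
pose I := [set i : 'I_k | t < d i]%SET.
pose d1 i := if t < d i then 0 else d i.
pose d2 i := if t < d i then d i else 0.
set E := selmx R f; set F := selmx R g.
have EE : E^T *m E = 1%:M by exact: selmx_isometry.
have FF : F^T *m F = 1%:M by exact: selmx_isometry.
exists U, V, d, I; split=> //.
  rewrite -sumr_const mulr_sumr; apply: ler_sum => i; rewrite inE => ti.
  by rewrite mulr1 ler_sqr ?nnegrE// ltW.
have -> : E *m W *m F^T = E *m (U *m dgmx k s d1 *m V) *m F^T + E *m (U *m dgmx k s d2 *m V) *m F^T.
  rewrite -mulmxDl -mulmxDr -mulmxDl -mulmxDr -dgmxD WE; congr (_ *m (_ *m dgmx _ _ _ *m _) *m _).
  by apply/funext => i; rewrite /d1 /d2; case: ifP; rewrite ?add0r ?addr0.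
apply: le_trans (norm_triangle nN _ _) _; apply: lerD.
  apply: uinorm_op_bound => //.
    apply: leq_trans (mxrankM_maxl _ _) _; apply: leq_trans (mxrankM_maxr _ _) _.
    by rewrite leq_min rank_leq_row rank_leq_col.
  move=> x; rewrite !mulmxA mxdot_isometryr// mxdot_orthr// mxdot_mulmx_dgmx; last first.
    by move=> i /ds di; rewrite /d1 di; case: ifP.
  apply: (@le_trans _ _ (t ^+ 2 * mxdot (x *m E *m U) (x *m E *m U))).
    rewrite [X in t ^+ 2 * X]/mxdot exchange_big mulr_sumr; apply: ler_sum => l _.
    have -> : \sum_i (x *m E *m U) i l * (x *m E *m U) i l =
        mxdot (col l (x *m E *m U)) (col l (x *m E *m U)).
      by rewrite /mxdot; apply: eq_bigr => i _; rewrite big_ord1 !mxE.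
    rewrite ler_wpM2r ?mxdot_ge0// /d1; case: ltP => h; first by rewrite expr0n sqr_ge0.
    by rewrite ler_sqr ?nnegrE.
  by rewrite ler_wpM2l ?sqr_ge0// mxdot_orthr// mxdot_mul_isometry.
apply: le_trans (uinorm_sparse_sup nN uN kp sm (sparse_selmx2 _ fI gI)) _.
rewrite -/E -/F mxdot_isometryr// mxdot_isometryl// mxdot_orthr// mxdot_orthl//.
rewrite mxdot_dgmx; last by move=> i /ds di; rewrite /d2 di; case: ifP.
rewrite [X in _ <= _ * Num.sqrt X]big_mkcond /= le_eqVlt; apply/orP; left; apply/eqP.
congr (_ * Num.sqrt _); apply: eq_bigr => i _; rewrite inE /d2.
by case: ifP; rewrite ?mul0r ?expr2.
Qed.

End threshold.

(** * Nets over all supports *)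

Section sparse_nets.
Context (R : realType).

(** One term of the binomial expansion of [(1 + k / p) ^+ p], which is at most [expR k]. *)
Lemma bin_le_expR (p k : nat) : (0 < k <= p)%N ->
  'C(p, k)%:R <= expR (k%:R * ln (expR 1 * p%:R / k%:R)) :> R.
Proof.
move=> /andP[k0 kp]; have kR : 0 < k%:R :> R by rewrite ltr0n.
have pR : 0 < p%:R :> R by rewrite ltr0n (leq_trans k0).
have x0 : 0 < k%:R / p%:R :> R by rewrite divr_gt0.
rewrite expRM_natl lnK ?posrE; last by rewrite !mulr_gt0 ?invr_gt0 ?expR_gt0.
rewrite -mulrA exprMn -expRM_natl mulr1 -invf_div exprVn ler_pdivlMr ?exprn_gt0//.
apply: (@le_trans _ _ ((1 + k%:R / p%:R) ^+ p)).
  rewrite exprDn (bigD1 (Ordinal (kp : k < p.+1)%N))//= expr1n mul1r.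
  rewrite (mulr_natl ((k%:R / p%:R) ^+ k)) lerDl.
  by apply: sumr_ge0 => i _; rewrite expr1n mul1r mulrn_wge0// exprn_ge0// ltW.
apply: (@le_trans _ _ (expR (k%:R / p%:R) ^+ p)).
  by rewrite lerXn2r ?nnegrE ?expR_ge0 ?expR_ge1Dx// addr_ge0// ltW.
by rewrite -expRM_natl mulrCA divff ?mulr1// gt_eqF.
Qed.

Lemma log_rate_ge (p k : nat) : (0 < k <= p)%N ->
  k%:R <= k%:R * ln (expR 1 * p%:R / k%:R) :> R.
Proof.
move=> /andP[k0 kp]; have kR : 0 < k%:R :> R by rewrite ltr0n.
rewrite -[leLHS]mulr1 ler_wpM2l// -[leLHS](@expRK R) ler_ln ?posrE ?expR_gt0//.
  by rewrite -mulrA ler_peMr ?expR_ge0// ler_pdivlMr// mul1r ler_nat.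
by rewrite !mulr_gt0 ?invr_gt0 ?expR_gt0// ltr0n (leq_trans k0).
Qed.

(** Index [j] stands for [j.+1] singular values above the threshold, and [x] is their Frobenius
    norm. The lists depend on neither [X] nor its support, which allows the union bound. *)
Lemma sparse_net (p m k s : nat) (N : 'M[R]_(p, m) -> R) :
  is_norm N -> unitarily_invariant N -> (0 < k <= p)%N -> (0 < s <= m)%N ->
  exists l : 'I_k -> seq 'M[R]_(p, m),
  [/\ forall j, (size (l j) <= 'C(p, k) * 'C(m, s) * 2 ^ (18 * (j.+1 * (k + s))))%N,
      forall j B, B \in l j -> mxdot B B <= 1 &
      forall (X : 'M[R]_(p, m)) (K : {set 'I_p}) (S : {set 'I_m}) (t : R),
        #|K| = k -> #|S| = s -> 0 <= t ->
        exists2 x : R, N (projmx R K *m X *m projmx R S) <=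
          t * N (pid_mx (minn k s)) + sparse_norm_sup k s N * x &
          x = 0 \/ exists j : 'I_k, exists2 B, B \in l j &
            0 <= x /\ t ^+ 2 * j.+1%:R <= x ^+ 2 /\ x <= 2 * mxdot B X].
Proof.
move=> nN uN kp sm.
have /choice[b bP] : forall j : 'I_k, exists b : seq 'M[R]_(k, s),
  [/\ (size b <= 2 ^ (18 * (j.+1 * (k + s))))%N, (forall B, B \in b -> mxdot B B <= 1) &
    forall (U : 'M[R]_k) (V : 'M[R]_s) (d : nat -> R) (I : {set 'I_k}),
      orthogonal_mx U -> orthogonal_mx V -> (forall i, (s <= i)%N -> d i = 0) ->
      #|I| = j.+1 ->
      exists2 B, B \in b & Num.sqrt (\sum_(i in I) d i ^+ 2) / 2 <=
                mxdot (U *m dgmx k s d *m V) B].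
  move=> j; have [A [b [cA b1 bA]]] := @svd_net R k s j.+1 (ltn_ord j).
  exists [seq b a | a : A]; split; first by rewrite size_map -cardE.
    by move=> B /mapP[a _ ->].
  move=> U V d I oU oV d0 cI; have [a ha] := bA U V d I oU oV d0 cI.
  by exists (b a) => //; apply: map_f; rewrite mem_enum.
pose TK := {K : {set 'I_p} | #|K| == k}; pose TS := {S : {set 'I_m} | #|S| == s}.
have /choice[f fP] : forall K : TK, exists f : 'I_k -> 'I_p, injective f /\ val K =i codom f.
  by move=> [K cK]; apply: set_enumeration; exact/eqP.
have /choice[g gP] : forall S : TS, exists g : 'I_s -> 'I_m, injective g /\ val S =i codom g.
  by move=> [S cS]; apply: set_enumeration; exact/eqP.
pose lift (KS : TK * TS) (B : 'M[R]_(k, s)) := selmx R (f KS.1) *m B *m (selmx R (g KS.2))^T.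
exists (fun j => [seq lift KS B | KS <- enum {: TK * TS}, B <- b j]); split.
- move=> j; rewrite size_allpairs leq_mul//; last by have [] := bP j.
  rewrite -cardE card_prod !card_sig.
  have cd n (i : nat) : #|[pred K : {set 'I_n} | #|K| == i]| = 'C(n, i).
    by rewrite -[in RHS](card_ord n) -card_draws; apply: eq_card => K; rewrite !inE.
  by rewrite !cd.
- move=> j B /allpairsP[[KS C] [_ Cb ->]] /=.
  rewrite /lift mxdot_isometryr; last by apply: selmx_isometry; have [] := gP KS.2.
  rewrite mxdot_isometryl; last by apply: selmx_isometry; have [] := fP KS.1.
  by have [_ /(_ C Cb)] := bP j.
move=> X K S t /eqP cK /eqP cS t0.
pose KS : TK * TS := (exist _ K cK, exist _ S cS).
have [fI fK] := fP KS.1; have [gI gS] := gP KS.2.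
set E := selmx R (f KS.1); set F := selmx R (g KS.2).
have [U [V [d [I [[oU oV d0] WE tI NW]]]]] :=
  uinorm_threshold (E^T *m X *m F) nN uN kp sm fI gI t0.
exists (Num.sqrt (\sum_(i in I) d i ^+ 2)).
  apply: le_trans NW; rewrite -/E -/F !mulmxA (selmx_projmx R fI fK).
  by rewrite -(mulmxA _ F) (selmx_projmx R gI gS).
have s0 : 0 <= \sum_(i in I) d i ^+ 2 by apply: sumr_ge0 => i _; exact: sqr_ge0.
case cI : #|I| => [|j].
  by left; move/eqP: cI; rewrite cards_eq0 => /eqP ->; rewrite big_set0 sqrtr0.
have jk : (j < k)%N by rewrite -cI -[leqRHS]card_ord max_card.
right; exists (Ordinal jk).
have [_ _ /(_ U V d I oU oV d0 cI)[B Bb hB]] := bP (Ordinal jk).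
exists (lift KS B); first by apply/allpairsP; exists (KS, B); rewrite mem_enum.
rewrite sqrtr_ge0 sqr_sqrtr// -cI; split=> //; split=> //.
rewrite mulrC -ler_pdivrMr//; apply: le_trans hB _; rewrite -WE.
by rewrite mxdot_mulr mxdot_mull trmxK (mxdotC (lift KS B)) mulmxA.
Qed.

End sparse_nets.

(** * Moments of the restricted noise *)

Section noise_moment.
Context d (T : measurableType d) (R : realType) (P : probability T R).
Context (p m : nat) (Z : 'I_p * 'I_m -> {RV P >-> R}).
Hypothesis iidZ : iid_standard_normal Z.

(** A smooth majorant of [x ^+ 2] on the event [a <= x <= 2 * mxdot B X]. It is integrable in closed
    form, so expectations are bounded without tail probabilities. *)
Definition exp_tail (a : R) (B X : 'M[R]_(p, m)) : R :=
  a ^+ 2 * expR (a / 8 * (2 * mxdot B X - a)).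

Lemma exp_tail_ge0 a B X : 0 <= exp_tail a B X.
Proof. by rewrite mulr_ge0 ?sqr_ge0 ?expR_ge0. Qed.

Lemma measurable_exp_tail a B :
  measurable_fun setT (exp_tail a B : borel_mx R p m -> R).
Proof.
apply: measurable_funM => //; apply: measurableT_comp => //.
apply: measurable_funM => //; apply: measurable_funB => //.
by apply: measurable_funM => //; exact: measurable_mxdot.
Qed.

(** From [x / a <= expR ((x - a) / a)], squared; the exponent [2 / a] is then replaced by [a / 8],
    which is where [4 <= a] enters. *)
Lemma sqr_le_exp_tail (a x : R) B X : 4 <= a -> a <= x -> x <= 2 * mxdot B X ->
  x ^+ 2 <= exp_tail a B X.
Proof.
move=> a4 ax xB; have a0 : 0 < a by lra.
have x0 : 0 < x by lra.
have xa : x <= a * expR ((x - a) / a).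
  rewrite mulrC -ler_pdivrMr//; apply: le_trans (expR_ge1Dx _).
  by rewrite mulrBl divff ?gt_eqF// addrC subrK.
apply: (@le_trans _ _ ((a * expR ((x - a) / a)) ^+ 2)).
  by rewrite ler_sqr ?nnegrE ?(ltW x0) ?mulr_ge0 ?expR_ge0 ?(ltW a0).
rewrite exprMn -expRM_natl /exp_tail ler_wpM2l ?sqr_ge0// ler_expR.
apply: (@le_trans _ _ (a / 8 * (x - a))); last first.
  by rewrite ler_wpM2l ?divr_ge0 ?(ltW a0)// lerB.
rewrite mulrA mulrAC ler_wpM2r ?subr_ge0// ler_pdivrMr//.
by nra.
Qed.

(** The Laplace transform at [a / 4 *: B] contributes at most [a ^+ 2 / 32], against [- a ^+ 2 / 8]
    from the constant term. *)
Lemma integral_exp_tail a B : 0 <= a -> mxdot B B <= 1 ->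
  (\int[P]_w (exp_tail a B (noise_mx Z w))%:E <= (a ^+ 2 * expR (- (3 / 32 * a ^+ 2)))%:E)%E.
Proof.
move=> a0 B1; pose c := a ^+ 2 * expR (- (a ^+ 2 / 8)).
have c0 : 0 <= c by rewrite mulr_ge0 ?sqr_ge0 ?expR_ge0.
have e0 w : setT w -> (0 <= (expR (mxdot ((a / 4) *: B) (noise_mx Z w)))%:E)%E.
  by move=> _; rewrite lee_fin expR_ge0.
have me : measurable_fun setT (fun w => (expR (mxdot ((a / 4) *: B) (noise_mx Z w)))%:E).
  apply/measurable_EFinP; apply: measurableT_comp => //.
  exact: (measurableT_comp (measurable_mxdot _) (measurable_noise Z)).
have -> : (\int[P]_w (exp_tail a B (noise_mx Z w))%:E =
    c%:E * \int[P]_w (expR (mxdot ((a / 4) *: B) (noise_mx Z w)))%:E)%E.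
  rewrite -(ge0_integralZl_EFin P measurableT e0 me c0).
  apply: eq_integral => w _; rewrite -EFinM /exp_tail /c -(mulrA (a ^+ 2)) -expRD mxdotZl.
  by congr (_ * expR _)%:E; field.
rewrite integral_mxdot_expR// -EFinM lee_fin /c -(mulrA (a ^+ 2)) -expRD ler_wpM2l ?sqr_ge0//.
rewrite ler_expR mxdotZl mxdotZr.
have : a ^+ 2 * mxdot B B <= a ^+ 2 by rewrite ler_piMr ?sqr_ge0.
by lra.
Qed.

Lemma integral_affine_le (f : borel_mx R p m -> R) (b c0 c1 : R) :
  measurable_fun setT f -> (forall X, 0 <= f X) -> 0 <= c0 -> 0 <= c1 ->
  (\int[P]_w (f (noise_mx Z w))%:E <= b%:E)%E ->
  (\int[P]_w (c0 + c1 * f (noise_mx Z w))%:E <= (c0 + c1 * b)%:E)%E.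
Proof.
move=> mf f0 c00 c10 hf.
have f0' w : setT w -> (0 <= (f (noise_mx Z w))%:E)%E by move=> _; rewrite lee_fin.
have mf' : measurable_fun setT (fun w => (f (noise_mx Z w))%:E).
  by apply/measurable_EFinP; exact: (measurableT_comp mf (measurable_noise Z)).
have g0 w : setT w -> (0 <= (c1 * f (noise_mx Z w))%:E)%E.
  by move=> _; rewrite lee_fin mulr_ge0.
have mg : measurable_fun setT (fun w => (c1 * f (noise_mx Z w))%:E).
  by apply/measurable_EFinP; apply: measurable_funM => //; exact/measurable_EFinP.
have h0 (w : T) : setT w -> (0 <= cst c0%:E w :> \bar R)%E by move=> _; rewrite lee_fin.
have mh : measurable_fun setT (cst c0%:E : T -> \bar R) by exact: measurable_cst.
have -> : (\int[P]_w (c0 + c1 * f (noise_mx Z w))%:E =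
    c0%:E + c1%:E * \int[P]_w (f (noise_mx Z w))%:E)%E.
  rewrite -(ge0_integralZl_EFin P measurableT f0' mf' c10).
  transitivity (\int[P]_w (cst c0%:E w) + \int[P]_w (c1 * f (noise_mx Z w))%:E)%E.
    rewrite -(ge0_integralD P measurableT h0 mh g0 mg).
    by apply: eq_integral => w _; rewrite EFinD.
  congr (_ + _)%E; rewrite integral_cst// -[RHS]mule1; congr (_ * _)%E.
  exact: probability_setT.
by rewrite EFinD EFinM leeD2l// lee_wpmul2l// lee_fin.
Qed.

Lemma integral_sum_exp_tail (k : nat) (l : 'I_k -> seq 'M[R]_(p, m)) (a : 'I_k -> R) (b : R) :
  (forall j, 0 <= a j) -> (forall j B, B \in l j -> mxdot B B <= 1) ->
  \sum_(j < k) (size (l j))%:R * (a j ^+ 2 * expR (- (3 / 32 * a j ^+ 2))) <= b ->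
  (\int[P]_w (\sum_(j < k) \sum_(B <- l j) exp_tail (a j) B (noise_mx Z w))%:E <= b%:E)%E.
Proof.
move=> a0 l1 hb.
have me j B : measurable_fun setT (fun w => (exp_tail (a j) B (noise_mx Z w))%:E).
  by apply/measurable_EFinP; exact: (measurableT_comp (measurable_exp_tail _ _) (measurable_noise Z)).
rewrite (_ : (fun w => _) = (fun w => \sum_(j < k) \sum_(B <- l j)
    (exp_tail (a j) B (noise_mx Z w))%:E)%E); last first.
  by apply/funext => w; rewrite -sumEFin; apply: eq_bigr => j _; rewrite -sumEFin.
rewrite ge0_integral_sum//; last 2 first.
- by move=> j; apply: emeasurable_sum.
- by move=> j w _; apply: sume_ge0 => B _; rewrite lee_fin exp_tail_ge0.
apply: (@le_trans _ _ (\sum_(j < k) ((size (l j))%:R * (a j ^+ 2 * expR (- (3 / 32 * a j ^+ 2))))%:E)%E); last first.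
  by rewrite sumEFin lee_fin.
apply: lee_sum => j _; rewrite ge0_integral_sum//; last first.
  by move=> B w _; rewrite lee_fin exp_tail_ge0.
apply: (@le_trans _ _ (\sum_(B <- l j) (a j ^+ 2 * expR (- (3 / 32 * a j ^+ 2)))%:E)%E).
  rewrite big_seq [leRHS]big_seq; apply: lee_sum => B Bl.
  by apply: integral_exp_tail => //; exact: l1 Bl.
by rewrite sumEFin lee_fin big_const_seq count_predT iter_addr addr0 -[leLHS]mulr_natl.
Qed.

End noise_moment.

(** * Integrable envelope of the restricted noise *)

Section envelope.
Context d (T : measurableType d) (R : realType) (P : probability T R).
Context (p m k s : nat) (Z : 'I_p * 'I_m -> {RV P >-> R}) (N : 'M[R]_(p, m) -> R).
Hypotheses (iidZ : iid_standard_normal Z) (nN : is_norm N) (uN : unitarily_invariant N).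
Hypotheses (kp : (0 < k <= p)%N) (sm : (0 < s <= m)%N).
Local Notation n := ((k + s)%:R : R).
Local Notation H := (k%:R * ln (expR 1 * p%:R / k%:R) + s%:R * ln (expR 1 * m%:R / s%:R) : R).

(* [a j ^+ 2] is the mean of [608 * H] and [608 * j.+1 * n], so it is at most
   [x ^+ 2] as soon as both are. *)
Lemma tail_sum_le (l : 'I_k -> seq 'M[R]_(p, m)) (a : 'I_k -> R) :
  (forall j, (size (l j) <= 'C(p, k) * 'C(m, s) * 2 ^ (18 * (j.+1 * (k + s))))%N) ->
  (forall j, a j ^+ 2 = 304 * (H + j.+1%:R * n)) ->
  \sum_(j < k) (size (l j))%:R * (a j ^+ 2 * expR (- (3 / 32 * a j ^+ 2))) <= 32.
Proof.
move=> hl ha.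
have Hn : n <= H by rewrite natrD lerD// log_rate_ge.
have e2 : 2 <= expR 1 :> R by apply: le_trans (expR_ge1Dx _); rewrite -natr1.
apply: (@le_trans _ _ (\sum_(j < k) 32 * expR (- n))).
  apply: ler_sum => j _.
  set Jn := j.+1%:R * n; have Jn1 : n <= Jn by rewrite ler_peMl// ler1n.
  have sz : (size (l j))%:R <= expR (H + 18 * Jn) :> R.
    apply: (@le_trans _ _ ('C(p, k)%:R * 'C(m, s)%:R * 2 ^+ (18 * (j.+1 * (k + s))))).
      by rewrite -natrX -!natrM ler_nat.
    rewrite expRD ler_pM//; first by rewrite expRD ler_pM// bin_le_expR.
    rewrite (_ : 18 * Jn = (18 * (j.+1 * (k + s)))%:R * 1); last by rewrite mulr1 !natrM.
    by rewrite expRM_natl lerXn2r// nnegrE ?expR_ge0.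
  (* A third of the exponent tames the factor [a j ^+ 2]; the rest is [304 * 2 / 32 = 19], one more
     than the 18 needed against the entropy of the net. *)
  have tl : a j ^+ 2 * expR (- (3 / 32 * a j ^+ 2)) <= 32 * expR (- (19 * (H + Jn))).
    have -> : - (3 / 32 * a j ^+ 2) = - (a j ^+ 2 / 32) + - (19 * (H + Jn)).
      by rewrite ha -/Jn; field.
    rewrite expRD mulrA ler_wpM2r ?expR_ge0// expRN ler_pdivrMr ?expR_gt0//.
    have := expR_ge1Dx (a j ^+ 2 / 32); lra.
  apply: (@le_trans _ _ (expR (H + 18 * Jn) * (32 * expR (- (19 * (H + Jn)))))).
    by apply: ler_pM => //; rewrite mulr_ge0 ?sqr_ge0 ?expR_ge0.
  rewrite mulrCA -expRD ler_wpM2l// ler_expR.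
  have n0 : 0 <= n by [].
  by lra.
rewrite sumr_const card_ord -[leLHS]mulr_natl mulrCA ler_piMr//.
rewrite expRN ler_pdivrMr ?expR_gt0// mul1r; apply: le_trans (expR_ge1Dx _).
by rewrite natrD; have : 0 <= s%:R :> R by []; lra.
Qed.

(** One measurable function dominates all supports at once, so the measurability of a supremum is
    avoided. The constant is [1280 = 2 * 608 + 2 * 32], the last term being the total mass of the
    tails. *)
Lemma noise_envelope : exists G : borel_mx R p m -> R,
  [/\ measurable_fun setT G,
      forall (X : 'M[R]_(p, m)) (K : {set 'I_p}) (S : {set 'I_m}), #|K| = k -> #|S| = s ->
        N (projmx R K *m X *m projmx R S) ^+ 2 <= G X &
      (\int[P]_w (G (noise_mx Z w))%:E <= (1280 * rate k s N)%:E)%E].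
Proof.
have [l [szl l1 hl]] := sparse_net nN uN kp sm.
have Hn : n <= H by rewrite natrD lerD// log_rate_ge.
have n1 : 1 <= n by rewrite ler1n addn_gt0; case/andP: kp => ->.
pose a (j : 'I_k) : R := Num.sqrt (304 * (H + j.+1%:R * n)).
have aa j : a j ^+ 2 = 304 * (H + j.+1%:R * n).
  have jn : 0 <= j.+1%:R * n by rewrite mulr_ge0.
  by rewrite sqr_sqrtr; lra.
have a0 j : 0 <= a j := sqrtr_ge0 _.
have a4 j : 4 <= a j.
  rewrite -ler_sqr ?nnegrE// aa.
  have : 0 <= j.+1%:R * n by rewrite mulr_ge0.
  by lra.
pose t : R := Num.sqrt (608 * n).
have tt : t ^+ 2 = 608 * n by rewrite sqr_sqrtr; lra.
pose Nr := N (pid_mx (minn k s)); pose L := sparse_norm_sup k s N.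
have Nr0 : 0 <= Nr by exact: uinorm_ge0 nN _.
have L0 : 0 < L := sparse_norm_sup_gt0 nN uN kp sm.
have [tail [mtail tail0 tailB htail]] : exists tail : borel_mx R p m -> R,
    [/\ measurable_fun setT tail, forall X, 0 <= tail X,
        forall j B X, B \in l j -> exp_tail (a j) B X <= tail X &
        (\int[P]_w (tail (noise_mx Z w))%:E <= (32%R : R)%:E)%E].
  exists (fun X => \sum_(j < k) \sum_(B <- l j) exp_tail (a j) B X); split.
  - by apply: measurable_sum => j; apply: measurable_sum => B; exact: measurable_exp_tail.
  - by move=> X; apply: sumr_ge0 => j _; apply: sumr_ge0 => B _; exact: exp_tail_ge0.
  - move=> j B X Bl; rewrite (bigD1 j)//= (perm_big _ (perm_to_rem Bl)) big_cons -addrA lerDl.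
    rewrite addr_ge0//; first by apply: sumr_ge0 => C _; exact: exp_tail_ge0.
    by apply: sumr_ge0 => i _; apply: sumr_ge0 => C _; exact: exp_tail_ge0.
  - have hs := tail_sum_le szl aa.
    exact: (integral_sum_exp_tail iidZ a0 l1 hs).
pose c0 := 2 * t ^+ 2 * Nr ^+ 2 + 2 * L ^+ 2 * (608 * H).
have c00 : 0 <= c0.
  have H0 : 0 <= 608 * H by lra.
  by apply: addr_ge0; apply: mulr_ge0 => //; rewrite mulr_ge0 ?sqr_ge0.
have c10 : 0 <= 2 * L ^+ 2 by rewrite mulr_ge0 ?sqr_ge0.
exists (fun X => c0 + 2 * L ^+ 2 * tail X); split.
- by apply: measurable_funD => //; apply: measurable_funM.
- move=> X K S cK cS.
  have [x NX hx] := hl X K S t cK cS (sqrtr_ge0 _).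
  rewrite -/Nr -/L in NX.
  (* Either [x ^+ 2] is below the entropy level, or it exceeds both [608 * H] and [608 * j.+1 * n],
     hence their mean [a j ^+ 2], and a single term of [tail] dominates it. *)
  have xtail : x ^+ 2 <= 608 * H + tail X.
    case: hx => [->|[j [B Bl [x0 [tx xB]]]]].
      by have := tail0 X; rewrite expr0n /=; lra.
    have [xH|Hx] := leP (x ^+ 2) (608 * H).
      by have := tail0 X; lra.
    apply: (@le_trans _ _ (tail X)); last by lra.
    have ax : a j <= x.
      rewrite -ler_sqr ?nnegrE// aa; rewrite tt in tx; lra.
    exact: (le_trans (sqr_le_exp_tail (a4 j) ax xB) (tailB _ _ _ Bl)).
  have N0 : 0 <= N (projmx R K *m X *m projmx R S) by exact: uinorm_ge0 nN _.
  apply: (@le_trans _ _ ((t * Nr + L * x) ^+ 2)).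
    by rewrite ler_sqr ?nnegrE// (le_trans N0).
  apply: (@le_trans _ _ (2 * (t * Nr) ^+ 2 + 2 * (L ^+ 2 * x ^+ 2))).
    by rewrite -exprMn; have := sqr_ge0 (t * Nr - L * x); lra.
  have := ler_wpM2l (sqr_ge0 L) xtail.
  by rewrite /c0 exprMn; lra.
apply: (le_trans (integral_affine_le mtail tail0 c00 c10 htail)).
rewrite lee_fin /c0 tt /rate -/Nr -/L.
have h1 : 0 <= Nr ^+ 2 * n by rewrite mulr_ge0 ?sqr_ge0.
have h2 : L ^+ 2 <= L ^+ 2 * H by rewrite ler_peMr ?sqr_ge0//; lra.
by lra.
Qed.

End envelope.

(** * The upper bound *)

Section selection.
Context (R : realType).

(** The first admissible index of an enumeration is chosen, with [y0] as default when there is none;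
    this makes a minimiser over supports an estimator. *)
Lemma measurable_selection d (T : measurableType d) d' (T' : measurableType d')
    (I : finType) (A : I -> T -> bool) (F : I -> T -> T') (y0 : T') :
  (forall i, measurable_fun setT (A i)) -> (forall i, measurable_fun setT (F i)) ->
  exists g : T -> T', measurable_fun setT g /\
    forall x, (exists i, A i x) -> exists i, A i x /\ g x = F i x.
Proof.
move=> mA mF.
suff [g [mg gP]] : exists g : T -> T', measurable_fun setT g /\
    forall x, (exists2 i, i \in enum I & A i x) -> exists i, A i x /\ g x = F i x.
  by exists g; split=> // x [i Ai]; apply: gP; exists i; rewrite ?mem_enum.
elim: (enum I) => [|i r [g [mg gP]]]; first by exists (cst y0); split=> // x [].
exists (fun x => if A i x then F i x else g x); split; first exact: measurable_fun_ifT.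
move=> x [j]; rewrite inE; case: ifP => [Ai _ _|nAi]; first by exists i.
by case/predU1P => [->|jr Aj]; [rewrite nAi|apply: gP; exists j].
Qed.

Lemma measurable_all d (T : measurableType d) (I : Type) (r : seq I) (A : I -> T -> bool) :
  (forall i, measurable_fun setT (A i)) -> measurable_fun setT (fun x => all (A^~ x) r).
Proof.
move=> mA; elim: r => [|i r ih]; first exact: measurable_cst.
exact: measurable_and.
Qed.

Lemma measurable_bigmax d (T : measurableType d) (I : Type) (r : seq I) (Q : pred I)
    (F : I -> T -> R) : (forall i, measurable_fun setT (F i)) ->
  measurable_fun setT (fun x => \big[Num.max/0]_(i <- r | Q i) F i x).
Proof.
move=> mF; elim: r => [|i r ih].
  by rewrite (_ : (fun x => _) = cst 0)//; apply/funext => x; rewrite big_nil.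
case Qi : (Q i); last first.
  by rewrite (_ : (fun x => _) = (fun x => \big[Num.max/0]_(i <- r | Q i) F i x))//;
    apply/funext => x; rewrite big_cons Qi.
rewrite (_ : (fun x => _) = F i \max (fun x => \big[Num.max/0]_(i <- r | Q i) F i x)).
  exact: measurable_maxr.
by apply/funext => x; rewrite big_cons Qi.
Qed.

Context (p m k s : nat) (N : 'M[R]_(p, m) -> R).
Hypotheses (nN : is_norm N) (uN : unitarily_invariant N).
Local Notation mx := (borel_mx R p m).
Local Notation supp := ({set 'I_p} * {set 'I_m})%type.

Definition restrict_mx (KS : supp) (A : 'M[R]_(p, m)) : 'M[R]_(p, m) :=
  projmx R KS.1 *m A *m projmx R KS.2.

Lemma restrict_mxE KS A i j : restrict_mx KS A i j =
  if j \in KS.2 then if i \in KS.1 then A i j else 0 else 0.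
Proof. by rewrite mulmx_projmxE projmxE. Qed.

Lemma restrict_mxD KS A B : restrict_mx KS (A + B) = restrict_mx KS A + restrict_mx KS B.
Proof. by rewrite /restrict_mx mulmxDr mulmxDl. Qed.

Lemma restrict_mxB KS A B : restrict_mx KS (A - B) = restrict_mx KS A - restrict_mx KS B.
Proof. by rewrite /restrict_mx mulmxBr mulmxBl. Qed.

Lemma uinorm_restrict KS A : N (restrict_mx KS A) <= N A.
Proof.
have b01 (b : bool) : `|b%:R| <= 1 :> R by case: b; rewrite ?normr1 ?normr0.
apply: le_trans (uinorm_contractr _ nN uN _) _ => [i|]; first by rewrite mxE.
by apply: uinorm_contractl => // i; rewrite mxE.
Qed.

Lemma measurable_restrict KS : measurable_fun setT (restrict_mx KS : mx -> mx).
Proof.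
apply: measurable_funmx => i j.
rewrite (_ : (fun X => _) = (fun X : mx =>
    if j \in KS.2 then if i \in KS.1 then X i j else 0 else 0)).
  by case: (j \in KS.2) => //; case: (i \in KS.1) => //; exact: measurable_mxcoord.
by apply/funext => X; rewrite restrict_mxE.
Qed.

Definition valid_supp (KS : supp) := (#|KS.1| == k) && (#|KS.2| == s).

(** The residual is seen only through supports of the true size, since its full norm would contain
    the noise of all entries. The default 0 of the maximum is harmless because norms are
    nonnegative. *)
Definition criterion (Y : 'M[R]_(p, m)) (KS : supp) : R :=
  \big[Num.max/0]_(KS' : supp | valid_supp KS') N (restrict_mx KS' (Y - restrict_mx KS Y)).

Lemma measurable_criterion KS : measurable_fun setT (criterion^~ KS : mx -> R).
Proof.
apply: measurable_bigmax => KS'; apply: (measurableT_comp (measurable_uinorm nN)).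
apply: (measurableT_comp (measurable_restrict KS')).
apply: measurable_funmx => i j.
rewrite (_ : (fun X => _) = (fun X : mx => X i j - restrict_mx KS X i j)).
  apply: measurable_funB; first exact: measurable_mxcoord.
  exact: (measurableT_comp (@measurable_mxcoord R p m i j) (measurable_restrict KS)).
by apply/funext => X; rewrite !mxE.
Qed.

Section loss.
Context (M X : 'M[R]_(p, m)) (xi : R) (KS0 : supp).
Hypotheses (xi0 : 0 <= xi) (v0 : valid_supp KS0) (ME : M = restrict_mx KS0 M).
Hypothesis hxi : forall KS, valid_supp KS -> N (restrict_mx KS X) <= xi.

(** On the true support the residual is pure noise minus its restriction, and both have restrictions
    of norm at most [xi]. *)
Lemma criterion_true_support : criterion (M + X) KS0 <= 2 * xi.
Proof.
apply: bigmax_le => [|KS vKS]; first by rewrite mulr_ge0.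
have -> : M + X - restrict_mx KS0 (M + X) = X - restrict_mx KS0 X.
  by rewrite restrict_mxD -ME opprD addrACA subrr add0r.
rewrite restrict_mxB; apply: le_trans (uinormB nN _ _) _.
have := hxi vKS; have := le_trans (uinorm_restrict KS _) (hxi v0); lra.
Qed.

(** The error [D] is the noise minus the residual, so each of its restrictions costs [xi + 2 * xi].
    It lives on the union of two rectangles, which four further restrictions of valid ones cover. *)
Lemma selected_support_loss (KS1 : supp) : valid_supp KS1 ->
  criterion (M + X) KS1 <= 2 * xi -> N (restrict_mx KS1 (M + X) - M) <= 12 * xi.
Proof.
move=> v1 hc; set D := restrict_mx KS1 (M + X) - M.
have hD KS : valid_supp KS -> N (restrict_mx KS D) <= 3 * xi.
  move=> vKS; have -> : D = X - (M + X - restrict_mx KS1 (M + X)).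
    by apply/matrixP => i j; rewrite /D !mxE; ring.
  rewrite restrict_mxB; apply: le_trans (uinormB nN _ _) _.
  have := le_bigmax_cond 0 (fun KS' => N (restrict_mx KS' (M + X - restrict_mx KS1 (M + X)))) vKS.
  have := hxi vKS; rewrite /criterion in hc; lra.
have M0 i j : ~~ ((i \in KS0.1) && (j \in KS0.2)) -> M i j = 0.
  by rewrite ME restrict_mxE; case: (i \in KS0.1) => //; case: (j \in KS0.2).
pose Sc : supp := (finset.setTfor 'I_p, finset.setC KS0.2).
pose Kc : supp := (finset.setC KS0.1, finset.setTfor 'I_m).
pose KSc : supp := (finset.setC KS0.1, finset.setC KS0.2).
(* The matrix is cut according to membership in the true row and column sets; outside the true
   rectangle [D] vanishes off the selected one, which allows mixing true rows with selected columns
   and conversely. *)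
have DE : D = restrict_mx KS0 D + restrict_mx Sc (restrict_mx (KS0.1, KS1.2) D) +
    restrict_mx Kc (restrict_mx (KS1.1, KS0.2) D) +
    restrict_mx KSc (restrict_mx KS1 D).
  apply/matrixP => i j; rewrite 3![in RHS]mxE !restrict_mxE /= !inE /D mxE restrict_mxE [(- M) i j]mxE.
  have := M0 i j.
  case: (i \in KS0.1); case: (j \in KS0.2) => /= M0ij;
    rewrite ?(M0ij isT); case: (i \in KS1.1); case: (j \in KS1.2);
    by rewrite ?subr0 ?addr0 ?add0r.
have v01 : valid_supp (KS0.1, KS1.2).
  by move: v0 v1 => /andP[a _] /andP[_ b]; rewrite /valid_supp a b.
have v10 : valid_supp (KS1.1, KS0.2).
  by move: v0 v1 => /andP[_ a] /andP[b _]; rewrite /valid_supp a b.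
rewrite DE; apply: le_trans (norm_triangle nN _ _) _.
have h1 := hD _ v0; have h2 := le_trans (uinorm_restrict Sc _) (hD _ v01).
have h3 := le_trans (uinorm_restrict Kc _) (hD _ v10).
have h4 := le_trans (uinorm_restrict KSc _) (hD _ v1).
have := norm_triangle nN (restrict_mx KS0 D + restrict_mx Sc (restrict_mx (KS0.1, KS1.2) D))
  (restrict_mx Kc (restrict_mx (KS1.1, KS0.2) D)).
have := norm_triangle nN (restrict_mx KS0 D) (restrict_mx Sc (restrict_mx (KS0.1, KS1.2) D)).
lra.
Qed.

End loss.

End selection.

Section upper_bound.
Context d (T : measurableType d) (R : realType) (P : probability T R).

(** The loss bound holds pointwise in the noise with [xi] the square root of the envelope, so only
    [144 = 12 ^+ 2] times the mean of the envelope remains. *)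
Lemma rate_upper_bound (p m k s : nat) (Z : 'I_p * 'I_m -> {RV P >-> R}) (N : 'M[R]_(p, m) -> R) :
  iid_standard_normal Z -> is_norm N -> unitarily_invariant N ->
  (0 < k <= p)%N -> (0 < s <= m)%N ->
  (minimax_risk k s N Z <= (144 * (1280 * rate k s N))%:E)%E.
Proof.
move=> iidZ nN uN kp sm; have [k0 kp'] := andP kp; have [s0 sm'] := andP sm.
have [G [mG hG intG]] := noise_envelope iidZ nN uN kp sm.
pose supp := ({set 'I_p} * {set 'I_m})%type.
(* The selection runs over supports of exact size; a smaller true support is enlarged, which does
   not alter the restriction of [M]. *)
have extend (K : {set 'I_p}) (S : {set 'I_m}) : (#|K| <= k)%N -> (#|S| <= s)%N ->
    exists KS : supp, [/\ valid_supp k s KS, K \subset KS.1 & S \subset KS.2].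
  move=> hK hS.
  have [K' KK' cK] : exists2 K' : {set 'I_p}, K \subset K' & #|K'| = k.
    by apply: superset_card; rewrite hK card_ord.
  have [S' SS' cS] : exists2 S' : {set 'I_m}, S \subset S' & #|S'| = s.
    by apply: superset_card; rewrite hS card_ord.
  by exists (K', S'); rewrite /valid_supp /= cK cS !eqxx.
have [KS' [v' _ _]] : exists KS : supp, [/\ valid_supp k s KS, finset.set0 \subset KS.1 & finset.set0 \subset KS.2].
  by apply: extend; rewrite cards0.
have hG' X (KS : supp) : valid_supp k s KS -> N (restrict_mx KS X) <= Num.sqrt (G X).
  move=> /andP[/eqP cK /eqP cS]; rewrite -[leLHS]ger0_norm ?(uinorm_ge0 nN)// -sqrtr_sqr.
  by rewrite ler_wsqrtr// hG.
have G0 X : 0 <= G X.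
  have /andP[/eqP cK /eqP cS] := v'.
  exact: le_trans (sqr_ge0 _) (hG X KS'.1 KS'.2 cK cS).
pose A (KS : supp) (Y : borel_mx R p m) := valid_supp k s KS &&
  all (fun KS' => criterion k s N Y KS <= criterion k s N Y KS') (enum [pred KS | valid_supp k s KS]).
have mA KS : measurable_fun setT (A KS).
  apply: measurable_and; first exact: measurable_cst.
  apply: (measurable_all (T := borel_mx R p m) _
    (A := fun KS' Y => criterion k s N Y KS <= criterion k s N Y KS')) => KS2.
  by apply: measurable_fun_ler; exact: measurable_criterion.
have [f [mf fP]] := measurable_selection (T' := borel_mx R p m) (0%R : 'M[R]_(p, m)) mA (@measurable_restrict R p m).
have [est estE] := estimator_ex mf.
have selP M X KS0 : valid_supp k s KS0 -> M = restrict_mx KS0 M ->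
    N (est (M + X) - M) <= 12 * Num.sqrt (G X).
  move=> v0 ME; rewrite estE.
  have [|KS1 [/andP[v1 /allP hmin] ->]] := fP (M + X).
    case: (@arg_minP _ _ _ KS0 (valid_supp k s) (criterion k s N (M + X)) v0) => KS1 v1 hmin.
    exists KS1; rewrite /A v1 /=; apply/allP => KS2; rewrite mem_enum => v2; exact: hmin.
  have hxi := hG' X; have sG := sqrtr_ge0 (G X).
  apply: (selected_support_loss nN uN v0 ME hxi v1).
  apply: le_trans (criterion_true_support nN uN sG v0 ME hxi).
  by apply: hmin; rewrite mem_enum.
apply: le_trans (ereal_inf_lbound _) _; first by exists est.
apply: ge_ereal_sup => _ [M sM <-]; rewrite unlock.
have [K0 [S0 [hK hS ME]]] := (sparse_mxP k s M).1 sM.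
have [KS0 [v0 KK SS]] := extend K0 S0 hK hS.
have ME0 : M = restrict_mx KS0 M.
  apply/matrixP => i j; rewrite restrict_mxE ME mulmx_projmxE projmxE.
  case: (boolP (j \in S0)) => [jS|]; last by case: ifP => //; case: ifP.
  rewrite (fintype.subsetP SS _ jS); case: (boolP (i \in K0)) => [iK|]; last by case: ifP.
  by rewrite (fintype.subsetP KK _ iK).
have mnoise := measurable_noise Z.
have c10 : 0 <= 144 :> R by rewrite ler0n.
have := integral_affine_le mG G0 (lexx 0) c10 intG.
rewrite [X in (X%:E)%E]add0r; apply: le_trans.
apply: ge0_le_integral => //.
- by move=> w _; rewrite lee_fin sqr_ge0.
- apply/measurable_EFinP/measurable_funX.
  apply: (measurableT_comp (measurable_uinorm nN)).
  apply: (measurableT_comp (measurable_mxtranslate (- M))).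
  apply: (measurableT_comp (measurable_funP est)).
  rewrite (_ : (fun w => _) = (fun w => noise_mx Z w + M)).
    exact: (measurableT_comp (measurable_mxtranslate M) mnoise).
  by apply/funext => w; rewrite addrC.
- apply/measurable_EFinP/measurable_funD => //; apply: measurable_funM => //.
  exact: (measurableT_comp mG mnoise).
- move=> w _; rewrite lee_fin add0r.
  have h := selP M (noise_mx Z w) KS0 v0 ME0.
  have N0 : 0 <= N (est (M + noise_mx Z w) - M) by exact: uinorm_ge0 nN _.
  have := ler_pM N0 N0 h h; rewrite -!expr2 exprMn sqr_sqrtr// => h2.
  by apply: le_trans h2 _; rewrite le_eqVlt; apply/orP; left; apply/eqP; ring.
Qed.

End upper_bound.

Lemma lower_const_le1 (R : realType) : lower_const R <= 1.
Proof.
have e0 : 0 < (expR (- 1) ^+ 2)^-1 :> R by rewrite invr_gt0 exprn_gt0 ?expR_gt0.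
by rewrite invf_le1; lra.
Qed.

Theorem theorem1 (R : realType) :
  exists c C : R, [/\ 0 < c, c <= C &
    forall (p m k s : nat) (N : 'M[R]_(p, m) -> R)
      (d : measure_display) (T : measurableType d) (P : probability T R)
      (Z : 'I_p * 'I_m -> {RV P >-> R}),
      (0 < p)%N -> (0 < m)%N ->
      (1 <= k <= p)%N -> (1 <= s <= m)%N ->
      is_norm N -> unitarily_invariant N ->
      iid_standard_normal Z ->
      ((c * rate k s N)%:E <= minimax_risk k s N Z)%E /\
      (minimax_risk k s N Z <= (C * rate k s N)%:E)%E].
Proof.
exists (lower_const R), (144 * 1280); split; first exact: lower_const_gt0.
  by apply: le_trans (lower_const_le1 R) _; lra.
move=> p m k s N d T P Z _ _ kp sm nN uN iidZ; split; first exact: rate_lower_bound.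
by rewrite -mulrA; exact: rate_upper_bound.
Qed.
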